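(* Let $\mathcal{U}\subset\mathbb{R}^m$ be finite and let $p:\mathcal{U}_{pc}\to PC([0,+\infty[,\mathbb{R}^{\mathrm{p}})$ be an input-output map. If $p$ has a realization by a recurrent neural network with input space $\mathcal{U}$ whose activation function satisfies Assumption (A1), then $p$ is causal, $p$ is analytic, and $\mathrm{trdeg}\,\mathcal{A}_{obs}(p)<+\infty$.
   Context: $PC([0,+\infty[,X)$ is the set of piecewise-continuous functions $[0,+\infty[\to X$, and $\mathcal{U}_{pc}$ is the set of piecewise-constant functions $[0,+\infty[\to\mathcal{U}$. An input-output map is any map $p:\mathcal{U}_{pc}\to PC([0,+\infty[,\mathbb{R}^{\mathrm{p}})$. Recurrent neural network (RNN): $\Sigma=(A,B,C,\mathcal{U},\sigma,x_0)$ with $A\in\mathbb{R}^{n\times n}$, $B\in\mathbb{R}^{n\times m}$, $C\in\mathbb{R}^{\mathrm{p}\times n}$, $x_0\in\mathbb{R}^n$, and $\sigma:\mathbb{R}\to\mathbb{R}$ continuous and globally Lipschitz (the activation function), denotes the system $\dot x(t)=\overrightarrow{\sigma}(Ax(t)+Bu(t))$, $x(0)=x_0$, $y(t)=Cx(t)$, where $\overrightarrow{\sigma}$ applies $\sigma$ componentwise. A solution is a triple $(x,u,y)$ with $u\in PC([0,+\infty[,\mathcal{U})$, $x:[0,+\infty[\to\mathbb{R}^n$ absolutely continuous, $y:[0,+\infty[\to\mathbb{R}^{\mathrm{p}}$, satisfying these equations; for each $u$ it exists and is unique. $\Sigma$ is a realization of $p$ if for every $u\in\mathcal{U}_{pc}$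 the unique solution $(x,u,y)$ with $x(0)=x_0$ satisfies $p(u)=y$. Assumption (A1) on $\sigma$: $\sigma$ is real analytic and there exist an integer $N>0$, real analytic functions $\xi_1,\dots,\xi_N:\mathbb{R}\to\mathbb{R}$ and real polynomials $U_0,\dots,U_N,V_0,\dots,V_N$ in $N$ variables such that $V_k(\xi_1,\dots,\xi_N)$ is not the zero function for $0\le k\le N$, $\sigma\, V_0(\xi_1,\dots,\xi_N)=U_0(\xi_1,\dots,\xi_N)$, and $\dot\xi_i\, V_i(\xi_1,\dots,\xi_N)=U_i(\xi_1,\dots,\xi_N)$ for $1\le i\le N$. Causal: for all $t\ge0$ and $u,v\in\mathcal{U}_{pc}$ with $u=v$ on $[0,t]$, one has $p(u)=p(v)$ on $[0,t]$. Analytic: for all $k\in\{1,\dots,\mathrm{p}\}$, $l>0$ and $\alpha_1,\dots,\alpha_l\in\mathcal{U}$, the function $([0,+\infty[)^l\to\mathbb{R}$, $(t_1,\dots,t_l)\mapsto p_k(u)(T_l)$ is analytic, where $T_0=0$, $T_i=\sum_{j=1}^i t_j$, and $u(t)=\alpha_i$ for $t\in[T_{i-1},T_i[$, $i=1,\dots,l$, and $u(t)=\alpha_l$ for $t\ge T_l$. $\mathcal{A}(\mathcal{U}_{pc})$ is the real algebra (pointwise operations) of causal analytic maps $\mathcal{U}_{pc}\to PC([0,+\infty[,\mathbb{R})$; it is an integral domain. For $\varphi\in\mathcal{A}(\mathcal{U}_{pc})$ and $\alpha\in\mathcal{U}$, $D_\alpha\varphi\in\mathcal{A}(\mathcal{U}_{pc})$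 is defined by $(D_\alpha\varphi(u))(t)=\frac{d}{ds}\varphi(u_\alpha)(t+s)|_{s=0}$ (right derivative, $s\ge0$), where $u_\alpha(\tau)=u(\tau)$ for $\tau\in[0,t[$ and $u_\alpha(\tau)=\alpha$ for $\tau\ge t$. For a causal analytic $p$ with components $p_1,\dots,p_{\mathrm{p}}$, the observation algebra $\mathcal{A}_{obs}(p)$ is the smallest subalgebra of $\mathcal{A}(\mathcal{U}_{pc})$ that contains $p_1,\dots,p_{\mathrm{p}}$ and is closed under $D_\alpha$ for all $\alpha\in\mathcal{U}$. $\mathrm{trdeg}\,S$ of an integral domain $S$ over $\mathbb{R}$ is the transcendence degree over $\mathbb{R}$ of its field of fractions. *)

(* Defs.v *)
From HB Require Import structures.
From mathcomp Require Import all_boot all_order all_algebra.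
From mathcomp Require Import -(notations) mpoly.
From mathcomp Require Import all_classical all_reals all_analysis.
From mathcomp.analysis.showcase Require summability.

Set Implicit Arguments.
Unset Strict Implicit.
Unset Printing Implicit Defensive.

Import Order.TTheory GRing.Theory Num.Theory.
Import numFieldNormedType.Exports.

Local Open Scope classical_set_scope.
Local Open Scope ring_scope.

Section TimeAxis.
Context {R : realType}.

Lemma max0_ge0 (x : R) : 0 <= Num.max 0 x.
Proof. by rewrite le_max lexx. Qed.

Definition time_of (x : R) : {nonneg R} := NngNum (max0_ge0 x).

(* Constant continuation to the negative reals, so that (dis)continuity and
   limits of f on [0, +oo[ are those of [ext f] at the points t >= 0. *)
Definition ext {X : Type} (f : {nonneg R} -> X) (x : R) : X := f (time_of x).

(* Finitely many discontinuities on bounded intervals, with finite one-sided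
   limits everywhere. *)
Definition piecewise_continuous {X : topologicalType} (f : {nonneg R} -> X) :=
  [/\ forall T : R,
        finite_set [set t : R | 0 <= t <= T /\ ~ {for t, continuous (ext f)}],
      forall t : R, 0 < t -> exists l : X, ext f x @[x --> t^'-] --> l
    & forall t : R, 0 <= t -> exists l : X, ext f x @[x --> t^'+] --> l].

Definition PC (X : topologicalType) : set ({nonneg R} -> X) :=
  [set f | piecewise_continuous f].

(* Absolute continuity on every interval [0, T]. *)
Definition locally_abs_continuous {n} (x : {nonneg R} -> 'cV[R]_n) :=
  forall (T : R) (e : R), 0 < e -> exists2 d : R, 0 < d &
    forall (k : nat) (a b : 'I_k -> {nonneg R}),
      (forall i, (a i)%:num <= (b i)%:num <= T) ->
      trivIset setT (fun i => [set` `](a i)%:num, (b i)%:num[]) ->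
      \sum_i ((b i)%:num - (a i)%:num) < d ->
      \sum_i `|x (b i) - x (a i)| < e.

End TimeAxis.

Arguments PC {R} X _.

Section Analytic.
Context {R : realType}.

Definition real_analytic (f : R -> R) := forall a : R,
  exists (r : R) (c : nat -> R), 0 < r /\
    forall x, `|x - a| < r ->
      [series c k * (x - a) ^+ k]_k @ \oo --> f x.

(* Near each point a of D, f coincides on D with the sum of a power series in
   x - a, summed unconditionally (hence absolutely) over all multi-indices. *)
Definition analytic_on (l : nat) (D : set 'rV[R]_l) (f : 'rV[R]_l -> R) :=
  forall a, D a ->
  exists (r : R) (c : {ffun 'I_l -> nat} -> R), 0 < r /\
    forall x, D x -> `|x - a| < r ->
      summability.partial_sum
        (fun nu => c nu * \prod_(i < l) (x 0 i - a 0 i) ^+ nu i)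
        @ summability.totally --> f x.

Definition orthant (l : nat) : set 'rV[R]_l := [set t | forall i, 0 <= t 0 i].

End Analytic.

Arguments orthant {R} l _.

Section Inputs.
Context {R : realType} {m : nat} (U : set 'cV[R]_m).

(* Right-continuous: on [0, T] there is a finite set F of switching times and u
   is constant on every interval [a, b] such that ]a, b] does not meet F. *)
Definition Upc : set ({nonneg R} -> 'cV[R]_m) :=
  [set u | (forall t, U (u t)) /\
     forall T : R, exists2 F : set R, finite_set F &
       forall a b : {nonneg R}, a%:num <= b%:num <= T ->
         (forall s, F s -> ~ (a%:num < s <= b%:num)) -> u a = u b].

Definition splice_fun (u : {nonneg R} -> 'cV[R]_m) (t : {nonneg R})
    (alpha : 'cV[R]_m) : {nonneg R} -> 'cV[R]_m :=
  fun tau => if tau < t then u tau else alpha.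

Lemma splice_subproof (u : Upc) (t : {nonneg R}) (alpha : U) :
  splice_fun (val u) t (val alpha) \in Upc.
Proof.
case: u => u /=; rewrite inE => -[uU upc]; apply/mem_set; split.
  move=> s; rewrite /splice_fun; case: ifP => // _.
  by have := valP alpha; rewrite inE.
move=> T; have [F finF HF] := upc T.
exists (F `|` [set t%:num]); first by rewrite finite_setU.
move=> a b /andP[ab bT] noF; rewrite /splice_fun.
have ltE (c d : {nonneg R}) : (c < d) = (c%:num < d%:num) by [].
rewrite !ltE; case: (ltP b%:num t%:num) => bt.
  rewrite (le_lt_trans ab bt); apply: HF; first by rewrite ab.
  by move=> s Fs; apply: noF; left.
case: ltP => // lt_at; exfalso.
by apply: (noF t%:num); [right|rewrite lt_at].
Qed.

(* u_alpha: follows u on [0, t[ and is equal to alpha from t on. *)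
Definition splice (u : Upc) (t : {nonneg R}) (alpha : U) : Upc :=
  SigSub (splice_subproof u t alpha).

(* T_i = t_1 + ... + t_i, where t_j is the entry of index j - 1 of t. *)
Definition switch_time {l} (t : 'rV[R]_l) (i : nat) : R :=
  \sum_(j < l | (j < i)%N) t 0 j.

(* The number of pieces is l.+1; the value alpha_i, i >= 1, has index i - 1. *)
Definition switch_fun {l} (alpha : 'I_l.+1 -> U) (t : 'rV[R]_l.+1)
    (tau : {nonneg R}) : 'cV[R]_m :=
  if [pick i : 'I_l.+1 | switch_time t i <= tau%:num < switch_time t i.+1]
  is Some i then val (alpha i) else val (alpha ord_max).

Lemma switch_subproof {l} (alpha : 'I_l.+1 -> U) (t : 'rV[R]_l.+1) :
  switch_fun alpha t \in Upc.
Proof.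
apply/mem_set; split.
  move=> s; rewrite /switch_fun.
  by case: pickP => [i _|_];
    [have := valP (alpha i)|have := valP (alpha ord_max)]; rewrite inE.
move=> T; exists (range (fun i : 'I_l.+2 => switch_time t i)).
  exact: finite_image.
move=> a b /andP[ab _] noF; rewrite /switch_fun.
have leE (i : 'I_l.+2) : (switch_time t i <= a%:num) = (switch_time t i <= b%:num).
  apply/idP/idP => [/le_trans|sb]; first exact.
  rewrite leNgt; apply/negP => sa.
  by apply: (noF (switch_time t i)); [exists i|rewrite sa].
congr (if _ is Some i then _ else _); apply: eq_pick => i /=.
rewrite !ltNge; congr (_ && ~~ _).
  exact: (leE (widen_ord (leqnSn _) i)).
by have := leE (lift ord0 i); rewrite lift0.
Qed.

Definition switch {l} (alpha : 'I_l.+1 -> U) (t : 'rV[R]_l.+1) : Upc :=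
  SigSub (switch_subproof alpha t).

Definition causal {Y : Type} (phi : Upc -> {nonneg R} -> Y) :=
  forall (t : {nonneg R}) (u v : Upc),
    (forall s, s <= t -> val u s = val v s) ->
    forall s, s <= t -> phi u s = phi v s.

Definition analytic (phi : Upc -> {nonneg R} -> R) :=
  forall (l : nat) (alpha : 'I_l.+1 -> U),
    analytic_on (orthant l.+1)
      (fun t => ext (phi (switch alpha t)) (switch_time t l.+1)).

Definition AUpc : set (Upc -> {nonneg R} -> R) :=
  [set phi | [/\ forall u, piecewise_continuous (phi u),
                 causal phi & analytic phi]].

(* The right derivative in s, at s = 0, of phi(u_alpha)(t + s). *)
Definition Dop (alpha : U) (phi : Upc -> {nonneg R} -> R) :
    Upc -> {nonneg R} -> R :=
  fun u t =>
    let g s := ext (phi (splice u t alpha)) (t%:num + s) in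
    lim ((g s - g 0) / s @[s --> 0^'+]).

Definition const_map (a : R) : Upc -> {nonneg R} -> R := fun _ _ => a.

(* Unital; the constant maps give closure under scalar multiplication. *)
Definition subalgebra (S : set (Upc -> {nonneg R} -> R)) :=
  [/\ forall a, S (const_map a),
      forall f g, S f -> S g -> S (f + g) &
      forall f g, S f -> S g -> S (f * g)].

End Inputs.

Arguments Upc {R m} U _.
Arguments AUpc {R m} U _.
Arguments Dop {R m U} alpha phi u t.

Section ObservationAlgebra.
Context {R : realType} {m q : nat} (U : set 'cV[R]_m).

Definition io_map := Upc U -> PC (R := R) 'cV[R]_q.

Variable p : io_map.

Definition component (k : 'I_q) : Upc U -> {nonneg R} -> R :=
  fun u t => val (p u) t k 0.

Definition causal_io := causal (fun u => val (p u)).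
Definition analytic_io := forall k, analytic (component k).

Definition obs_set : set (Upc U -> {nonneg R} -> R) :=
  \bigcap_(S in [set S | [/\ S `<=` AUpc U, subalgebra S,
                             forall k, S (component k) &
                             forall alpha phi, S phi -> S (Dop alpha phi)]]) S.

Definition obs_pred : {pred (Upc U -> {nonneg R} -> R)} :=
  fun phi => phi \in obs_set.

Lemma obs_subring_closed : subring_closed obs_pred.
Proof.
have obsN f : f \in obs_pred -> - f \in obs_pred.
  move=> /set_mem fS; apply/mem_set => S SP; have Sf := fS S SP.
  case: SP => _ [Sc _ SM] _ _.
  suff -> : - f = const_map (U := U) (-1) * f by apply: SM.
  by apply/funext => u; apply/funext => t; rewrite /const_map /= mulN1r.
split.
- by apply/mem_set => S [_ [Sc _ _] _ _]; apply: (Sc 1).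
- move=> f g fS /obsN/set_mem gS; move/set_mem: fS => fS.
  apply/mem_set => S SP; have [_ [_ SD _] _ _] := SP.
  by apply: SD; [apply: fS|apply: gS].
- move=> f g /set_mem fS /set_mem gS; apply/mem_set => S SP.
  by have [_ [_ _ SM] _ _] := SP; apply: SM; [apply: fS|apply: gS].
Qed.

HB.instance Definition _ :=
  GRing.isSubringClosed.Build _ obs_pred obs_subring_closed.

Definition Aobs := {phi | phi \in obs_pred}.

HB.instance Definition _ := SubType.on Aobs.
HB.instance Definition _ := Choice.on Aobs.
HB.instance Definition _ :=
  GRing.SubChoice_isSubComPzRing.Build _ _ Aobs obs_subring_closed.

Lemma obs_const_subproof a : const_map a \in obs_pred.
Proof. by apply/mem_set => S [_ [Sc _ _] _ _]; apply: Sc. Qed.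

Definition obs_const (a : R) : Aobs := SigSub (obs_const_subproof a).

Lemma obs_const_zmod : zmod_morphism obs_const.
Proof. by move=> a b; apply: val_inj. Qed.

Lemma obs_const_monoid : monoid_morphism obs_const.
Proof. by split=> [|a b]; apply: val_inj. Qed.

HB.instance Definition _ :=
  GRing.isZmodMorphism.Build R Aobs obs_const obs_const_zmod.
HB.instance Definition _ :=
  GRing.isMonoidMorphism.Build R Aobs obs_const obs_const_monoid.

End ObservationAlgebra.

Arguments io_map {R m} q U.
Arguments obs_const {R m q U} p.

Section TranscendenceDegree.

Definition integral_domain (S : comPzRingType) :=
  (1 : S) <> 0 /\ forall x y : S, x * y = 0 -> x = 0 \/ y = 0.

(* S with the canonical idomainType structure coming from a proof that it is an
   integral domain. *)
Definition domain_of (S : comPzRingType) (_ : integral_domain S) : Type := S.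

Section DomainOf.
Variables (S : comPzRingType) (domS : integral_domain S).
Local Notation D := (domain_of domS).

HB.instance Definition _ := GRing.ComPzRing.copy D S.

Lemma domain_oner_neq0 : (1 : D) != 0.
Proof. by apply/eqP; apply: (proj1 domS). Qed.

HB.instance Definition _ :=
  GRing.PzSemiRing_isNonZero.Build D domain_oner_neq0.

Definition domain_unit : pred D := fun x => `[< exists y : D, y * x = 1 >].

Definition domain_inv (x : D) : D :=
  if pselect (exists y : D, y * x = 1) is left h then sval (cid h) else x.

Lemma domain_mulVx : {in domain_unit, left_inverse 1 domain_inv *%R}.
Proof.
move=> x /asboolP ux; rewrite /domain_inv.
by case: pselect => // h; case: cid.
Qed.

Lemma domain_unitPl (x y : D) : y * x = 1 -> domain_unit x.
Proof. by move=> yx; apply/asboolP; exists y. Qed.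

Lemma domain_invr_out : {in [predC domain_unit], domain_inv =1 id}.
Proof.
by move=> x /asboolPn nux; rewrite /domain_inv; case: pselect.
Qed.

HB.instance Definition _ := GRing.ComNzRing_hasMulInverse.Build D
  domain_mulVx domain_unitPl domain_invr_out.

Lemma domain_mulf_eq0 (x y : D) : x * y = 0 -> (x == 0) || (y == 0).
Proof.
by move=> /(proj2 domS)[] e; apply/orP; [left|right]; apply/eqP.
Qed.

HB.instance Definition _ :=
  GRing.ComUnitRing_isIntegral.Build D domain_mulf_eq0.

End DomainOf.

Section FieldTrdeg.
Variables (F K : fieldType) (iota : {rmorphism F -> K}).

Definition alg_independent {d} (x : 'I_d -> K) :=
  forall P : mpoly d F, mmap iota x P = 0 -> P = 0.

Definition add_elt {d} (y : K) (x : 'I_d -> K) : 'I_d.+1 -> K :=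
  fun i => oapp x y (unlift ord0 i).

(* A maximal algebraically independent family over F. *)
Definition transcendence_basis {d} (x : 'I_d -> K) :=
  alg_independent x /\ forall y, ~ alg_independent (add_elt y x).

Definition field_trdeg_is (d : nat) :=
  exists x : 'I_d -> K, transcendence_basis x.

End FieldTrdeg.

Definition frac_embedding (F : fieldType) (S : comPzRingType)
    (iota : {rmorphism F -> S}) (domS : integral_domain S) :
    F -> {fraction (domain_of domS)} :=
  fun a => @FracField.tofrac (domain_of domS) (iota a).

Section FracEmbedding.
Variables (F : fieldType) (S : comPzRingType) (iota : {rmorphism F -> S}).
Variable domS : integral_domain S.

Lemma frac_embedding_zmod : zmod_morphism (frac_embedding iota domS).
Proof. by move=> a b; rewrite /frac_embedding rmorphB -tofracB. Qed.

Lemma frac_embedding_monoid : monoid_morphism (frac_embedding iota domS).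
Proof.
by split=> [|a b]; rewrite /frac_embedding ?rmorph1 ?rmorphM -?tofrac1 -?tofracM.
Qed.

HB.instance Definition _ := GRing.isZmodMorphism.Build F
  {fraction (domain_of domS)} (frac_embedding iota domS) frac_embedding_zmod.
HB.instance Definition _ := GRing.isMonoidMorphism.Build F
  {fraction (domain_of domS)} (frac_embedding iota domS) frac_embedding_monoid.

End FracEmbedding.

(* The transcendence degree is that of the field of fractions, so it presupposes
   that S is an integral domain. *)
Definition finite_trdeg (F : fieldType) (S : comPzRingType)
    (iota : {rmorphism F -> S}) :=
  exists (domS : integral_domain S) (d : nat),
    field_trdeg_is (frac_embedding iota domS) d.

End TranscendenceDegree.

Section RNN.
Context {R : realType} {m : nat}.

Record rnn (n q : nat) (U : set 'cV[R]_m) := Rnn {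
  rnnA : 'M[R]_(n, n);
  rnnB : 'M[R]_(n, m);
  rnnC : 'M[R]_(q, n);
  activation : R -> R;
  init : 'cV[R]_n;
  activation_continuous : continuous activation;
  activation_lipschitz : lipschitz activation
}.

Definition is_solution {n q} {U : set 'cV[R]_m} (Sigma : rnn n q U)
    (u : {nonneg R} -> 'cV[R]_m)
    (x : {nonneg R} -> 'cV[R]_n) (y : {nonneg R} -> 'cV[R]_q) :=
  [/\ piecewise_continuous u /\ (forall t, U (u t)),
      locally_abs_continuous x /\ x (time_of 0) = init Sigma,
      {ae lebesgue_measure, forall t : R, 0 < t ->
         is_derive t 1 (ext x)
           (map_mx (activation Sigma)
              (rnnA Sigma *m ext x t + rnnB Sigma *m ext u t))}
    & forall t, y t = rnnC Sigma *m x t].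

(* The unique solution (x, u, y) satisfies p(u) = y. *)
Definition realization {n q} {U : set 'cV[R]_m} (Sigma : rnn n q U)
    (p : io_map q U) :=
  forall u : Upc U,
  exists xy : ({nonneg R} -> 'cV[R]_n) * ({nonneg R} -> 'cV[R]_q),
    unique (fun xy => is_solution Sigma (val u) xy.1 xy.2) xy /\
    val (p u) = xy.2.

(* In Up and Vp the index 0 belongs to sigma and i.+1 to xi i. *)
Definition assumption_A1 (sigma : R -> R) :=
  real_analytic sigma /\
  exists (N : nat) (xi : 'I_N -> R -> R) (Up Vp : 'I_N.+1 -> mpoly N R),
    let ev (P : mpoly N R) (s : R) : R := meval (fun i => xi i s) P in
    [/\ (0 < N)%N,
        forall i, real_analytic (xi i),
        forall k, exists s, ev (Vp k) s <> 0,
        forall s, sigma s * ev (Vp ord0) s = ev (Up ord0) s &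
        forall i s, derive1 (xi i) s * ev (Vp (lift ord0 i)) s =
                    ev (Up (lift ord0 i)) s].

End RNN.

(* Main.v *)
From HB Require Import structures.
Require Import Defs.
From mathcomp Require Import all_boot all_order all_algebra.
From mathcomp Require Import finmap.
From mathcomp Require Import -(notations) mpoly.
From mathcomp Require Import all_classical all_reals all_analysis.
From mathcomp.analysis.showcase Require summability.
From mathcomp Require Import ring lra.

(* The crux is the analyticity of the reachable state in the switching times and
   the finiteness of the transcendence degree.

   Analyticity: on each piece where the input is constant, the state is the
   pointwise limit of Euler iterates.  Seen as functions of the switching times
   these iterates are bounded in a weighted l^1 norm of power series around any
   point, by a discrete Gronwall inequality, and norm-bounded sets are closed
   under pointwise limits (Montel).

   Transcendence degree: the observation algebra consists of functions g(x(t))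
   with g analytic, which form an integral domain because two of them can be
   restricted to a common segment of switching times, where the identity theorem
   applies.  Inside its field of fractions, the field generated by the x_i and the
   xi_j((A x + B alpha)_i) is closed under all D_alpha by (A1), the denominators
   V_k(xi(...)) vanishing identically only when the affine form is constant along
   all trajectories.  It contains the observation algebra, so any sufficiently
   large family is algebraically dependent by counting monomials. *)

Set Implicit Arguments.
Unset Strict Implicit.
Unset Printing Implicit Defensive.

Import Order.TTheory GRing.Theory Num.Theory.
Import numFieldNormedType.Exports.

Local Open Scope classical_set_scope.
Local Open Scope ring_scope.

(** * Power series with bounded weighted l^1 norm *)

(** Real analyticity is lost under pointwise, even uniform, limits. Over the complex numbers a bound
    on a polydisc would prevent this; the weighted l^1 norm of the coefficients replaces that bound
    without leaving the reals. It also makes sense at boundary points of the orthant of switching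
    times, where only some directions are available. The estimates are arranged so that radius and
    bound do not depend on the number of Euler steps.

    Trajectories are merely absolutely continuous and satisfy the equation almost everywhere, so the
    local error of an Euler step rests on a mean value inequality for such functions. The limit of
    the Euler iterates then serves as a normal form: the state becomes an expression in the input
    values and durations, from which causality and the effect of zero durations can be read off.

    The observation algebra is an intersection of algebras of causal analytic maps. To bound it, the
    rational maps must form one of these algebras; hence they are taken among the functions of the
    state, and a quotient is an equation phi Q = P instead of a division. *)

Section PolyNorm.
Context {R : realType} {l : nat}.
Implicit Types (P Q : mpoly l R) (r : R).

(** Stands in for the sup norm on a complex polydisc of radius [r]: it is submultiplicative and
    dominates the values on the real box of that radius. *)
Definition pnorm r P : R := \sum_(m <- msupp P) `|mcoeff m P| * r ^+ mdeg m.

Lemma pnorm_ge0 r P : 0 <= r -> 0 <= pnorm r P.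
Proof. by move=> r0; apply: sumr_ge0 => m _; rewrite mulr_ge0// exprn_ge0. Qed.

Lemma pnormE r P (s : seq (multinom l)) : uniq s -> {subset msupp P <= s} ->
  pnorm r P = \sum_(m <- s) `|mcoeff m P| * r ^+ mdeg m.
Proof.
move=> us sub; rewrite [RHS](bigID (mem (msupp P))) /=.
rewrite [X in _ + X]big1 ?addr0; last first.
  by move=> m /memN_msupp_eq0 ->; rewrite normr0 mul0r.
rewrite -big_filter; apply: perm_big; apply: uniq_perm; rewrite ?filter_uniq//.
move=> m; rewrite mem_filter /= andb_idr//; exact: sub.
Qed.

Lemma pnorm_sub r P (s : seq (multinom l)) : 0 <= r -> uniq s ->
  \sum_(m <- s) `|mcoeff m P| * r ^+ mdeg m <= pnorm r P.
Proof.
move=> r0 us; pose S := undup (s ++ msupp P).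
rewrite (@pnormE r P S) ?undup_uniq//; last first.
  by move=> m mP; rewrite mem_undup mem_cat mP orbT.
rewrite [leRHS](bigID (mem s)) /= -[X in _ <= X + _]big_filter.
have Ss : perm_eq [seq i <- S | i \in s] s.
  apply: uniq_perm; rewrite ?filter_uniq ?undup_uniq//.
  by move=> m; rewrite !mem_filter mem_undup mem_cat; case: (m \in s).
by rewrite (perm_big _ Ss) lerDl; apply: sumr_ge0 => m _; rewrite mulr_ge0// exprn_ge0.
Qed.

Lemma pnormD r P Q : 0 <= r -> pnorm r (P + Q) <= pnorm r P + pnorm r Q.
Proof.
move=> r0; rewrite {1}/pnorm.
apply: (@le_trans _ _ (\sum_(m <- msupp (P + Q))
    (`|mcoeff m P| * r ^+ mdeg m + `|mcoeff m Q| * r ^+ mdeg m))).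
  apply: ler_sum => m _; rewrite mcoeffD -mulrDl ler_wpM2r ?exprn_ge0//.
  exact: ler_normD.
by rewrite big_split/= lerD// pnorm_sub.
Qed.

Lemma pnorm0 r : pnorm r 0 = 0.
Proof. by rewrite /pnorm msupp0 big_nil. Qed.

Lemma pnorm_sum r (I : Type) (s : seq I) (F : I -> mpoly l R) : 0 <= r ->
  pnorm r (\sum_(i <- s) F i) <= \sum_(i <- s) pnorm r (F i).
Proof.
move=> r0; elim: s => [|i s IH]; first by rewrite !big_nil pnorm0.
by rewrite !big_cons (le_trans (pnormD _ _ r0))// lerD2l.
Qed.

Lemma pnormZ r (c : R) P : 0 <= r -> pnorm r (c *: P) <= `|c| * pnorm r P.
Proof.
move=> r0.
apply: (@le_trans _ _ (\sum_(m <- msupp (c *: P)) `|c| * (`|mcoeff m P| * r ^+ mdeg m))).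
  by apply: ler_sum => m _; rewrite mcoeffZ normrM mulrA.
by rewrite -mulr_sumr ler_wpM2l// pnorm_sub.
Qed.

Lemma pnormX r (m : multinom l) : pnorm r (mpolyX R m) = r ^+ mdeg m.
Proof. by rewrite /pnorm msuppX big_seq1 mcoeffX eqxx normr1 mul1r. Qed.

Lemma pnormM r P Q : 0 <= r -> pnorm r (P * Q) <= pnorm r P * pnorm r Q.
Proof.
move=> r0; rewrite mpolyME (le_trans (pnorm_sum _ _ r0))//.
rewrite /pnorm mulr_suml big_allpairs_dep/=; apply: ler_sum => m _.
rewrite mulr_sumr; apply: ler_sum => m' _ /=.
rewrite (le_trans (pnormZ _ _ r0))// pnormX mdegD exprD normrM.
by rewrite le_eqVlt; apply/orP; left; apply/eqP; ring.
Qed.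

Lemma pnormC r (c : R) : pnorm r (mpolyC l c) = `|c|.
Proof.
rewrite /pnorm msuppC; case: eqP => [->|_]; first by rewrite big_nil normr0.
by rewrite big_seq1 mcoeffC eqxx mulr1 mdeg0 expr0 mulr1.
Qed.

Lemma prodX_le (h : 'I_l -> R) r (m : multinom l) : (forall i, `|h i| <= r) ->
  `|\prod_i h i ^+ m i| <= r ^+ mdeg m.
Proof.
move=> hr; rewrite normr_prod mdegE -prodrXr.
apply: ler_prod => i _; rewrite normr_ge0 normrX /= lerXn2r// nnegrE//.
exact: le_trans (hr i).
Qed.

Lemma meval_le_pnorm r (h : 'I_l -> R) P : (forall i, `|h i| <= r) ->
  `|meval h P| <= pnorm r P.
Proof.
move=> hr; rewrite mevalE (le_trans (ler_norm_sum _ _ _))//.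
by apply: ler_sum => m _; rewrite normrM ler_wpM2l// prodX_le.
Qed.

Lemma le_pnorm r r' P : 0 <= r' <= r -> pnorm r' P <= pnorm r P.
Proof.
move=> /andP[r'0 rr]; apply: ler_sum => m _; rewrite ler_wpM2l// lerXn2r ?nnegrE//.
exact: le_trans rr.
Qed.

(** Schwarz lemma for this norm: the monomials left after removing the constant term have degree at
    least 1, so each loses a factor [k] when the radius is multiplied by [k]. *)
Lemma pnorm_scale r k P : 0 <= r -> 0 <= k <= 1 ->
  pnorm (k * r) (P - mpolyC l (mcoeff mnm0 P)) <= k * pnorm r P.
Proof.
move=> r0 /andP[k0 k1].
set Q := P - _.
have Q0 : mcoeff mnm0 Q = 0 by rewrite mcoeffB mcoeffC eqxx mulr1 subrr.
apply: (@le_trans _ _ (\sum_(m <- msupp Q) k * (`|mcoeff m P| * r ^+ mdeg m))).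
  rewrite /pnorm !big_seq; apply: ler_sum => m mQ.
  have m0 : m != mnm0 by apply: contraTneq mQ => ->; rewrite mcoeff_msupp Q0 eqxx.
  have -> : mcoeff m Q = mcoeff m P.
    by rewrite mcoeffB mcoeffC (negbTE m0) mulr0 subr0.
  rewrite mulrCA ler_wpM2l// exprMn ler_wpM2r ?exprn_ge0//.
  have: (0 < mdeg m)%N by rewrite lt0n mdeg_eq0.
  case: (mdeg m) => // d _; rewrite exprS ler_piMr// exprn_ile1//.
by rewrite -mulr_sumr ler_wpM2l// pnorm_sub.
Qed.

Lemma meval_0 P : meval (fun=> 0) P = mcoeff mnm0 P.
Proof.
rewrite mevalE (bigID (fun m => m == mnm0)) /= addrC big1 ?add0r.
  case m0: (mnm0 \in msupp P).
    rewrite -big_filter (@perm_big _ _ _ _ _ [:: mnm0]).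
      by rewrite big_seq1 big1 ?mulr1// => i _; rewrite mnm0E expr0.
    apply: uniq_perm; rewrite ?filter_uniq// => m.
    by rewrite mem_filter inE; case: eqP => // ->.
  rewrite big_seq_cond big1 ?memN_msupp_eq0 ?m0// => m /andP[mP /eqP mE].
  by rewrite mE m0 in mP.
move=> m m0; have : mdeg m != 0%N by rewrite mdeg_eq0.
rewrite mdegE sum_nat_eq0 => /forallPn[i /= mi].
by rewrite (bigD1 i)//= expr0n (negbTE mi) mul0r mulr0.
Qed.

End PolyNorm.

Section Cls.
Context {R : realType}.

(* f is in the pointwise closure, over the points of E in the box of radius r, of
   the polynomials of norm at most M.  By [wiener_extract] this means that f is on E
   the sum of a power series of norm at most M, but the closure form makes products,
   substitutions and limits reduce to polynomials. *)
Definition wiener {l} (E : set 'rV[R]_l) (r M : R) (f : 'rV[R]_l -> R) :=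
  forall (s : seq 'rV[R]_l) (e : R),
    {in s, forall h : 'rV[R]_l, E h /\ forall i, `|h 0 i| <= r} -> 0 < e ->
    exists P : mpoly l R, pnorm r P <= M /\
      {in s, forall h : 'rV[R]_l, `|meval (h 0) P - f h| < e}.

Section Basic.
Context {l : nat} (E : set 'rV[R]_l).
Implicit Types (r M : R) (f g : 'rV[R]_l -> R).

Lemma wiener_weak E' r M r' M' f : wiener E r M f -> E' `<=` E -> 0 <= r' <= r -> M <= M' ->
  wiener E' r' M' f.
Proof.
move=> H sub rr MM s e hs e0.
have [|P [PM Pf]] := H s e _ e0.
  move=> h /hs[Eh hr]; split; first exact: sub.
  by move=> i; rewrite (le_trans (hr i))//; case/andP: rr.
exists P; split => //; exact: le_trans (le_pnorm _ rr) (le_trans PM MM).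
Qed.

Lemma wiener_ext r M f g : (forall h, E h -> (forall i, `|h 0 i| <= r) -> f h = g h) ->
  wiener E r M f -> wiener E r M g.
Proof.
move=> fg H s e hs e0; have [P [PM Pf]] := H s e hs e0.
exists P; split => // h hin; have [Eh hr] := hs h hin.
by rewrite -fg//; apply: Pf.
Qed.

Lemma wiener_le r M f h : wiener E r M f -> E h -> (forall i, `|h 0 i| <= r) -> `|f h| <= M.
Proof.
move=> H Eh hr; apply/ler_addgt0Pr => e e0.
have [|P [PM Pf]] := H [:: h] e _ e0; first by move=> k; rewrite inE => /eqP ->.
have := Pf h (mem_head _ _); have := meval_le_pnorm P hr => P1 P2.
have -> : f h = meval (h 0) P - (meval (h 0) P - f h) by ring.
rewrite (le_trans (ler_normB _ _))// lerD//; last exact: ltW.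
exact: le_trans PM.
Qed.

Lemma wiener_ge0 r M f : 0 <= r -> wiener E r M f -> 0 <= M.
Proof.
by move=> r0 /(_ [::] 1)[//|//|P [PM _]]; apply: le_trans PM; apply: pnorm_ge0.
Qed.

Lemma wiener_cst r (c : R) : wiener E r `|c| (fun=> c).
Proof.
move=> s e hs e0; exists (mpolyC l c); rewrite pnormC; split => // h _.
by rewrite mevalC subrr normr0.
Qed.

Lemma wiener_coord r i : wiener E r r (fun h => h 0 i).
Proof.
move=> s e hs e0; exists (mpolyX R (mnm1 i)); rewrite pnormX mdeg1 expr1; split => // h _.
by rewrite mevalXU subrr normr0.
Qed.

Lemma wiener_add r M M' f g : 0 <= r -> wiener E r M f -> wiener E r M' g ->
  wiener E r (M + M') (fun h => f h + g h).
Proof.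
move=> r0 Hf Hg s e hs e0.
have e2 : 0 < e / 2 by rewrite divr_gt0.
have [P [PM Pf]] := Hf s _ hs e2; have [Q [QM Qg]] := Hg s _ hs e2.
exists (P + Q); split; first by rewrite (le_trans (pnormD _ _ r0))// lerD.
move=> h hin; rewrite mevalD opprD addrACA (le_lt_trans (ler_normD _ _))//.
by rewrite [e]splitr ltrD ?Pf ?Qg.
Qed.

Lemma wiener_mul r M M' f g : 0 <= r -> wiener E r M f -> wiener E r M' g ->
  wiener E r (M * M') (fun h => f h * g h).
Proof.
move=> r0 Hf Hg s e hs e0.
have M0 := wiener_ge0 r0 Hf; have M'0 := wiener_ge0 r0 Hg.
(* The error of the product is at most (M + M') e'; the 1 covers M = M' = 0. *)
pose e' := e / (M + M' + 1).
have e2 : 0 < e' by rewrite divr_gt0// ltr_wpDl// addr_ge0.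
have [P [PM Pf]] := Hf s _ hs e2; have [Q [QM Qg]] := Hg s _ hs e2.
exists (P * Q); split.
  by rewrite (le_trans (pnormM _ _ r0))// ler_pM// pnorm_ge0.
move=> h hin; rewrite mevalM; have [Eh hr] := hs h hin.
have -> : meval (h 0) P * meval (h 0) Q - f h * g h =
   meval (h 0) P * (meval (h 0) Q - g h) + (meval (h 0) P - f h) * g h by ring.
have gM := wiener_le Hg Eh hr.
have PhM := le_trans (meval_le_pnorm P hr) PM.
rewrite (le_lt_trans (ler_normD _ _))// !normrM.
apply: (@le_lt_trans _ _ (M * e' + e' * M')).
  by rewrite lerD// ler_pM// ltW// ?Pf ?Qg.
rewrite mulrC -mulrDr /e' mulrAC -mulrA gtr_pMr// ltr_pdivrMr ?mul1r ?ltrDl//.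
by rewrite ltr_wpDl// addr_ge0.
Qed.

Lemma wiener_scale r (c M : R) f : 0 <= r -> wiener E r M f ->
  wiener E r (`|c| * M) (fun h => c * f h).
Proof. by move=> r0 Hf; apply: wiener_mul => //; apply: wiener_cst. Qed.

Lemma wiener_sum r (I : Type) (s : seq I) (M : I -> R) (F : I -> 'rV[R]_l -> R) :
  0 <= r -> (forall i, wiener E r (M i) (F i)) ->
  wiener E r (\sum_(i <- s) M i) (fun h => \sum_(i <- s) F i h).
Proof.
move=> r0 HF; elim: s => [|i s IH].
  rewrite big_nil; have := @wiener_cst r 0; rewrite normr0; apply: wiener_ext => h _ _.
  by rewrite big_nil.
rewrite big_cons; have Hi := wiener_add r0 (HF i) IH; apply: (wiener_ext _ Hi) => h _ _.
by rewrite big_cons.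
Qed.

Lemma wiener_prod r (I : Type) (s : seq I) (M : I -> R) (F : I -> 'rV[R]_l -> R) :
  0 <= r -> (forall i, wiener E r (M i) (F i)) ->
  wiener E r (\prod_(i <- s) M i) (fun h => \prod_(i <- s) F i h).
Proof.
move=> r0 HF; elim: s => [|i s IH].
  rewrite big_nil; have := @wiener_cst r 1; rewrite normr1; apply: wiener_ext => h _ _.
  by rewrite big_nil.
rewrite big_cons; have Hi := wiener_mul r0 (HF i) IH; apply: (wiener_ext _ Hi) => h _ _.
by rewrite big_cons.
Qed.

Lemma wiener_exp r M f k : 0 <= r -> wiener E r M f -> wiener E r (M ^+ k) (fun h => f h ^+ k).
Proof.
move=> r0 Hf; have := @wiener_prod r _ (nseq k tt) (fun=> M) (fun=> f) r0 (fun=> Hf).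
rewrite big_nseq iter_mulr_1; apply: wiener_ext => h _ _.
by rewrite big_nseq iter_mulr_1.
Qed.

Lemma wiener_lim r M f :
  (forall (s : seq 'rV[R]_l) (e : R),
    {in s, forall h : 'rV[R]_l, E h /\ forall i, `|h 0 i| <= r} -> 0 < e ->
    exists g, wiener E r M g /\ {in s, forall h, `|g h - f h| < e}) -> wiener E r M f.
Proof.
move=> H s e hs e0; have e2 : 0 < e / 2 by rewrite divr_gt0.
have [g [gM gf]] := H s _ hs e2; have [P [PM Pf]] := gM s _ hs e2.
exists P; split => // h hin.
have -> : meval (h 0) P - f h = (meval (h 0) P - g h) + (g h - f h) by ring.
by rewrite (le_lt_trans (ler_normD _ _))// [e]splitr ltrD ?Pf ?gf.
Qed.

(** The Montel step. Pointwise convergence is enough because a test involves finitely many points,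
    for which a common index exists. *)
Lemma wiener_seq_lim r M (F : nat -> 'rV[R]_l -> R) f : (forall n, wiener E r M (F n)) ->
  (forall h, E h -> (forall i, `|h 0 i| <= r) -> F n h @[n --> \oo] --> f h) ->
  wiener E r M f.
Proof.
move=> HF Hf; apply: wiener_lim => s e hs e0.
suff : \forall n \near \oo, {in s, forall h, `|F n h - f h| < e}.
  by move=> [N _ HN]; exists (F N); split => //; apply: (HN N) => /=.
elim: s hs => [|h s IH] hs; first by apply: nearW => n h; rewrite in_nil.
have [|Eh hr] := hs h; first exact: mem_head.
have H1 : \forall n \near \oo, {in s, forall h, `|F n h - f h| < e}.
  by apply: IH => k ks; apply: hs; rewrite in_cons ks orbT.
have H2 : \forall n \near \oo, `|f h - F n h| < e.
  by have /cvgrPdist_lt := Hf h Eh hr; apply.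
apply: filterS2 H1 H2 => n H1 H2 k; rewrite in_cons => /orP[/eqP ->|]; last exact: H1.
by rewrite distrC.
Qed.

End Basic.

Lemma wiener_meval {l l'} (E' : set 'rV[R]_l') (r r' : R) (P : mpoly l R)
    (w : 'I_l -> 'rV[R]_l' -> R) : 0 <= r' -> (forall i, wiener E' r' r (w i)) ->
  wiener E' r' (pnorm r P) (fun h => meval (fun i => w i h) P).
Proof.
move=> r'0 Hw; rewrite /pnorm; apply: (@wiener_ext _ _ _ _ (fun h => \sum_(m <- msupp P)
   mcoeff m P * \prod_(i <- index_enum 'I_l) w i h ^+ m i)).
  by move=> h _ _; rewrite mevalE.
apply: wiener_sum => // m; apply: wiener_scale => //.
rewrite mdegE -prodrXr; apply: wiener_prod => // i; exact: wiener_exp.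
Qed.

(** The inner functions have norm at most the radius [r] of the outer one, so a monomial of degree j
    becomes a function of norm at most r^j: the bound [M] survives. *)
Lemma wiener_subst {l l'} (E : set 'rV[R]_l) (E' : set 'rV[R]_l') (r r' M : R) f
    (w : 'I_l -> 'rV[R]_l' -> R) : 0 <= r' -> wiener E r M f ->
  (forall i, wiener E' r' r (w i)) ->
  (forall h, E' h -> (forall i, `|h 0 i| <= r') -> E (\row_i w i h)) ->
  wiener E' r' M (fun h => f (\row_i w i h)).
Proof.
move=> r'0 Hf Hw wE; apply: wiener_lim => s e hs e0.
have [|P [PM Pf]] := Hf [seq \row_i w i h | h <- s] e _ e0.
  move=> _ /mapP[h hin ->]; have [Eh hr] := hs h hin.
  by split=> [|i]; [apply: wE|rewrite mxE; apply: wiener_le (Hw i) _ _].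
exists (fun h => meval (fun i => w i h) P); split; last first.
  move=> h hin; have := Pf (\row_i w i h) (map_f _ hin).
  by rewrite (@meval_eq _ _ _ (fun i => w i h))// => i; rewrite mxE.
apply: (@wiener_weak _ E' _ r' (pnorm r P)) => //; last by rewrite r'0 lexx.
exact: wiener_meval.
Qed.

Lemma wiener_shrink {l} (E : set 'rV[R]_l) (r k M : R) f : 0 <= r -> 0 <= k <= 1 ->
  E 0 -> wiener E r M f -> wiener E (k * r) (k * M) (fun h => f h - f 0).
Proof.
move=> r0 k01 E0 Hf s e hs e0; have e2 : 0 < e / 2 by rewrite divr_gt0.
have kr : k * r <= r by case/andP: k01 => k0 k1; rewrite ler_piMl.
(* The point 0 joins the test points, so that the constant coefficient of [P] approximates [f 0]. *)
have [|P [PM Pf]] := Hf (0 :: s) _ _ e2.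
  move=> h; rewrite inE => /predU1P[->|/hs[Eh hr]].
    by split => // i; rewrite mxE normr0.
  by split => // i; rewrite (le_trans (hr i)).
exists (P - mpolyC l (mcoeff mnm0 P)); split.
  by rewrite (le_trans (pnorm_scale _ r0 k01))// ler_wpM2l//; case/andP: k01.
move=> h hin; rewrite mevalB mevalC -meval_0.
have P0 : `|meval (fun=> 0) P - f 0| < e / 2.
  have := Pf 0 (mem_head _ _); rewrite (@meval_eq _ _ _ (fun=> 0))// => i.
  by rewrite mxE.
have Ph : `|meval (h 0) P - f h| < e / 2 by apply: Pf; rewrite in_cons hin orbT.
rewrite [X in `|X|](_ : _ = (meval (h 0) P - f h) - (meval (fun=> 0) P - f 0)); last by ring.
by rewrite (le_lt_trans (ler_normB _ _))// [e]splitr ltrD.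
Qed.

End Cls.

Lemma cvg_sumr (R : realType) (T : Type) (F : set_system T) (FF : Filter F) (I : Type)
    (s : seq I) (f : I -> T -> R) (a : I -> R) :
  (forall i, f i x @[x --> F] --> a i) ->
  \sum_(i <- s) f i x @[x --> F] --> \sum_(i <- s) a i.
Proof.
move=> fa; elim: s => [|i s IH].
  by rewrite big_nil; under eq_cvg do rewrite big_nil; apply: cvg_cst.
by rewrite big_cons; under eq_cvg do rewrite big_cons; apply: cvgD.
Qed.

Lemma half_pow_lt (R : realType) (M e : R) : 0 < e -> exists K, 2^-1 ^+ K * M < e.
Proof.
move=> e0.
have /cvgrPdist_lt/(_ _ e0)[K _ HK] : 2^-1 ^+ n * M @[n --> \oo] --> (0 * M : R).
  apply: cvgMr_tmp; apply: cvg_expr; rewrite ger0_norm ?invr_ge0//.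
  by rewrite invf_lt1// ltr1n.
exists K; have := HK K (leqnn _) => /=.
by rewrite mul0r sub0r normrN; apply: le_lt_trans; apply: ler_norm.
Qed.

Section Extract.
Context {R : realType} {l : nat}.
Implicit Types (nu : {ffun 'I_l -> nat}).

(** The monomials outside [s] have degree at least [K], so passing from radius r to k r shrinks each
    of them by [k ^+ K] or better. *)
Lemma meval_tail (h : 'I_l -> R) (P : mpoly l R) (r k : R) K (s : seq (multinom l)) :
  0 <= r -> 0 <= k <= 1 -> (forall i, `|h i| <= k * r) -> uniq s ->
  (forall m, (mdeg m < K)%N -> m \in s) ->
  `|meval h P - \sum_(m <- s) mcoeff m P * \prod_i h i ^+ m i| <= k ^+ K * pnorm r P.
Proof.
move=> r0 /andP[k0 k1] hk us sK; pose S := undup (s ++ msupp P).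
have mS : meval h P = \sum_(m <- S) mcoeff m P * \prod_i h i ^+ m i.
  rewrite mevalE [RHS](bigID (mem (msupp P))) /= [X in _ + X]big1 ?addr0; last first.
    by move=> m /memN_msupp_eq0 ->; rewrite mul0r.
  rewrite -[RHS]big_filter; apply: perm_big; apply: uniq_perm; rewrite ?filter_uniq ?undup_uniq//.
  by move=> m; rewrite mem_filter mem_undup mem_cat; case: (m \in msupp P); rewrite ?orbT.
rewrite mS (bigID (mem s)) /= -big_filter.
have Ss : perm_eq [seq i <- S | i \in s] s.
  apply: uniq_perm; rewrite ?filter_uniq ?undup_uniq//.
  by move=> m; rewrite !mem_filter mem_undup mem_cat; case: (m \in s).
rewrite (perm_big _ Ss) addrAC subrr add0r (le_trans (ler_norm_sum _ _ _))//.
apply: (@le_trans _ _ (\sum_(m <- S | m \notin s) k ^+ K * (`|mcoeff m P| * r ^+ mdeg m))).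
  apply: ler_sum => m ms; rewrite normrM mulrCA ler_wpM2l//.
  rewrite (le_trans (prodX_le _ hk))// exprMn ler_wpM2r ?exprn_ge0//.
  rewrite ler_wiXn2l//; by rewrite leqNgt; apply: contra ms => /sK.
rewrite -mulr_sumr ler_wpM2l ?exprn_ge0// -big_filter pnorm_sub//.
by rewrite filter_uniq ?undup_uniq.
Qed.

Lemma ultra_bounded_cvg (T : Type) (F : set_system T) (g : T -> R) (K : R) :
  UltraFilter F -> F [set x | `|g x| <= K] -> exists c : R, g @ F --> c.
Proof.
move=> UF FK.
have PF : ProperFilter (g @ F) by apply: fmap_proper_filter.
have [|c [_ cl]] := @segment_compact R (- K) K (g @ F) PF.
  suff : F (g @^-1` `[- K, K]) by [].
  by apply: filterS FK => x /=; rewrite ler_norml in_itv.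
exists c => A nA; have [//|FnA] := in_ultra_setVsetC (g @^-1` A) UF.
by have [x [] ] := cl _ _ (FnA : (g @ F) (~` A)) nA.
Qed.

Definition mn_of nu : multinom l := Multinom [tuple nu i | i < l].

Lemma mn_ofE nu i : mn_of nu i = nu i.
Proof. by rewrite /mn_of mnmE. Qed.

Lemma mn_of_inj : injective mn_of.
Proof. by move=> a b /mnmP ab; apply/ffunP => i; have := ab i; rewrite !mn_ofE. Qed.

Lemma mdeg_mn_of nu : mdeg (mn_of nu) = (\sum_i nu i)%N.
Proof. by rewrite mdegE; apply: eq_bigr => i _; rewrite mn_ofE. Qed.

(** Compactness: the approximating polynomials generate a filter, refined to an ultrafilter. Along
    it each coefficient converges, being bounded by M / r^|nu|. Both claims involve finite sums only
    and hold for all these polynomials with the same right-hand side, so they pass to the limit. *)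
Lemma wiener_extract (E : set 'rV[R]_l) (r M : R) f : 0 < r -> wiener E r M f ->
  exists c : {ffun 'I_l -> nat} -> R,
    (forall s, uniq s -> \sum_(nu <- s) `|c nu| * r ^+ (\sum_i nu i)%N <= M) /\
    (forall (k : R) K s h, E h -> 0 <= k <= 1 -> (forall i, `|h 0 i| <= k * r) -> uniq s ->
       (forall nu, (\sum_i nu i < K)%N -> nu \in s) ->
       `|f h - \sum_(nu <- s) c nu * \prod_i h 0 i ^+ nu i| <= k ^+ K * M).
Proof.
move=> r0 Hf.
pose D := [set se : seq 'rV[R]_l * R |
  {in se.1, forall h : 'rV[R]_l, E h /\ forall i, `|h 0 i| <= r} /\ 0 < se.2].
pose B (se : seq 'rV[R]_l * R) := [set P : mpoly l R | pnorm r P <= M /\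
  {in se.1, forall h : 'rV[R]_l, `|meval (h 0) P - f h| < se.2}].
have FF : ProperFilter (filter_from D B).
  apply: filter_from_proper; last first.
    by move=> [s e] [hs e0]; have [P HP] := Hf s e hs e0; exists P.
  apply: filter_from_filter; first by exists ([::], 1); split.
  move=> [s1 e1] [s2 e2] [/= h1 e10] [/= h2 e20]; exists (s1 ++ s2, Num.min e1 e2).
    split => /=; last by rewrite lt_min e10.
    by move=> h; rewrite mem_cat => /orP[/h1|/h2].
  move=> P [/= PM HP]; split; split => //= h hs.
    by have := HP h; rewrite mem_cat hs lt_min => /(_ erefl) /andP[].
  by have := HP h; rewrite mem_cat hs orbT lt_min => /(_ erefl) /andP[].
have [F [UF subF]] := ultraFilterLemma FF.
have PF := @ultra_proper _ _ UF.
have FF' : Filter F by exact: filter_filter.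
have FM : F [set P | pnorm r P <= M].
  by apply: subF; exists ([::], 1) => // P [].
have bnd P nu : pnorm r P <= M -> `|mcoeff (mn_of nu) P| <= M / r ^+ (\sum_i nu i)%N.
  move=> PM; rewrite ler_pdivlMr ?exprn_gt0// -mdeg_mn_of (le_trans _ PM)//.
  by have := @pnorm_sub _ _ r P [:: mn_of nu] (ltW r0) erefl; rewrite big_seq1.
have cE nu : exists c : R, mcoeff (mn_of nu) P @[P --> F] --> c.
  apply: (ultra_bounded_cvg (K := M / r ^+ (\sum_i nu i)%N) UF).
  by apply: filterS FM => P PM; apply: bnd.
pose c nu := sval (cid (cE nu)).
have cP nu : mcoeff (mn_of nu) P @[P --> F] --> c nu by rewrite /c; case: cid.
exists c; split => [s us|k K s h Eh k01 hk us sK].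
  apply: (@cvgr_to_le _ F _ _ (fun P => \sum_(nu <- s) `|mcoeff (mn_of nu) P| * r ^+ (\sum_i nu i)%N)).
    by apply: cvg_sumr => nu; apply: cvgMr_tmp; apply: cvg_norm.
  apply: filterS FM => P PM; apply: le_trans PM.
  have := @pnorm_sub _ _ r P [seq mn_of nu | nu <- s] (ltW r0).
  rewrite map_inj_uniq; last exact: mn_of_inj.
  by move=> /(_ us); rewrite big_map; under eq_bigr do rewrite mdeg_mn_of.
have /andP[k0 k1] := k01.
have fF : meval (h 0) P @[P --> F] --> f h.
  apply/cvgrPdist_lt => e e0; apply: subF; exists ([:: h], e).
    split => //= h'; rewrite inE => /eqP ->; split => // i.
    by rewrite (le_trans (hk i))// ler_piMl// ltW.
  by move=> P [_ /(_ h (mem_head _ _))] /=; rewrite distrC.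
apply: (@cvgr_to_le _ F _ _ (fun P => `|meval (h 0) P -
    \sum_(nu <- s) mcoeff (mn_of nu) P * \prod_i h 0 i ^+ nu i|)).
  apply: cvg_norm; apply: cvgB => //.
  by apply: cvg_sumr => nu; apply: cvgMr_tmp.
apply: filterS FM => P PM; apply: (@le_trans _ _ (k ^+ K * pnorm r P)); last first.
  by rewrite ler_wpM2l ?exprn_ge0.
have := @meval_tail (h 0) P r k K [seq mn_of nu | nu <- s] (ltW r0) k01 hk.
rewrite map_inj_uniq; last exact: mn_of_inj.
move=> /(_ us); rewrite big_map.
under [X in _ - X]eq_bigr do under eq_bigr do rewrite mn_ofE.
apply=> m mK; apply/mapP; exists [ffun i => m i].
  apply: sK; rewrite mdegE in mK; by under eq_bigr do rewrite ffunE.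
by apply/mnmP => i; rewrite mn_ofE ffunE.
Qed.

(** On half the radius, every finite sum that contains the finitely many terms of degree below [K]
    is within 2^-K M of [f]. *)
Lemma wiener_partial_sum (E : set 'rV[R]_l) (r M : R) f : 0 < r -> wiener E r M f ->
  exists c : {ffun 'I_l -> nat} -> R, forall h, E h -> (forall i, `|h 0 i| <= r / 2) ->
    summability.partial_sum (fun nu => c nu * \prod_(i < l) h 0 i ^+ nu i)
        @ summability.totally --> f h.
Proof.
move=> r0 Hf; have [c [_ cP]] := wiener_extract r0 Hf.
exists c => h Eh hr.
have PT := @summability.totally_filter {ffun 'I_l -> nat}.
apply/cvgrPdist_lt => e e0.
have M0 := wiener_ge0 (ltW r0) Hf.
have [K Ke] := half_pow_lt M e0.
have : finite_set [set nu : {ffun 'I_l -> nat} | (\sum_i nu i < K)%N].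
  pose g (x : {ffun 'I_l -> 'I_K}) : {ffun 'I_l -> nat} := [ffun i => nat_of_ord (x i)].
  apply: (@sub_finite_set _ _ (range g)); last exact: finite_image.
  move=> nu /= nuK.
  have ltK i : (nu i < K)%N by apply: leq_ltn_trans nuK; rewrite (bigD1 i)//= leq_addr.
  by exists [ffun i => Ordinal (ltK i)] => //; apply/ffunP => i; rewrite !ffunE.
move=> /finite_fsetP[A HA].
exists A => // s As /=.
rewrite /summability.partial_sum.
rewrite -(finmap.big_seq_fsetE _ _ predT (fun nu => c nu * \prod_(i < l) h 0 i ^+ nu i)) /=.
apply: le_lt_trans Ke; apply: cP => //.
- by rewrite invr_ge0 ler0n invf_le1// ler1n.
- by move=> i; rewrite mulrC.
- exact: finmap.fset_uniq.
- move=> nu nuK; have /finmap.fsubsetP sub := As; apply: sub.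
  by have : [set` A] nu by rewrite -HA.
Qed.

End Extract.

(** * Analytic functions of one variable and the identity theorem *)

Section OneVar.
Context {R : realType}.
Implicit Types (f : R -> R).

(** The supremum of the points where [P] holds satisfies [P] by the limit hypothesis, and the step
    hypothesis forces it to be [b]. [P] may fail at intermediate points. *)
Lemma real_induction (a b : R) (P : R -> Prop) : a <= b -> P a ->
  (forall t, a <= t < b -> P t -> exists2 s, t < s <= b & P s) ->
  (forall t, a < t <= b ->
     (forall e, 0 < e -> exists2 s, t - e < s < t & a <= s /\ P s) -> P t) -> P b.
Proof.
move=> ab Pa Pstep Plim.
pose S := [set t | a <= t <= b /\ P t].
have supS : has_sup S.
  split; first by exists a; split => //; rewrite lexx ab.
  by exists b => t [/andP[_ tb] _].
have Sa : S a by split => //; rewrite lexx ab.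
have aS : a <= sup S by apply: ub_le_sup; [exact: supS.2|].
have Sb : sup S <= b by apply: ge_sup; [exists a|move=> t [/andP[]]].
have PS : P (sup S).
  move: aS; rewrite le_eqVlt => /predU1P[<-//|aS].
  have [//|NPS] := pselect (P (sup S)).
  apply: Plim => [|e e0]; first by rewrite aS.
  have [s [/andP[as_ sb] Ps] es] := sup_adherent e0 supS.
  exists s => //; rewrite es /= lt_neqAle; apply/andP; split.
    by apply: contra_notN NPS => /eqP <-.
  by apply: ub_le_sup; [exact: supS.2|split => //; rewrite as_].
move: Sb; rewrite le_eqVlt => /predU1P[<-//|Sb].
have [|s /andP[Ss sb] Ps] := Pstep (sup S) _ PS; first by rewrite aS.
have : s <= sup S.
  by apply: ub_le_sup; [exact: supS.2|split => //; rewrite (le_trans aS) ?sb// ltW].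
by rewrite leNgt Ss.
Qed.

Lemma real_analytic_wiener f a : real_analytic f ->
  exists r M, 0 < r /\ wiener (l := 1) setT r M (fun h => f (a + h 0 0)).
Proof.
move=> /(_ a)[r [c [r0 fc]]].
have r2 : 0 < r / 2 by rewrite divr_gt0.
(* The series converges at 3r/4, hence absolutely at r/2, where the sum of absolute values is the
   bound sought. *)
have rlt : `|r / 2| < `|r * (3 / 4)|.
  by rewrite !ger0_norm ?mulr_ge0 ?divr_ge0 ?ltW//; nra.
have Cx : cvgn (pseries c (r * (3 / 4))).
  have := fc (a + r * (3 / 4)); rewrite addrAC subrr add0r => H.
  have -> : pseries c (r * (3 / 4)) = [series c k * (r * (3 / 4)) ^+ k]_k by [].
  apply: cvgP; apply: H; rewrite ger0_norm; nra.
have Cn := is_cvg_pseries_inside_norm Cx rlt.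
exists (r / 2), (limn (pseries (fun i => `|c i|) (r / 2))); split => //.
apply: (@wiener_seq_lim _ _ _ _ _ (fun n h => \sum_(0 <= k < n) c k * (h 0 0) ^+ k)).
  move=> n; apply: (@wiener_weak _ _ setT _ (r / 2) (\sum_(0 <= k < n) `|c k| * (r / 2) ^+ k)) => //.
  - apply: wiener_sum; rewrite ?ltW// => k.
    apply: wiener_scale; rewrite ?ltW//; apply: wiener_exp; rewrite ?ltW//.
    exact: wiener_coord.
  - by rewrite lexx ltW.
  - apply: (@nondecreasing_cvgn_le _ (pseries (fun i => `|c i|) (r / 2))) => //.
    apply: nondecreasing_series => k _ _.
    by rewrite mulr_ge0// exprn_ge0// ltW.
move=> h _ hr; have := fc (a + h 0 0); rewrite addrAC subrr add0r.
apply; apply: le_lt_trans (hr 0) _; nra.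
Qed.

(** The coefficients vanish by induction: at a zero [h] the remainder estimate leaves |c_k| <= |h| M
    / r^(k+1), and such zeros come arbitrarily close to 0. They may all lie on one side. *)
Lemma wiener_ident (E : set 'rV[R]_1) (r M : R) (f : 'rV[R]_1 -> R) : 0 < r -> wiener E r M f ->
  (forall e, 0 < e -> exists2 h, E h /\ 0 < `|h 0 0| < e & f h = 0) ->
  forall h, E h -> `|h 0 0| <= r / 2 -> f h = 0.
Proof.
move=> r0 Hf acc; have [c [_ cP]] := wiener_extract r0 Hf.
have M0 := wiener_ge0 (ltW r0) Hf.
pose s k : seq {ffun 'I_1 -> nat} := [seq [ffun=> j] | j <- iota 0 k].
have us k : uniq (s k).
  rewrite map_inj_uniq ?iota_uniq// => i j /ffunP/(_ 0); by rewrite !ffunE.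
have sP k (nu : {ffun 'I_1 -> nat}) : (\sum_i nu i < k)%N -> nu \in s k.
  rewrite big_ord1 => nuk; apply/mapP; exists (nu 0); first by rewrite mem_iota.
  by apply/ffunP => i; rewrite ffunE (ord1 i).
have sE k h : \sum_(nu <- s k) c nu * \prod_(i < 1) h 0 i ^+ nu i =
    \sum_(0 <= j < k) c [ffun=> j] * h 0 0 ^+ j.
  rewrite big_map /index_iota subn0; apply: eq_bigr => j _.
  by rewrite big_ord1 ffunE.
have bd k (t : R) h : E h -> 0 <= t <= 1 -> `|h 0 0| <= t * r ->
    `|f h - \sum_(0 <= j < k) c [ffun=> j] * h 0 0 ^+ j| <= t ^+ k * M.
  move=> Eh t01 ht; rewrite -sE; apply: cP => //; last exact: sP.
  by move=> i; rewrite (ord1 i).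
have c0 k : c [ffun=> k] = 0.
  elim/ltn_ind: k => k IH; apply/eqP; rewrite -normr_le0.
  apply/ler_addgt0Pr => e e0; rewrite add0r.
  pose e' := Num.min r (e * r ^+ k.+1 / (M + 1)).
  have M1 : 0 < M + 1 by rewrite ltr_wpDl.
  have [|h [Eh /andP[h0 he]] fh] := acc e'.
    by rewrite lt_min r0 divr_gt0// mulr_gt0// exprn_gt0.
  move: he; rewrite lt_min => /andP[hr he].
  have t01 : 0 <= `|h 0 0| / r <= 1.
    by rewrite divr_ge0 ?(ltW r0)//= ler_pdivrMr// mul1r ltW.
  have := bd k.+1 (`|h 0 0| / r) h Eh t01; rewrite divfK ?gt_eqF// lexx => /(_ erefl).
  rewrite fh sub0r normrN big_nat_recr//= big_nat big1 ?add0r; last first.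
    by move=> j /andP[_ jk]; rewrite IH// mul0r.
  rewrite normrM normrX expr_div_n exprSr.
  have hk : 0 < `|h 0 0| ^+ k by rewrite exprn_gt0.
  rewrite mulrAC [leRHS](_ : _ = (`|h 0 0| * M / r ^+ k.+1) * `|h 0 0| ^+ k); last by ring.
  rewrite ler_pM2r// => /le_trans; apply.
  rewrite ler_pdivrMr ?exprn_gt0//.
  move: he; rewrite ltr_pdivlMr// => /ltW; apply: le_trans.
  by rewrite ler_wpM2l// lerDl.
move=> h Eh hr; apply/eqP; rewrite -normr_le0; apply/ler_addgt0Pr => e e0.
rewrite add0r.
have [K Ke] := half_pow_lt M e0.
have := bd K 2^-1 h Eh; rewrite invr_ge0 ler0n invf_le1 ?ler1n// mulrC => /(_ erefl hr).
rewrite big1 ?subr0; first by move=> /le_trans; apply; apply: ltW.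
by move=> j _; rewrite c0 mul0r.
Qed.

(** The zeros spread to the right from [0, c]: at every point reached they accumulate from the left,
    so the expansion there vanishes beyond the point as well. *)
Lemma segment_ident (F : R -> R) (c : R) : 0 < c <= 1 ->
  (forall a, 0 <= a <= 1 -> exists r M, 0 < r /\
     wiener (l := 1) [set h | 0 <= a + h 0 0 <= 1] r M (fun h => F (a + h 0 0))) ->
  (forall s, 0 <= s <= c -> F s = 0) -> forall s, 0 <= s <= 1 -> F s = 0.
Proof.
move=> /andP[c0 c1] HF Fc.
pose P t := forall s, 0 <= s <= t -> F s = 0.
suff P1 : P 1 by exact: P1.
have ext t : 0 < t <= 1 -> (forall e, 0 < e -> exists2 s, t - e < s < t & 0 <= s /\ P s) ->
    exists2 r : R, 0 < r & forall s, 0 <= s <= 1 -> s <= t + r -> F s = 0.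
  move=> /andP[t0 t1] Pt; have [|r [M [r0 Fr]]] := HF t; first by rewrite (ltW t0).
  have small (h : 'rV[R]_1) : 0 <= t + h 0 0 <= 1 -> `|h 0 0| <= r / 2 -> F (t + h 0 0) = 0.
    move: h; apply: (wiener_ident r0 Fr) => e e0.
    have [s /andP[es st] [s0 Ps]] := Pt e e0.
    exists (const_mx (s - t)); rewrite /= !mxE; last first.
      by rewrite addrCA subrr addr0; apply: Ps; rewrite s0 lexx.
    rewrite addrCA subrr addr0 s0 (ltW (lt_le_trans st t1)); split => //.
    by rewrite distrC gtr0_norm ?subr_gt0// st/= ltrBlDr -ltrBlDl.
  have r2 : 0 < r / 2 by rewrite divr_gt0.
  exists (r / 2) => // s /andP[s0 s1] sr.
  have [s' /andP[es st] [s'0 Ps]] := Pt (r / 2) r2.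
  have [ss|ss] := leP s s'; first by apply: Ps; rewrite s0.
  have := small (const_mx (s - t)); rewrite mxE addrCA subrr addr0 s0 s1; apply => //.
  by rewrite ler_norml; apply/andP; split; lra.
apply: (@real_induction c 1) => //.
- move=> t /andP[ct t1] Pt.
  have t0 : 0 < t by exact: lt_le_trans ct.
  have [||r r0 Pr] := ext t; first by rewrite t0 ltW.
    move=> e e0; exists (t - Num.min e t / 2).
      have m0 : 0 < Num.min e t by rewrite lt_min e0.
      have : Num.min e t <= e by rewrite ge_min lexx.
      by move=> me; apply/andP; split; lra.
    have mt : Num.min e t <= t by rewrite ge_min lexx orbT.
    have m0 : 0 < Num.min e t by rewrite lt_min e0.
    split; first by lra.
    by move=> s /andP[s0 st]; apply: Pt; rewrite s0; lra.
  exists (Num.min (t + r) 1).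
    by rewrite lt_min t1 ltrDl r0 ge_min lexx orbT.
  move=> s /andP[s0]; rewrite le_min => /andP[sr s1]; apply: Pr => //.
  by rewrite s0.
- move=> t /andP[ct t1] Pt; have [||r r0 Pr] := ext t.
  + by rewrite t1 (lt_trans c0).
  + move=> e e0; have [s sP [cs Ps]] := Pt e e0; exists s => //; split => //.
    by rewrite (le_trans _ cs)// ltW.
  + move=> s /andP[s0 st]; apply: Pr; first by rewrite s0 (le_trans st).
    by rewrite (le_trans st)// lerDl ltW.
Qed.

Lemma uniform_radius f (K : R) : real_analytic f ->
  exists rho M, 0 < rho /\ forall z, `|z| <= K ->
    wiener (l := 1) setT rho M (fun h => f (z + h 0 0)).
Proof.
move=> fan.
(* A single integer governs the radius 1/(n+1) and the bound n+1, so compactness of the segment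
   yields common values of both. *)
pose P (n : nat) (z : R) := wiener (l := 1) setT n.+1%:R^-1 n.+1%:R (fun h => f (z + h 0 0)).
have := @segment_compact R (- K) K; rewrite compact_near_coveringP => /(_ nat \oo P _).
case=> [b _|N _ HN]; last first.
  exists N.+1%:R^-1, N.+1%:R; split; first by rewrite invr_gt0.
  by move=> z zK; apply: (HN N) => /=; rewrite // in_itv /= -ler_norml.
have [r [M [r0 Mf]]] := real_analytic_wiener b fan.
have M0 := wiener_ge0 (ltW r0) Mf.
have r2 : 0 < r / 2 by rewrite divr_gt0.
exists ([set z | `|b - z| < r / 2], [set n | n.+1%:R^-1 < r / 2 /\ M <= n.+1%:R]).
  split => /=; first exact: nbhsx_ballx.
  near=> n; split; near: n.
    by apply: near_infty_natSinv_lt (PosNum r2).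
  exists (Num.bound M) => // n /= Mn.
  rewrite (le_trans (ltW (archi_boundP M0)))// ler_nat; exact: leq_trans Mn _.
move=> [z n] [/= zb [nr Mn]]; rewrite /P.
apply: (@wiener_weak _ _ setT _ (r / 2) M) => //; last by rewrite invr_ge0 ler0n ltW.
have Hw (i : 'I_1) : wiener (l := 1) setT (r / 2) r (fun h => (z - b) + h 0 0).
  apply: (@wiener_weak _ _ setT _ (r / 2) (`|z - b| + r / 2)) => //.
  - by apply: wiener_add; [exact: ltW|exact: wiener_cst|exact: wiener_coord].
  - by rewrite lexx ltW.
  - by rewrite distrC [leRHS]splitr lerD2r ltW.
have := wiener_subst (ltW r2) Mf Hw (fun _ _ _ => I); apply: wiener_ext => h _ _.
by rewrite mxE addrA (addrCA b) subrr addr0.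
Unshelve. all: by end_near. Qed.

(** A Lipschitz estimate in norm, with constant [M / rho]: [wiener_shrink] by the factor [d / rho],
    followed by substitution of [w]. *)
Lemma wiener_lip {l} (E : set 'rV[R]_l) f (rho M r d z : R) (w : 'rV[R]_l -> R) :
  0 < rho -> 0 <= r -> 0 <= d <= rho ->
  wiener (l := 1) setT rho M (fun h => f (z + h 0 0)) -> wiener E r d w ->
  wiener E r (d / rho * M) (fun h => f (z + w h) - f z).
Proof.
move=> rho0 r0 /andP[d0 dr] Hf Hw.
have k01 : 0 <= d / rho <= 1 by rewrite divr_ge0 ?(ltW rho0)//= ler_pdivrMr// mul1r.
have := wiener_shrink (ltW rho0) k01 I Hf; rewrite divfK ?gt_eqF// mxE addr0 => H.
have := @wiener_subst _ _ _ _ E d r _ _ (fun _ : 'I_1 => w) r0 H (fun=> Hw) (fun _ _ _ => I).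
by apply: wiener_ext => h _ _; rewrite mxE.
Qed.

End OneVar.

(** * Absolutely continuous functions *)

Section AbsCont.
Context {R : realType}.
Implicit Types (G : R -> R).
Let mu : measure _ _ := @lebesgue_measure R.

(* The intervals are listed from right to left. *)
Fixpoint interval_chain (a : R) (s : seq (R * R)) (t : R) : Prop :=
  if s is p :: s' then [/\ p.1 <= p.2, p.2 <= t & interval_chain a s' p.1]
  else a <= t.

Lemma interval_chain_le a s t t' : interval_chain a s t -> t <= t' -> interval_chain a s t'.
Proof.
case: s => [|p s] /=; first exact: le_trans.
by move=> [p12 pt c] tt; split => //; apply: le_trans tt.
Qed.

Lemma derive_slope_lt G (t v K : R) : is_derive t 1 G v -> v < K ->
  exists2 r : R, 0 < r & forall s, s != t -> `|s - t| < r -> (G s - G t) / (s - t) < K.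
Proof.
move=> [dG vE] vK.
have : h^-1 *: ((G \o shift t) (h *: 1) - G t) @[h --> 0^'] --> v by rewrite -vE.
move=> /cvgr_lt/(_ _ vK); rewrite near_withinE => -[r /= r0 Hr].
exists r => // s st str.
have := Hr (s - t); rewrite /= sub0r normrN => /(_ str); rewrite subr_eq0 => /(_ st).
by rewrite /shift /= [_ *: 1]mulr1 subrK [_ *: _]mulrC.
Qed.

(** The exceptional null set is covered by an open [O] of small measure. On the way from [a] to [b],
    a step inside [O] is recorded in a chain whose total length stays below the measure of [O], so
    absolute continuity makes its contribution small; any other step starts or ends at a point
    outside [O], where the slope is below [K + e]. *)
Lemma ac_mean_le G (a b K : R) : a <= b ->
  (forall e, 0 < e -> exists2 d : R, 0 < d & forall s, interval_chain a s b ->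
     \sum_(p <- s) (p.2 - p.1) < d -> \sum_(p <- s) (G p.2 - G p.1) < e) ->
  {ae mu, forall t : R, a < t < b -> exists2 v, v <= K & is_derive t 1 G v} ->
  G b - G a <= K * (b - a).
Proof.
move=> ab AC [N0 [mN0 N00 N0P]].
suff : forall e, 0 < e -> G b - G a <= (K + e) * (b - a) + (e + e).
  move=> H; apply/ler_addgt0Pr => e e0.
  have ba : 0 < b - a + 2 by rewrite ltr_wpDl// subr_ge0.
  have := H (e / (b - a + 2)) (divr_gt0 e0 ba); set e' := e / _.
  have -> : (K + e') * (b - a) + (e' + e') = K * (b - a) + e' * (b - a + 2) by ring.
  by rewrite divfK ?gt_eqF.
move=> e e0; have [d1 d10 Hd] := AC e e0.
have k1 : 0 < `|K + e| + 1 by rewrite ltr_wpDl.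
(* The second bound keeps [|K + e|] times the length of the chain below [e]: the chain intervals are
   also counted in (K + e) (t - a), possibly with the wrong sign. *)
pose d := Num.min d1 (e / (`|K + e| + 1)).
have d0 : 0 < d by rewrite lt_min d10 divr_gt0.
(* The endpoints join the null set because the derivative is known only inside ]a, b[. *)
pose N := N0 `|` ([set a] `|` [set b]).
have mN : measurable N by do 2?apply: measurableU => //; exact: measurable_set1.
have N0' : mu N = 0%E.
  rewrite /N setUC measureU0//; last by apply: measurableU; exact: measurable_set1.
  have m1 x : mu [set x] = 0%E by exact: lebesgue_measure_set1.
  by rewrite measureU0// m1.
have [|O [oO NO OD]] := lebesgue_regularity_outer mN _ d0; first by rewrite N0' ltry.
have mO : measurable O by exact: measurable_realfun.open_measurable.
have Od : (mu O < d%:E)%E.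
  apply: le_lt_trans OD; rewrite -[in leLHS](setDUK NO) (le_trans (measureU2 _ _ _))//.
    exact: measurableD.
  by rewrite [X in (X + _ <= _)%E]N0' add0e.
pose P t := exists s, [/\ interval_chain a s t,
   ((\sum_(p <- s) (p.2 - p.1))%:E <= mu (O `&` [set` `[a, t[]))%E &
   G t - G a <= (K + e) * (t - a) + (\sum_(p <- s) (G p.2 - G p.1) +
     `|K + e| * \sum_(p <- s) (p.2 - p.1))].
have mOi t : measurable (O `&` [set` `[a, t[]) by apply: measurableI.
have Padd s t : a <= s -> s < t -> [set` `[s, t[] `<=` O -> P s -> P t.
  move=> as_ st stO [L [cL lL gL]]; exists ((s, t) :: L); split => /=.
  - by split => //; apply: ltW.
  - rewrite big_cons /= EFinD addeC.
    have -> : O `&` [set` `[a, t[] = (O `&` [set` `[a, s[]) `|` [set` `[s, t[].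
      apply/seteqP; split => x /=; rewrite !in_itv /=.
        move=> [Ox /andP[ax xt]]; have [xs|sx] := ltP x s; [left|right] => //.
        by rewrite ax.
      move=> [[Ox /andP[ax xs]]|/andP[sx xt]].
        by split => //; rewrite ax (lt_trans xs).
      by split; [apply: stO; rewrite /= in_itv /= sx|rewrite (le_trans as_ sx)].
    have dis : (O `&` [set` `[a, s[]) `&` [set` `[s, t[] = set0.
      apply/seteqP; split => // x /=; rewrite !in_itv /=.
      by move=> [[_ /andP[_ xs]] /andP[sx _]]; move: xs; rewrite ltNge sx.
    have mst : mu [set` `[s, t[] = (t - s)%:E.
      by have := lebesgue_measure_itv `[s, t[; rewrite /= lte_fin st -EFinB.
    rewrite measureU ?dis//; last exact: mOi.
    by rewrite leeD// [leRHS]mst.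
  - rewrite !big_cons /=.
    have : - (K + e) * (t - s) <= `|K + e| * (t - s).
      by rewrite ler_wpM2r ?subr_ge0 ?(ltW st)// -normrN ler_norm.
    move: gL; nra.
have Pder s t : s < t -> G t - G s <= (K + e) * (t - s) -> P s -> P t.
  move=> st Gst [L [cL lL gL]]; exists L; split => /=.
  - exact: interval_chain_le cL (ltW st).
  - apply: (le_trans lL); apply: le_measure; rewrite ?inE; [exact: mOi|exact: mOi|].
    apply: setIS => x /=; rewrite !in_itv /= => /andP[-> xs]; exact: lt_trans st.
  - have -> : G t - G a = (G s - G a) + (G t - G s) by ring.
    have -> : (K + e) * (t - a) = (K + e) * (s - a) + (K + e) * (t - s) by ring.
    by rewrite [leRHS]addrAC lerD.
suff [L [cL lL gL]] : P b.
  have Ld : \sum_(p <- L) (p.2 - p.1) < d.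
    rewrite -lte_fin (le_lt_trans lL)// (le_lt_trans _ Od)//.
    by apply: le_measure; rewrite ?inE//; exact: mOi.
  move: Ld; rewrite lt_min => /andP[Ld1 Lk].
  apply: (le_trans gL); rewrite lerD2l lerD//; first by rewrite ltW// Hd.
  apply: (@le_trans _ _ (`|K + e| * (e / (`|K + e| + 1)))); first by rewrite ler_wpM2l// ltW.
  by rewrite mulrCA ger_pMr// ler_pdivrMr// mul1r lerDl.
have der t : a <= t <= b -> ~ O t -> exists2 r : R, 0 < r &
    forall s, s != t -> `|s - t| < r -> (G s - G t) / (s - t) < K + e.
  move=> /andP[at_ tb] nO.
  have nN : ~ N t by move=> /NO.
  have ta : t != a by apply: contra_not_neq nN => ->; right; left.
  have tnb : t != b by apply: contra_not_neq nN => ->; right; right.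
  have [v vK Gv] : exists2 v, v <= K & is_derive t 1 G v.
    apply: contrapT => nv; apply: nN; left; apply: N0P => /= H; apply: nv; apply: H.
    by rewrite !lt_neqAle [a == t]eq_sym ta tnb at_ tb.
  by apply: (derive_slope_lt Gv); rewrite (le_lt_trans vK)// ltrDl.
apply: (@real_induction _ a b) => //.
- exists [::]; rewrite /= !big_nil !subrr !mulr0 !addr0; split => //.
- move=> t /andP[at_ tb] Pt; have [Ot|nO] := pselect (O t).
    have [r /= r0 rO] : nbhs t O by move: oO; rewrite openE => /(_ _ Ot).
    exists (Num.min (t + r / 2) b).
      by rewrite lt_min ltrDl divr_gt0// tb/= ge_min lexx orbT.
    apply: (@Padd t) => //; first by rewrite lt_min ltrDl divr_gt0.
    move=> x /=; rewrite in_itv /= lt_min => /andP[tx /andP[xr _]]; apply: rO => /=.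
    by rewrite ler0_norm ?subr_le0//; lra.
  have [|r r0 Hr] := der t _ nO; first by rewrite at_ ltW.
  exists (Num.min (t + r / 2) b).
    by rewrite lt_min ltrDl divr_gt0// tb/= ge_min lexx orbT.
  set s := Num.min _ _; have ts : t < s by rewrite lt_min ltrDl divr_gt0.
  have sr : s <= t + r / 2 by rewrite ge_min lexx.
  apply: (@Pder t) => //; have := Hr s; rewrite gt_eqF// => /(_ erefl).
  rewrite gtr0_norm ?subr_gt0// ltr_pdivrMr ?subr_gt0// => H.
  by apply: ltW; apply: H; lra.
- move=> t /andP[at_ tb] Pt; have [Ot|nO] := pselect (O t).
    have [r /= r0 rO] : nbhs t O by move: oO; rewrite openE => /(_ _ Ot).
    have [s /andP[rs st] [as_ Ps]] := Pt r r0.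
    apply: (@Padd s) => // x /=; rewrite in_itv /= => /andP[sx xt]; apply: rO => /=.
    by rewrite gtr0_norm ?subr_gt0//; lra.
  have [|r r0 Hr] := der t _ nO; first by rewrite ltW.
  have [s /andP[rs st] [as_ Ps]] := Pt r r0.
  apply: (@Pder s) => //; have := Hr s; rewrite lt_eqF// => /(_ erefl).
  rewrite ltr0_norm ?subr_lt0// => /(_ _)/ltW.
  rewrite -mulrNN -invrN !opprB ler_pdivrMr ?subr_gt0//; apply; lra.
Qed.

End AbsCont.

(** * Trajectories and Euler iterates *)

Section MxNorm.
Context {R : realType} {m n : nat}.
Implicit Types x : 'M[R]_(m, n).

Lemma mx_entry_le x i j : `|x i j| <= `|x|.
Proof.
by rewrite [leRHS]/Num.Def.normr/= mx_normrE; exact: (le_bigmax _ _ (i, j)).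
Qed.

Lemma mx_norm_ub x (M : R) : 0 <= M -> (forall i j, `|x i j| <= M) -> `|x| <= M.
Proof.
move=> M0 H; by rewrite [leLHS]/Num.Def.normr/= mx_normrE bigmax_le// => ij _.
Qed.

End MxNorm.

Section Field.
Context {R : realType} {n : nat}.
Implicit Types (x y b : 'cV[R]_n) (A : 'M[R]_n) (f : R -> R).

Definition act_field f A b x : 'cV[R]_n := map_mx f (A *m x + b).

Definition mx_sum A : R := \sum_i \sum_j `|A i j|.

Lemma mx_sum_ge0 A : 0 <= mx_sum A.
Proof. by apply: sumr_ge0 => i _; apply: sumr_ge0. Qed.

Lemma row_sum_le A i : \sum_j `|A i j| <= mx_sum A.
Proof. by rewrite /mx_sum [leRHS](bigD1 i)//= lerDl; apply: sumr_ge0 => k _; apply: sumr_ge0. Qed.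

Lemma mulmx_norm_le A x i : `|(A *m x) i 0| <= mx_sum A * `|x|.
Proof.
rewrite mxE (le_trans (ler_norm_sum _ _ _))//.
apply: (@le_trans _ _ (\sum_j `|A i j| * `|x|)).
  by apply: ler_sum => j _; rewrite normrM ler_wpM2l// mx_entry_le.
by rewrite -mulr_suml ler_wpM2r// row_sum_le.
Qed.

Lemma lipschitzP f : lipschitz f ->
  exists2 k : R, 0 < k & forall a b : R, `|f a - f b| <= k * `|a - b|.
Proof.
move=> [M [_ HM]]; exists (Num.max (M + 1) 1).
  by rewrite lt_max ltr01 orbT.
move=> a b; have /HM H : M < Num.max (M + 1) 1 by rewrite lt_max ltrDl ltr01.
by have := H (a, b); apply.
Qed.

Lemma act_field_lip f A : lipschitz f -> exists2 L : R, 0 < L &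
  forall b x y, `|act_field f A b x - act_field f A b y| <= L * `|x - y|.
Proof.
move=> /lipschitzP[k k0 Hk]; exists (k * (mx_sum A + 1)).
  by rewrite mulr_gt0// ltr_wpDl// mx_sum_ge0.
move=> b x y; apply: mx_norm_ub.
  by rewrite !mulr_ge0// ?(ltW k0)// addr_ge0// mx_sum_ge0.
move=> i j; rewrite (ord1 j).
have -> : (act_field f A b x - act_field f A b y) i 0 = f ((A *m x + b) i 0) - f ((A *m y + b) i 0).
  by rewrite [LHS]mxE [X in _ + X]mxE /act_field [X in X - _]mxE [X in _ - X]mxE.
rewrite (le_trans (Hk _ _))// -mulrA ler_wpM2l ?(ltW k0)//.
have -> : (A *m x + b) i 0 - (A *m y + b) i 0 = (A *m (x - y)) i 0.
  by rewrite mulmxBr !mxE; ring.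
by rewrite (le_trans (mulmx_norm_le _ _ _))// ler_wpM2r// lerDl.
Qed.

(** The local error of one explicit Euler step; about a trajectory, convergence of the scheme needs
    to know nothing else. *)
Definition quad_approx (X : R -> 'cV[R]_n) (g : 'cV[R]_n -> 'cV[R]_n) (a b K : R) :=
  forall s t, a <= s -> s <= t -> t <= b ->
    `|X t - X s - (t - s) *: g (X s)| <= K * (t - s) ^+ 2.

End Field.

Section Solution.
Context {R : realType} {m n q : nat} {U : set 'cV[R]_m} (Sigma : rnn n q U).
Variables (u : {nonneg R} -> 'cV[R]_m) (x : {nonneg R} -> 'cV[R]_n) (y : {nonneg R} -> 'cV[R]_q).
Hypothesis sol : is_solution Sigma u x y.

Lemma time_ofE (t : R) : 0 <= t -> (time_of t)%:num = t.
Proof. by move=> t0 /=; apply/max_idPr. Qed.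

(** Translates chains into the indexed families of [locally_abs_continuous]: the intervals are
    disjoint since each lies to the left of those listed before it. *)
Lemma sol_ac (a b e : R) i : 0 <= a -> 0 < e -> exists2 d : R, 0 < d &
  forall s, interval_chain a s b -> \sum_(p <- s) (p.2 - p.1) < d ->
     \sum_(p <- s) `|ext x p.2 i 0 - ext x p.1 i 0| < e.
Proof.
move=> a0 e0; have [_ [AC _] _ _] := sol.
have [d d0 Hd] := AC b e e0; exists d => // s cs sd.
have chain_nth k : (k < size s)%N -> [/\ 0 <= (nth 0 s k).1,
    (nth 0 s k).1 <= (nth 0 s k).2, (nth 0 s k).2 <= b &
    forall j, (j < k)%N -> (nth 0 s k).2 <= (nth 0 s j).1].
  elim: s b cs k {AC Hd sd} => [//|p s IH] c /= [p12 pc cs] k.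
  have [p10 tl] : 0 <= p.1 /\ forall k, (k < size s)%N -> (nth 0 s k).2 <= p.1.
    split.
      have : a <= p.1; last exact: le_trans.
      elim: s (p.1) cs {IH k} => [//|p' s IH'] t /= [p12' p't /IH' H].
      by rewrite (le_trans H)// (le_trans p12').
    by move=> k' /(IH _ cs)[].
  case: k => [_|k]; first by split.
  rewrite ltnS => ks; have [H1 H2 H3 H4] := IH _ cs k ks; split => //=.
    by rewrite (le_trans H3)// (le_trans p12).
  by move=> [|j]; [move=> _; apply: tl|rewrite ltnS; apply: H4].
pose aa (j : 'I_(size s)) := time_of (nth 0 s j).1.
pose bb (j : 'I_(size s)) := time_of (nth 0 s j).2.
have aaE j : (aa j)%:num = (nth 0 s j).1.
  by apply: time_ofE; have [] := chain_nth j (ltn_ord j).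
have bbE j : (bb j)%:num = (nth 0 s j).2.
  by apply: time_ofE; have [h1 h2 _ _] := chain_nth j (ltn_ord j); apply: le_trans h2.
have := Hd (size s) aa bb.
have -> : \sum_i ((bb i)%:num - (aa i)%:num) = \sum_(p <- s) (p.2 - p.1).
  by rewrite (big_nth 0) big_mkord; apply: eq_bigr => j _; rewrite aaE bbE.
move=> /(_ _ _ sd) H.
apply: le_lt_trans (H _ _).
- rewrite (big_nth 0) big_mkord; apply: ler_sum => j _.
  have := mx_entry_le (x (bb j) - x (aa j)) i 0; rewrite !mxE; exact.
- by move=> j; rewrite aaE bbE; have [_ -> -> _] := chain_nth j (ltn_ord j).
apply/trivIsetP => j k _ _ jk; apply/seteqP; split => // z /=.
rewrite !in_itv /= !aaE !bbE => -[/andP[z1 z2] /andP[z3 z4]].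
have [jk'|kj|/ord_inj jk'] := ltngtP j k.
- have [_ _ _ /(_ _ jk')] := chain_nth k (ltn_ord k).
  by move=> /(lt_le_trans z4)/(lt_trans z1); rewrite ltxx.
- have [_ _ _ /(_ _ kj)] := chain_nth j (ltn_ord j).
  by move=> /(lt_le_trans z2)/(lt_trans z3); rewrite ltxx.
- by move: jk; rewrite jk' eqxx.
Qed.

(** [ac_mean_le] for the coordinate and for its opposite. A bound on the open interval suffices, so
    the input may jump at [a] and [b]. *)
Lemma sol_mean (a b c K : R) i : 0 <= a -> a <= b ->
  (forall t, a < t < b -> `|act_field (activation Sigma) (rnnA Sigma)
      (rnnB Sigma *m ext u t) (ext x t) i 0 - c| <= K) ->
  `|ext x b i 0 - ext x a i 0 - (b - a) * c| <= K * (b - a).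
Proof.
move=> a0 ab HK; have [_ _ dx _] := sol.
have der : {ae lebesgue_measure, forall t : R, a < t < b ->
    exists2 v, `|v - c| <= K & is_derive t 1 (fun t => ext x t i 0) v}.
  apply: (@filterS _ (almost_everywhere lebesgue_measure)) dx => t Ht /andP[at_ tb].
  have [D1 D2] := Ht (le_lt_trans a0 at_).
  exists (act_field (activation Sigma) (rnnA Sigma) (rnnB Sigma *m ext u t) (ext x t) i 0).
    by apply: HK; rewrite at_.
  have D3 := (derivable_mxP _ _ _).1 D1.
  split; first exact: D3.
  by rewrite /act_field -D2 (derive_mx D1) mxE.
have up : ext x b i 0 - ext x a i 0 <= (c + K) * (b - a).
  apply: (@ac_mean_le R (fun t => ext x t i 0)) => //.
    move=> e e0; have [d d0 Hd] := @sol_ac a b e i a0 e0; exists d => // s cs sd.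
    by apply: le_lt_trans (Hd s cs sd); apply: ler_sum => p _; apply: ler_norm.
  apply: (@filterS _ (almost_everywhere lebesgue_measure)) der => t Ht /Ht[v vK tv]; exists v => //.
  by rewrite -lerBlDl (le_trans (ler_norm _)).
have down : - ext x b i 0 - - ext x a i 0 <= (- c + K) * (b - a).
  apply: (@ac_mean_le R (fun t => - ext x t i 0)) => //.
    move=> e e0; have [d d0 Hd] := @sol_ac a b e i a0 e0; exists d => // s cs sd.
    apply: le_lt_trans (Hd s cs sd); apply: ler_sum => p _.
    by rewrite -opprD -normrN ler_norm.
  apply: (@filterS _ (almost_everywhere lebesgue_measure)) der => t Ht /Ht[v vK tv]; exists (- v).
    by move: vK; rewrite ler_norml => /andP[? ?]; lra.
  exact: is_deriveN.
rewrite ler_norml; apply/andP; split; lra.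
Qed.

Lemma sol_continuous : continuous (ext x).
Proof.
have [_ [AC _] _ _] := sol.
move=> t; apply/cvgrPdist_lt => e e0.
have [d d0 Hd] := AC (`|t| + 1) e e0.
have tof (z w : R) : `|(time_of z)%:num - (time_of w)%:num| <= `|z - w|.
  rewrite /= !maxEle; case: (leP 0 z) => z0; case: (leP 0 w) => w0 //.
  - by rewrite subr0 ger0_norm// (le_trans _ (ler_norm _))//; lra.
  - by rewrite sub0r normrN ger0_norm// distrC (le_trans _ (ler_norm _))//; lra.
  - by rewrite subrr normr0.
have bound z : `|z| <= `|t| + 1 -> (time_of z)%:num <= `|t| + 1.
  by move=> zt; rewrite /= ge_max addr_ge0//= (le_trans (ler_norm _)).
have key z w : `|w| <= `|t| + 1 -> `|w - z| < d ->
    (time_of z)%:num <= (time_of w)%:num -> `|ext x w - ext x z| < e.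
  move=> wt zw H; have := Hd 1%N (fun=> time_of z) (fun=> time_of w); rewrite !big_ord1.
  apply.
  - by move=> _; rewrite H bound.
  - by apply/trivIsetP => i j _ _; rewrite (ord1 i) (ord1 j) eqxx.
  - by rewrite (le_lt_trans (ler_norm _))// (le_lt_trans (tof _ _)).
have md : 0 < Num.min d 1 by rewrite lt_min d0 ltr01.
have : \forall s \near t, `|t - s| < Num.min d 1.
  exact: (nbhsx_ballx (t : R) _ md).
apply: filterS => s; rewrite lt_min => /andP[sd s1].
have bs : `|s| <= `|t| + 1.
  have -> : s = t - (t - s) by ring.
  by rewrite (le_trans (ler_normB _ _))// lerD2l ltW.
have [H|/ltW H] := leP (time_of s)%:num (time_of t)%:num.
  by apply: key => //; rewrite lerDl.
by rewrite distrC; apply: key => //; rewrite distrC.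
Qed.

Lemma sol_bounded (T : R) : 0 <= T -> exists2 M : R, 0 <= M &
  forall t, 0 <= t <= T -> `|ext x t| <= M.
Proof.
move=> T0.
have [|c _ Hc] := @EVT_max R (fun t => `|ext x t|) 0 T T0.
  by apply: continuous_subspaceT => t; apply: cvg_norm; apply: sol_continuous.
by exists `|ext x c| => // t t0T; apply: Hc; rewrite in_itv.
Qed.

(** A bootstrap: the trajectory is bounded on [a, b], so the field along it is bounded by [M1], so
    the trajectory is [M1]-Lipschitz in time, so the field stays within L M1 (t - s) of its value at
    time [s]. *)
Lemma sol_quad_approx (a b : R) alpha : 0 <= a ->
  (forall t, a <= t -> t < b -> ext u t = alpha) ->
  exists2 K : R, 0 <= K & quad_approx (ext x)
    (act_field (activation Sigma) (rnnA Sigma) (rnnB Sigma *m alpha)) a b K.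
Proof.
move=> a0 ua; have [ab|ba] := leP a b; last first.
  exists 0 => // s t as_ st tb; exfalso.
  by move: (le_trans as_ (le_trans st tb)); rewrite leNgt ba.
have [M M0 HM] := sol_bounded (le_trans a0 ab).
set f := act_field _ _ _.
have [L L0 HL] := act_field_lip (rnnA Sigma) (@activation_lipschitz _ _ _ _ _ Sigma).
pose M1 := L * M + `|f 0|.
have M10 : 0 <= M1 by rewrite addr_ge0// mulr_ge0// ltW.
have fM t : a <= t <= b -> `|f (ext x t)| <= M1.
  move=> /andP[at_ tb]; rewrite -[f _](subrK (f 0)) (le_trans (ler_normD _ _))//.
  rewrite lerD2r (le_trans (HL _ _ _))// subr0 ler_wpM2l ?(ltW L0)//.
  by apply: HM; rewrite (le_trans a0) ?tb.
have lip s t : a <= s -> s <= t -> t <= b -> `|ext x t - ext x s| <= M1 * (t - s).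
  move=> as_ st tb; apply: mx_norm_ub; first by rewrite mulr_ge0// subr_ge0.
  move=> i j; rewrite (ord1 j) !mxE.
  have := @sol_mean s t 0 M1 i (le_trans a0 as_) st; rewrite mulr0 subr0; apply.
  move=> z /andP[sz zt]; rewrite subr0 ua; last 2 first.
  - exact: le_trans (ltW sz).
  - exact: lt_le_trans tb.
  rewrite (le_trans (mx_entry_le _ _ _))// fM// (le_trans as_ (ltW sz))/=.
  by rewrite (le_trans (ltW zt)).
exists (L * M1); first by rewrite mulr_ge0// ltW.
move=> s t as_ st tb; apply: mx_norm_ub; first by rewrite !mulr_ge0 ?subr_ge0// ltW.
move=> i j; rewrite (ord1 j).
have -> : (ext x t - ext x s - (t - s) *: f (ext x s)) i 0 =
    ext x t i 0 - ext x s i 0 - (t - s) * f (ext x s) i 0.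
  by move: (f _) => w; rewrite !mxE.
rewrite expr2 mulrA; apply: sol_mean => //; first exact: le_trans as_.
move=> z /andP[sz zt]; rewrite ua; last 2 first.
- exact: le_trans (ltW sz).
- exact: lt_le_trans tb.
have -> : forall v w : 'cV[R]_n, v i 0 - w i 0 = (v - w) i 0 by move=> v w; rewrite !mxE.
rewrite (le_trans (mx_entry_le _ _ _))// (le_trans (HL _ _ _))// -mulrA.
rewrite ler_wpM2l ?(ltW L0)// (le_trans (lip _ _ as_ (ltW sz) _))//.
  exact: le_trans (ltW zt) tb.
by rewrite ler_wpM2l// lerD2r ltW.
Qed.

End Solution.

(** * Convergence of the Euler scheme *)

Section Euler.
Context {R : realType} {n : nat}.
Implicit Types (f : 'cV[R]_n -> 'cV[R]_n) (x : 'cV[R]_n).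

Definition euler_step f (d : R) x := x + d *: f x.

Definition euler f (N : nat) (theta : R) x :=
  iter N.+1 (euler_step f (theta / N.+1%:R)) x.

Lemma pow_le_expR (c : R) k : 0 <= c -> (1 + c) ^+ k <= expR (c * k%:R).
Proof.
move=> c0; rewrite expRM_natr lerXn2r ?nnegrE ?expR_ge0 ?addr_ge0//.
exact: expR_ge1Dx.
Qed.

Lemma euler_cvg f (L K a b : R) (X : R -> 'cV[R]_n) : 0 < L ->
  (forall x y, `|f x - f y| <= L * `|x - y|) -> a <= b -> 0 <= K ->
  quad_approx X f a b K -> euler f N (b - a) (X a) @[N --> \oo] --> X b.
Proof.
move=> L0 fL ab K0 XK.
have ba : 0 <= b - a by rewrite subr_ge0.
pose C := expR (L * (b - a)) * (K * (b - a) / L).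
have bound N : `|euler f N (b - a) (X a) - X b| <= C / N.+1%:R.
  pose d := (b - a) / N.+1%:R.
  have d0 : 0 <= d by rewrite divr_ge0.
  have dN : N.+1%:R * d = b - a by rewrite mulrCA divff ?mulr1// pnatr_eq0.
  pose e k := `|iter k (euler_step f d) (X a) - X (a + k%:R * d)|.
  (* Adding [K * d / L] turns the recursion e(k+1) <= (1 + L d) e(k) + K d^2 into a geometric
     one. *)
  have ek k : (k <= N.+1)%N -> e k + K * d / L <= (1 + L * d) ^+ k * (K * d / L).
    elim: k => [|k IH] kN.
      by rewrite /e /= mul0r addr0 subrr normr0 add0r expr0 mul1r.
    have {}IH := IH (ltnW kN).
    set z := iter k (euler_step f d) (X a).
    have step : e k.+1 <= (1 + L * d) * e k + K * d ^+ 2.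
      rewrite /e iterS -/z.
      have kd : a + k.+1%:R * d - (a + k%:R * d) = d by rewrite -natr1; ring.
      have := XK (a + k%:R * d) (a + k.+1%:R * d).
      rewrite kd lerDl mulr_ge0// -subr_ge0 kd d0 => /(_ erefl erefl).
      have -> : a + k.+1%:R * d <= b.
        rewrite -lerBrDl -dN ler_wpM2r// ler_nat//.
      move=> /(_ erefl) H.
      rewrite /euler_step [X in `|X|](_ : _ = (z - X (a + k%:R * d)) +
        d *: (f z - f (X (a + k%:R * d))) - 
        (X (a + k.+1%:R * d) - X (a + k%:R * d) - d *: f (X (a + k%:R * d)))); last first.
        by apply/matrixP => i j; rewrite !mxE; ring.
      rewrite (le_trans (ler_normB _ _))// lerD//.
      rewrite (le_trans (ler_normD _ _))// mulrDl mul1r lerD2l normrZ ger0_norm//.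
      by apply: (le_trans (ler_wpM2l d0 (fL _ _))); rewrite mulrCA mulrA.
    rewrite exprS -(mulrA (1 + L * d)); apply: (@le_trans _ _ ((1 + L * d) * (e k + K * d / L))).
      apply: (le_trans (lerD step (lexx _))).
      rewrite [leRHS]mulrDr -addrA lerD2l.
      by rewrite le_eqVlt; apply/orP; left; apply/eqP; field; rewrite gt_eqF.
    by rewrite ler_wpM2l// addr_ge0// mulr_ge0// ltW.
  have := ek N.+1 (leqnn _); rewrite /e dN [a + _]addrC subrK => H.
  have Kd0 : 0 <= K * d / L by rewrite divr_ge0 ?mulr_ge0// ltW.
  apply: (@le_trans _ _ ((1 + L * d) ^+ N.+1 * (K * d / L))).
    by apply: le_trans H; rewrite lerDl.
  have -> : C / N.+1%:R = expR (L * d * N.+1%:R) * (K * d / L).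
    by rewrite -mulrA [d * _]mulrC dN /C /d; ring.
  by rewrite ler_wpM2r// pow_le_expR// mulr_ge0// ltW.
apply/cvgrPdist_lt => e e0.
have : C * N.+1%:R^-1 @[N --> \oo] --> (C * 0 : R).
  by apply: cvgMl_tmp; exact: cvg_harmonic.
move=> /cvgrPdist_lt/(_ _ e0); apply: filterS => N.
rewrite mulr0 sub0r normrN => H; rewrite distrC (le_lt_trans (bound N))//.
exact: le_lt_trans (ler_norm _) H.
Qed.

(** A limit of Euler iterates instead of a chosen solution: the new state depends on the old state,
    the duration and the input value alone. *)
Definition flow f (theta : R) x : 'cV[R]_n := lim (euler f N theta x @[N --> \oo]).

Lemma flow_cvg f theta x z : euler f N theta x @[N --> \oo] --> z -> flow f theta x = z.
Proof. by move=> H; apply/cvg_lim => //; exact: norm_hausdorff. Qed.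

Lemma flow0 f x : flow f 0 x = x.
Proof.
apply: flow_cvg; have E N : euler f N 0 x = x.
  rewrite /euler mul0r; elim: (N.+1) => //= k ->.
  by rewrite /euler_step scale0r addr0.
by under eq_fun do rewrite E; exact: cvg_cst.
Qed.

End Euler.

(** * States reached by words of input values and durations *)

Section Words.
Context {R : realType} {m n q : nat} {U : set 'cV[R]_m} (Sigma : rnn n q U).
Variables (X : Upc U -> {nonneg R} -> 'cV[R]_n) (Y : Upc U -> {nonneg R} -> 'cV[R]_q).
Hypothesis sol : forall u, is_solution Sigma (val u) (X u) (Y u).

Definition rnn_field (alpha : 'cV[R]_m) : 'cV[R]_n -> 'cV[R]_n :=
  act_field (activation Sigma) (rnnA Sigma) (rnnB Sigma *m alpha).

Lemma rnn_field_lip : exists2 L : R, 0 < L &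
  forall alpha x y, `|rnn_field alpha x - rnn_field alpha y| <= L * `|x - y|.
Proof.
have [L L0 HL] := act_field_lip (rnnA Sigma) (@activation_lipschitz _ _ _ _ _ Sigma).
by exists L => // alpha x y; apply: HL.
Qed.

Definition run (W : seq (U * R)) : 'cV[R]_n :=
  foldl (fun x w => flow (rnn_field (val w.1)) w.2 x) (init Sigma) W.

Lemma run_rcons W w : run (rcons W w) = flow (rnn_field (val w.1)) w.2 (run W).
Proof. by rewrite /run -cats1 foldl_cat. Qed.

Lemma sol_euler_cvg (u : Upc U) (a b : R) (alpha : 'cV[R]_m) : 0 <= a -> a <= b ->
  (forall t, a <= t -> t < b -> ext (val u) t = alpha) ->
  euler (rnn_field alpha) N (b - a) (ext (X u) a) @[N --> \oo] --> ext (X u) b.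
Proof.
move=> a0 ab ua; have [K K0 HK] := sol_quad_approx (sol u) a0 ua.
have [L L0 HL] := rnn_field_lip.
exact: (euler_cvg L0 (HL alpha) ab K0 HK).
Qed.

Lemma sol_flow (u : Upc U) (a b : R) (alpha : 'cV[R]_m) : 0 <= a -> a <= b ->
  (forall t, a <= t -> t < b -> ext (val u) t = alpha) ->
  ext (X u) b = flow (rnn_field alpha) (b - a) (ext (X u) a).
Proof. by move=> a0 ab ua; apply/esym; apply: flow_cvg; apply: sol_euler_cvg. Qed.

Lemma seq_gap (s : seq R) (t : R) :
  exists2 r : R, 0 < r & forall z, z \in s -> `|z - t| < r -> z = t.
Proof.
elim: s => [|z s [r r0 Hr]]; first by exists 1.
have [->|zt] := eqVneq z t.
  by exists r => // w; rewrite inE => /predU1P[->|/Hr].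
exists (Num.min r `|z - t|); first by rewrite lt_min r0 normr_gt0 subr_eq0.
move=> w; rewrite inE lt_min => /predU1P[->|ws] /andP[wr wz]; last exact: Hr.
by rewrite ltxx in wz.
Qed.

Lemma Upc_U (u : Upc U) t : val u t \in U.
Proof. by case: u => u /= /set_mem[uU _]; apply/mem_set. Qed.

(** Real induction over time, with one more letter for each interval free of switching times. Inputs
    that agree before [T] receive the same word, which gives causality; that every state comes from
    a finite word is what later allows two states to be joined by a segment of durations. *)
Lemma reach (u v : Upc U) (T : R) : 0 <= T ->
  (forall t, 0 <= t -> t < T -> ext (val u) t = ext (val v) t) ->
  exists W, [/\ all (fun w => 0 <= w.2) W, ext (X u) T = run W & ext (X v) T = run W].
Proof.
move=> T0 uv; have [_ /(_ T)[F /finite_seqP[Fs FE] HF]] := set_mem (valP u).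
pose P T' := exists W, [/\ all (fun w : U * R => 0 <= w.2) W,
  ext (X u) T' = run W & ext (X v) T' = run W].
(* A switching time at [s] or [t] itself is allowed: [Upc] tests half-open intervals ]a, b], and
   only input values before [t] matter. *)
have ext_run s t : 0 <= s -> s <= t -> t <= T -> P s ->
    (forall z, z \in Fs -> s < z -> z < t -> False) -> P t.
  move=> s0 st tT [W [W0 us vs]] noF.
  pose al : U := SigSub (Upc_U u (time_of s)).
  have uc z : s <= z -> z < t -> ext (val u) z = val al.
    move=> sz zt; apply/esym; apply: HF.
      by rewrite !time_ofE ?(le_trans s0)// sz (le_trans (ltW zt)).
    move=> w; rewrite FE /= !time_ofE ?(le_trans s0)// => wF /andP[sw wz].
    by apply: (noF w wF sw); apply: le_lt_trans zt.
  have vc z : s <= z -> z < t -> ext (val v) z = val al.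
    move=> sz zt; rewrite -(uc z)// uv//; [exact: le_trans sz|exact: lt_le_trans tT].
  exists (rcons W (al, t - s)); split.
  - by rewrite all_rcons W0 /= subr_ge0 st.
  - by rewrite run_rcons -us; apply: sol_flow.
  - by rewrite run_rcons -vs; apply: sol_flow.
apply: (@real_induction _ 0 T P) => //.
- exists [::]; split => //.
    by have [_ [_ E] _ _] := sol u; exact: E.
  by have [_ [_ E] _ _] := sol v; exact: E.
- move=> t /andP[t0 tT] Pt; have [r r0 Hr] := seq_gap Fs t.
  exists (Num.min (t + r / 2) T); first by rewrite lt_min ltrDl divr_gt0// tT ge_min lexx orbT.
  apply: (ext_run t) => //.
  + by rewrite le_min lerDl divr_ge0 ?(ltW r0)// ltW.
  + by rewrite ge_min lexx orbT.
  + move=> z zF tz; rewrite lt_min => /andP[zr _].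
    have := Hr z zF; rewrite gtr0_norm ?subr_gt0// => zt.
    by move: tz; rewrite zt ?ltxx//; lra.
- move=> t /andP[t0 tT] Pt; have [r r0 Hr] := seq_gap Fs t.
  have [s /andP[rs st] [s0 Ps]] := Pt r r0.
  apply: (ext_run s) => //; first exact: ltW.
  move=> z zF sz zt; have := Hr z zF; rewrite ltr0_norm ?subr_lt0// => zE.
  by move: zt; rewrite zE ?ltxx//; lra.
Qed.

Lemma sol_causal (u v : Upc U) (T : R) : 0 <= T ->
  (forall t, 0 <= t -> t < T -> ext (val u) t = ext (val v) t) ->
  ext (X u) T = ext (X v) T.
Proof. by move=> T0 /(reach T0)[W [_ -> ->]]. Qed.

Section Switch.
Context {l : nat} (alpha : 'I_l.+1 -> U) (t : 'rV[R]_l.+1).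
Hypothesis t0 : orthant l.+1 t.

Lemma switch_time0 : switch_time t 0 = 0.
Proof. by rewrite /switch_time big_pred0. Qed.

Lemma switch_timeS (i : 'I_l.+1) : switch_time t i.+1 = switch_time t i + t 0 i.
Proof.
rewrite /switch_time (bigD1 i)//= addrC; congr (_ + _); apply: eq_bigl => j.
by rewrite ltnS ltn_neqAle andbC -(inj_eq val_inj).
Qed.

Lemma le_switch_time i j : (i <= j)%N -> switch_time t i <= switch_time t j.
Proof.
move=> ij; rewrite /switch_time [leRHS](bigID (fun k : 'I_l.+1 => (k < i)%N)) /=.
rewrite [X in X + _](eq_bigl (fun k : 'I_l.+1 => (k < i)%N)); last first.
  by move=> k; rewrite andb_idl// => /leq_trans; apply.
by rewrite lerDl; apply: sumr_ge0 => k _; apply: t0.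
Qed.

Lemma switch_time_ge0 i : 0 <= switch_time t i.
Proof. by apply: sumr_ge0 => j _; apply: t0. Qed.

Lemma switch_funE (i : 'I_l.+1) (z : R) : switch_time t i <= z -> z < switch_time t i.+1 ->
  ext (val (switch alpha t)) z = val (alpha i).
Proof.
move=> iz zi; have z0 : 0 <= z by apply: le_trans iz; apply: switch_time_ge0.
rewrite /ext /= /switch_fun time_ofE//; case: pickP => [j /andP[jz zj]|/(_ i)]; last first.
  by rewrite iz zi.
suff -> : j = i by [].
apply/val_inj; apply/eqP; rewrite eqn_leq; apply/andP; split; rewrite leqNgt; apply/negP => lt_.
  by have := le_trans (le_switch_time lt_) jz; rewrite leNgt zi.
by have := le_trans (le_switch_time lt_) iz; rewrite leNgt zj.
Qed.

Lemma sol_switch_cvg (i : 'I_l.+1) :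
  euler (rnn_field (val (alpha i))) N (t 0 i) (ext (X (switch alpha t)) (switch_time t i))
    @[N --> \oo] --> ext (X (switch alpha t)) (switch_time t i.+1).
Proof.
have := @sol_euler_cvg (switch alpha t) (switch_time t i) (switch_time t i.+1)
  (val (alpha i)) (switch_time_ge0 _) (le_switch_time (leqnSn _)).
have -> : switch_time t i.+1 - switch_time t i = t 0 i.
  by rewrite switch_timeS addrAC subrr add0r.
by apply; exact: switch_funE.
Qed.

Lemma sol_switch : ext (X (switch alpha t)) (switch_time t l.+1) =
  run [seq (alpha i, t 0 i) | i <- enum 'I_l.+1].
Proof.
suff H k : (k <= l.+1)%N -> ext (X (switch alpha t)) (switch_time t k) =
    run (take k [seq (alpha i, t 0 i) | i <- enum 'I_l.+1]).
  by rewrite H// take_oversize// size_map size_enum_ord.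
elim: k => [_|k IH kl].
  by rewrite take0 switch_time0; have [_ [_ E] _ _] := sol (switch alpha t); exact: E.
pose i := Ordinal kl.
rewrite (take_nth (alpha i, t 0 i)); last by rewrite size_map size_enum_ord.
rewrite run_rcons -IH; last exact: ltnW.
rewrite (nth_map i); last by rewrite size_enum_ord.
have -> : nth i (enum 'I_l.+1) k = i by apply: val_inj; rewrite /= nth_enum_ord.
by apply/esym; apply: flow_cvg; exact: (@sol_switch_cvg i).
Qed.

End Switch.
End Words.

(** * Analyticity in the switching times *)

Lemma cvg_mx_entry (R : realType) (m n : nat) (T : Type) (F : set_system T)
    (f : T -> 'M[R]_(m, n)) (l : 'M[R]_(m, n)) i j :
  f x @[x --> F] --> l -> f x i j @[x --> F] --> l i j.
Proof.
move=> H; exact: (cvg_comp f (fun M : 'M[R]_(m, n) => M i j) H (@coord_continuous R m n i j l)).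
Qed.

Section EulerAnalytic.
Context {R : realType} {n l : nat}.

(** The growth |f z| <= L |z| + |f 0| becomes homogeneous after adding |f 0| / L to the norm. *)
Lemma iter_euler_bound (f : 'cV[R]_n -> 'cV[R]_n) (L d : R) x k : 0 < L -> 0 <= d ->
  (forall x y, `|f x - f y| <= L * `|x - y|) ->
  `|iter k (euler_step f d) x| + `|f 0| / L <= (1 + L * d) ^+ k * (`|x| + `|f 0| / L).
Proof.
move=> L0 d0 fL; elim: k => [|k IH]; first by rewrite expr0 mul1r.
rewrite iterS exprS -(mulrA (1 + L * d)); set z := iter k _ _ in IH *.
apply: (@le_trans _ _ ((1 + L * d) * (`|z| + `|f 0| / L))); last first.
  by rewrite ler_wpM2l// addr_ge0// mulr_ge0// ltW.
have fz : `|f z| <= L * `|z| + `|f 0|.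
  rewrite -[f z](subrK (f 0)) (le_trans (ler_normD _ _))// lerD2r.
  by have := fL z 0; rewrite subr0.
have -> : (1 + L * d) * (`|z| + `|f 0| / L) =
   `|z| + d * (L * `|z| + `|f 0|) + `|f 0| / L by field; rewrite gt_eqF.
rewrite lerD2r (le_trans (ler_normD _ _))// lerD2l normrZ ger0_norm//.
by rewrite ler_wpM2l.
Qed.

Lemma euler_step_act_fieldE (f : R -> R) (A : 'M[R]_n) (b : 'cV[R]_n) d x i :
  euler_step (act_field f A b) d x i 0 = x i 0 + d * f ((A *m x + b) i 0).
Proof. by rewrite mxE; congr (_ + _); rewrite mxE; congr (_ * _); rewrite mxE. Qed.

(* In the norm of [wiener], the deviation of the Euler iterates from those started
   at the centre obeys a discrete Gronwall inequality. *)
Lemma wiener_euler (f : R -> R) (A : 'M[R]_n) (b : 'cV[R]_n) (E : set 'rV[R]_l)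
    (r0 M0 theta : R) (Z : 'rV[R]_l -> 'cV[R]_n) (j : 'I_l) :
  real_analytic f -> lipschitz f -> E 0 -> 0 < r0 -> 0 <= theta ->
  (forall i, wiener E r0 M0 (fun h => Z h i 0)) ->
  exists r M, 0 < r /\ forall N i,
    wiener E r M (fun h => euler (act_field f A b) N (theta + h 0 j) (Z h) i 0).
Proof.
move=> fan flip E0 r00 th0 HZ.
have [i0 _|n0] := pickP (predT : pred 'I_n); last first.
  by exists 1, 0; split => // N i; have := n0 i.
have M00 : 0 <= M0 := wiener_ge0 (ltW r00) (HZ i0).
pose g := act_field f A b.
have [L L0 /(_ b) HL] := act_field_lip A flip.
(* Bounds the Euler iterates started at [Z 0] for every number of steps. The arguments passed to [f]
   are then at most [S * Kc + |b|], so one radius [rho] serves them all. *)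
pose Kc := expR (L * theta) * (`|Z 0| + `|g 0| / L).
pose S := mx_sum A; have S0 : 0 <= S := mx_sum_ge0 A.
have [rho [Mf [rho0 HMf]]] := uniform_radius (S * Kc + `|b|) fan.
have Kc0 : 0 <= Kc by rewrite mulr_ge0 ?expR_ge0// addr_ge0// divr_ge0// ltW.
have Mf0 : 0 <= Mf.
  apply: (wiener_ge0 (ltW rho0) (HMf 0 _)).
  by rewrite normr0 addr_ge0// mulr_ge0.
pose La := Mf / rho; have La0 : 0 <= La by rewrite divr_ge0// ltW.
(* Growth rate of the Gronwall argument; the 1 makes it positive, since it is used as a divisor. *)
pose C := theta * La * S + 1.
have C0 : 0 < C by rewrite ltr_wpDl// mulr_ge0// mulr_ge0.
pose B := expR C * (M0 / r0 + Mf / C).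
have B0 : 0 <= B.
  by rewrite mulr_ge0 ?expR_ge0// addr_ge0// divr_ge0// ltW.
(* The initial deviation and the forcing by [h 0 j] are both proportional to [r], so all deviations
   are at most [r * B] with [B] free of [r]. Now [r] is small enough for A times a deviation to stay
   within [rho]. *)
pose r := Num.min r0 (rho / (S * B + 1)).
have SB1 : 0 < S * B + 1 by rewrite ltr_wpDl// mulr_ge0.
have r_gt0 : 0 < r by rewrite lt_min r00 divr_gt0.
have rr0 : r <= r0 by rewrite ge_min lexx.
have SBr : S * (r * B) <= rho.
  have : r <= rho / (S * B + 1) by rewrite ge_min lexx orbT.
  rewrite ler_pdivlMr// mulrDr mulr1 mulrCA => H; apply: le_trans H.
  by rewrite lerDl ltW.
exists r, (Kc + r * B); split => // N i.
pose N' : R := N.+1%:R; have N0 : 0 < N' by rewrite ltr0n.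
pose c := C / N'; have c0 : 0 <= c by rewrite divr_ge0// ltW.
pose D := r * Mf / C; have D0 : 0 <= D by rewrite divr_ge0 ?mulr_ge0// ltW.
(* The solution of w(k+1) = (1 + c) w(k) + c D whose value at 0 is (r / r0) M0, the bound that
   [wiener_shrink] gives for the initial deviation. *)
pose w k := (1 + c) ^+ k * (r / r0 * M0 + D) - D.
have w0D : 0 <= r / r0 * M0 + D by rewrite addr_ge0// mulr_ge0// divr_ge0// ltW.
have wS k : w k.+1 = (1 + c) * w k + c * D.
  by rewrite /w exprS; ring.
have w_ge0 k : 0 <= w k.
  elim: k => [|k IH]; first by rewrite /w expr0 mul1r addrK mulr_ge0// divr_ge0// ltW.
  by rewrite wS; apply: addr_ge0; apply: mulr_ge0 => //; apply: addr_ge0.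
have w_le k : (k <= N.+1)%N -> w k <= r * B.
  move=> kN; apply: (@le_trans _ _ ((1 + c) ^+ k * (r / r0 * M0 + D))).
    by rewrite gerBl.
  have -> : r * B = expR C * (r / r0 * M0 + D).
    by rewrite /B /D; field; rewrite !gt_eqF.
  rewrite ler_wpM2r//.
  apply: (@le_trans _ _ ((1 + c) ^+ N.+1)).
    by rewrite ler_weXn2l// lerDl.
  by rewrite (le_trans (pow_le_expR _ c0))// /c -/N' divfK// gt_eqF.
pose z k := iter k (euler_step g (theta / N')) (Z 0).
pose Zk k (h : 'rV[R]_l) := iter k (euler_step g ((theta + h 0 j) / N')) (Z h).
have z_le k : (k <= N.+1)%N -> `|z k| <= Kc.
  move=> kN; have d0 : 0 <= theta / N' by rewrite divr_ge0// ltW.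
  have := iter_euler_bound (Z 0) k L0 d0 HL; rewrite -/(z k) => H.
  apply: (@le_trans _ _ ((1 + L * (theta / N')) ^+ k * (`|Z 0| + `|g 0| / L))).
    by apply: le_trans H; rewrite lerDl divr_ge0// ltW.
  have Ld0 : 0 <= L * (theta / N') by rewrite mulr_ge0// ltW.
  rewrite ler_wpM2r//; first by rewrite addr_ge0// divr_ge0// ltW.
  apply: (@le_trans _ _ ((1 + L * (theta / N')) ^+ N.+1)).
    by rewrite ler_weXn2l// lerDl.
  by rewrite (le_trans (pow_le_expR _ Ld0))// -/N' mulrA divfK// gt_eqF.
have main k : (k <= N.+1)%N -> forall i, wiener E r (w k) (fun h => Zk k h i 0 - z k i 0).
  elim: k => [_ {}i|k IH kN {}i].
    rewrite /w expr0 mul1r addrK.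
    have := @wiener_shrink _ _ E r0 (r / r0) M0 _ (ltW r00) _ E0 (HZ i).
    rewrite divfK ?gt_eqF//; apply.
    by rewrite divr_ge0 ?(ltW r00) ?(ltW r_gt0)//= ler_pdivrMr// mul1r.
  have {}IH := IH (ltnW kN).
  pose z' := (A *m z k + b) i 0.
  have z'le : `|z'| <= S * Kc + `|b|.
    rewrite /z' mxE (le_trans (ler_normD _ _))// lerD ?mx_entry_le//.
    by rewrite (le_trans (mulmx_norm_le _ _ _))// ler_wpM2l// z_le// ltnW.
  pose AW (h : 'rV[R]_l) := \sum_i' A i i' * (Zk k h i' 0 - z k i' 0).
  have AWE h : (A *m Zk k h + b) i 0 = z' + AW h.
    rewrite /z' /AW [in LHS]mxE [in RHS]mxE addrAC; congr (_ + _).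
    rewrite !mxE -big_split /=; apply: eq_bigr => i' _; ring.
  have Sw : S * w k <= rho by rewrite (le_trans _ SBr)// ler_wpM2l// w_le// ltnW.
  have clsAW : wiener E r (S * w k) AW.
    apply: (@wiener_weak _ _ E _ r (\sum_i' `|A i i'| * w k)) => //.
    - by apply: wiener_sum => [|i']; [exact: ltW|apply: wiener_scale => //; exact: ltW].
    - by rewrite lexx ltW.
    - by rewrite -mulr_suml ler_wpM2r// row_sum_le.
  have c1 := wiener_lip rho0 (ltW r_gt0) (introT andP (conj (mulr_ge0 S0 (w_ge0 k)) Sw)) (HMf _ z'le) clsAW.
  have c2 : wiener E r Mf (fun h => f (z' + AW h)).
    have clsAW' : wiener E r rho AW by apply: (wiener_weak clsAW) => //; rewrite lexx ltW.
    have := @wiener_subst _ _ _ _ E rho r _ _ (fun _ : 'I_1 => AW) (ltW r_gt0) (HMf _ z'le)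
      (fun=> clsAW') (fun _ _ _ => I).
    by apply: wiener_ext => h _ _; rewrite mxE.
  have d1 := wiener_scale (theta / N') (ltW r_gt0) c1.
  have d2 := wiener_mul (ltW r_gt0) (wiener_scale N'^-1 (ltW r_gt0) (@wiener_coord _ _ E r j)) c2.
  have d3 := wiener_add (ltW r_gt0) (wiener_add (ltW r_gt0) (IH i) d1) d2.
  apply: (wiener_weak (E := E) (r := r)
    (M := w k + `|theta / N'| * (S * w k / rho * Mf) + `|N'^-1| * r * Mf)) => //.
  - apply: (wiener_ext _ d3) => h _ _.
    have -> : Zk k.+1 h i 0 = Zk k h i 0 + (theta + h 0 j) / N' * f (z' + AW h).
      by rewrite -AWE /Zk iterS euler_step_act_fieldE.
    have -> : z k.+1 i 0 = z k i 0 + theta / N' * f z'.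
      by rewrite /z iterS euler_step_act_fieldE.
    by ring.
  - by rewrite lexx ltW.
  - rewrite wS !ger0_norm ?invr_ge0 ?divr_ge0 ?(ltW N0)//.
    have -> : (1 + c) * w k + c * D = w k + theta / N' * (S * w k / rho * Mf) +
        N'^-1 * r * Mf + w k / N'.
      have -> : c * D = N'^-1 * r * Mf by rewrite /c /D; field; rewrite !gt_eqF.
      by rewrite /c /C /La; field; rewrite !gt_eqF.
    by rewrite lerDl divr_ge0// ltW.
have := main N.+1 (leqnn _) i.
have cz := @wiener_cst _ _ E r (z N.+1 i 0).
move=> /(wiener_add (ltW r_gt0) cz) H.
apply: (@wiener_weak _ _ E _ r (`|z N.+1 i 0| + w N.+1)) => //.
- by apply: (wiener_ext _ H) => h _ _; rewrite addrCA subrr addr0.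
- by rewrite lexx ltW.
- by rewrite lerD// ?w_le// (le_trans (mx_entry_le _ _ _))// z_le.
Qed.

End EulerAnalytic.

Section SwitchAnalytic.
Context {R : realType} {m n q : nat} {U : set 'cV[R]_m} (Sigma : rnn n q U).
Variables (X : Upc U -> {nonneg R} -> 'cV[R]_n) (Y : Upc U -> {nonneg R} -> 'cV[R]_q).
Hypothesis sol : forall u, is_solution Sigma (val u) (X u) (Y u).
Hypothesis act_an : real_analytic (activation Sigma).

Lemma wiener_family {l} (E : set 'rV[R]_l) (F : 'I_n -> 'rV[R]_l -> R) : 
  (forall i, exists r M, 0 < r /\ wiener E r M (F i)) ->
  exists r M, 0 < r /\ forall i, wiener E r M (F i).
Proof.
move=> H; pose rM i := cid (H i).
pose rr i := sval (rM i); pose MM i := sval (cid (svalP (rM i))).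
have HM i : 0 < rr i /\ wiener E (rr i) (MM i) (F i) by rewrite /MM; case: cid.
exists (\big[Num.min/1]_i rr i), (\sum_i `|MM i|); split.
  by elim/big_ind : _ => // [x y x0 y0|i _]; [rewrite lt_min x0|have [] := HM i].
move=> i; have [r0 Hi] := HM i; apply: (wiener_weak Hi) => //.
  apply/andP; split; last exact: bigmin_le.
  by elim/big_ind : _ => // [x y x0 y0|k _]; [rewrite le_min x0|have [/ltW] := HM k].
by rewrite (le_trans (ler_norm _))// [leRHS](bigD1 i)//= lerDl sumr_ge0.
Qed.

(** Induction on the pieces: the state at one switching time is the initial value [Z] of the Euler
    iterates on the next piece, whose duration is [a 0 j + h 0 j], and their limit inherits radius
    and bound. *)
Lemma wiener_switch {l} (alpha : 'I_l.+1 -> U) k : (k <= l.+1)%N ->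
  forall a, orthant l.+1 a -> exists r M, 0 < r /\ forall i,
    wiener [set h | orthant l.+1 (a + h)] r M
      (fun h => ext (X (switch alpha (a + h))) (switch_time (a + h) k) i 0).
Proof.
elim: k => [_|k IH kl] a a0.
  exists 1, `|init Sigma|; split => // i.
  apply: (@wiener_weak _ _ setT _ 1 `|init Sigma i 0|) => //; [|by rewrite ler01 lexx|exact: mx_entry_le].
  apply: (wiener_ext _ (@wiener_cst _ _ setT 1 (init Sigma i 0))) => h _ _.
  rewrite switch_time0; by have [_ [_ E] _ _] := sol (switch alpha (a + h)); rewrite [ext _ _]E.
have [r0 [M0 [r00 HZ]]] := IH (ltnW kl) a a0.
pose j := Ordinal kl.
have E0 : [set h | orthant l.+1 (a + h)] 0 by rewrite /= addr0.
have [r [M [r_gt0 HN]]] := wiener_euler (rnnA Sigma) (rnnB Sigma *m val (alpha j)) j act_an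
  (@activation_lipschitz _ _ _ _ _ Sigma) E0 r00 (a0 j) HZ.
exists r, M; split => // i.
apply: (wiener_seq_lim (HN^~ i)) => h hE hr.
have := @sol_switch_cvg _ _ _ _ _ Sigma X Y sol l alpha (a + h) hE j.
rewrite mxE => H.
exact: cvg_mx_entry H.
Qed.

End SwitchAnalytic.

(** * Functions of the state *)

Section AnalyticDerivative.
Context {R : realType}.
Implicit Types (c : nat -> R) (f : R -> R).

(** Comparison with the absolute series at a point y between z and x, by (k + 1) z^k <= y^(k+1) / (y
    - z). *)
Lemma cvg_pseries_diffs c (x z : R) : 0 < z -> z < x ->
  cvgn (pseries c x) -> cvgn (pseries (pseries_diffs c) z).
Proof.
move=> z0 zx cx; pose y := (z + x) / 2.
have zy : z < y by rewrite /y; lra.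
have y0 : 0 < y by exact: lt_trans zy.
have yx : `|y| < `|x| by rewrite !gtr0_norm ?(lt_trans z0)// /y; lra.
have cy := is_cvg_pseries_inside_norm cx yx.
have S1 : cvgn (series (fun k => `|c k.+1| * y ^+ k.+1)).
  have -> : series (fun k => `|c k.+1| * y ^+ k.+1) =
      (fun k => pseries (fun i => `|c i|) y k.+1 - `|c 0%N|).
    apply/funext => k; rewrite /pseries /series /= big_nat_recl//= expr0 mulr1.
    by rewrite [_ - _]addrAC subrr add0r.
  apply: is_cvgB; last exact: is_cvg_cst.
  have /cvg_ex[l H] := cy; apply/cvg_ex; exists l.
  by move: H; rewrite -cvg_shiftS.
have yz : 0 < y - z by rewrite subr_gt0.
have S2 : cvgn (series (fun k => (y - z)^-1 * (`|c k.+1| * y ^+ k.+1))).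
  have -> : series (fun k => (y - z)^-1 * (`|c k.+1| * y ^+ k.+1)) =
     (fun n => (y - z)^-1 * series (fun k => `|c k.+1| * y ^+ k.+1) n).
    by apply/funext => n; rewrite /series /= mulr_sumr.
  by apply: is_cvgMl_tmp.
apply: normed_cvg; apply: series_le_cvg S2 => k.
- exact: normr_ge0.
- by rewrite mulr_ge0 ?invr_ge0 ?(ltW yz)// mulr_ge0// exprn_ge0// ltW.
rewrite /= /pseries_diffs normrM normrM normrX (gtr0_norm z0) ger0_norm//.
rewrite mulrAC mulrC [leRHS]mulrCA ler_wpM2l//.
rewrite ler_pdivlMl//.
have -> : y ^+ k.+1 = z ^+ k.+1 + (y - z) * \sum_(i < k.+1) y ^+ (k.+1.-1 - i) * z ^+ i.
  by rewrite -subrXX addrC subrK.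
rewrite -[leLHS]add0r lerD ?exprn_ge0 ?(ltW z0)// ler_wpM2l ?(ltW yz)//.
rewrite mulr_natl -[X in _ *+ X]card_ord -sumr_const; apply: ler_sum => i _.
rewrite -{1}(subnK (_ : i <= k)%N) -1?ltnS// exprD ler_wpM2r ?exprn_ge0 ?(ltW z0)//.
by rewrite lerXn2r ?nnegrE ?(ltW z0) ?(ltW y0) ?(ltW zy).
Qed.

Lemma real_analytic_is_derive f : real_analytic f ->
  (forall x : R, is_derive x (1 : R) f (derive1 f x)) /\ real_analytic (derive1 f).
Proof.
move=> fan.
have key (a : R) : exists (r : R) c, 0 < r /\ forall x : R, `|x - a| < r ->
    is_derive x (1 : R) f (limn (pseries (pseries_diffs c) (x - a))) /\
    cvgn (pseries (pseries_diffs c) (x - a)).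
  have [r [c [r0 fc]]] := fan a; exists (r / 2), c; split; first by rewrite divr_gt0.
  (* Each termwise differentiation costs some radius, hence 4/5, 3/4 and 2/3: [pseries_snd_diffs]
     asks for convergence of the series differentiated twice. *)
  have c0 : cvgn (pseries c (r * (4 / 5))).
    have := fc (a + r * (4 / 5)); rewrite addrAC subrr add0r => H.
    by apply: cvgP; apply: H; rewrite ger0_norm; nra.
  have c1 : cvgn (pseries (pseries_diffs c) (r * (3 / 4))).
    by apply: cvg_pseries_diffs c0; nra.
  have c2 : cvgn (pseries (pseries_diffs (pseries_diffs c)) (r * (2 / 3))).
    by apply: cvg_pseries_diffs c1; nra.
  have c0' : cvgn (pseries c (r * (2 / 3))).
    by apply: is_cvg_pseries_inside c0 _; rewrite !ger0_norm; nra.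
  have c1' : cvgn (pseries (pseries_diffs c) (r * (2 / 3))).
    by apply: is_cvg_pseries_inside c1 _; rewrite !ger0_norm; nra.
  move=> x xr; have xlt : `|x - a| < `|r * (2 / 3)|.
    by rewrite (lt_le_trans xr)// ger0_norm; nra.
  split; last exact: is_cvg_pseries_inside c1' xlt.
  have D := pseries_snd_diffs c0' c1' c2 xlt.
  have Dsh : is_derive x 1 (fun z => z - a) 1.
    by apply: is_derive_eq; rewrite ?subr0.
  have D2 : is_derive x 1 ((fun y => limn (pseries c y)) \o (fun z => z - a))
      (limn (pseries (pseries_diffs c) (x - a))).
    by apply: is_derive_eq; rewrite ?scale1r ?mulr1.
  apply: (near_eq_is_derive _ D2).
  have rx : 0 < r - `|x - a| by rewrite subr_gt0; apply: lt_trans xr _; nra.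
  have := nbhsx_ballx x _ rx; apply: filterS => z xz.
  apply/cvg_lim => //; apply: fc.
  have -> : z - a = (x - a) - (x - z) by ring.
  rewrite (le_lt_trans (ler_normB _ _))//.
  by move: xz; rewrite -ball_normE /ball_ /= ltrBrDl.
have der (x : R) : is_derive x (1 : R) f (derive1 f x).
  have [r [c [r0 /(_ x)]]] := key x; rewrite subrr normr0 => /(_ r0)[D _].
  have := D; rewrite derive1E => -[D1 D2]; by split.
split => // a; have [r [c [r0 H]]] := key a.
exists r, (pseries_diffs c); split => // x /H[D cv].
have -> : derive1 f x = limn (pseries (pseries_diffs c) (x - a)).
  by rewrite derive1E; apply: derive_val.
exact: cv.
Qed.

Lemma real_analytic_cst (a : R) : real_analytic (fun=> a).
Proof.
move=> b; exists 1, (fun k => if k is 0%N then a else 0); split => // x _.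
apply: cvg_near_cst; exists 1%N => // -[//|k] _.
rewrite /series /= big_nat_recl//= expr0 mulr1 big1 ?addr0// => i _.
by rewrite mul0r.
Qed.

End AnalyticDerivative.

Section StateFunctions.
Context {R : realType} {n : nat}.

(* A class of real functions of the state that is closed under the Lie
   derivatives along the vector fields of the network. *)
Inductive state_fun : ('cV[R]_n -> R) -> Prop :=
| state_ridge (h : R -> R) (v : 'rV[R]_n) (c : R) : real_analytic h ->
    state_fun (fun x => h ((v *m x) 0 0 + c))
| state_add g1 g2 : state_fun g1 -> state_fun g2 -> state_fun (fun x => g1 x + g2 x)
| state_mul g1 g2 : state_fun g1 -> state_fun g2 -> state_fun (fun x => g1 x * g2 x).

Lemma state_ext g g' : state_fun g -> g =1 g' -> state_fun g'.
Proof. by move=> sg /funext <-. Qed.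

Lemma state_cst (c : R) : state_fun (fun=> c).
Proof. exact: (@state_ridge (fun=> c) 0 0 (real_analytic_cst c)). Qed.

Lemma real_analytic_id : real_analytic (@id R).
Proof.
move=> a; exists 1, (fun k => if k is 0%N then a else if k is 1%N then 1 else 0).
split => // x _; apply: cvg_near_cst; exists 2%N => // -[//|[//|k]] _.
rewrite /series /= !big_nat_recl//= expr0 mulr1 expr1 mul1r big1 ?addr0; last first.
  by move=> i _; rewrite mul0r.
by rewrite addrC subrK.
Qed.

Lemma state_coord i : state_fun (fun x => x i 0).
Proof.
apply: (@state_ext (fun x => id ((delta_mx 0 i *m x) 0 0 + 0))).
  exact: (state_ridge _ _ real_analytic_id).
by move=> x; rewrite addr0 -rowE mxE.
Qed.

Lemma state_sum (I : Type) (s : seq I) (g : I -> 'cV[R]_n -> R) :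
  (forall i, state_fun (g i)) -> state_fun (fun x => \sum_(i <- s) g i x).
Proof.
move=> sg; elim: s => [|i s IH].
  by apply: (state_ext (state_cst 0)) => x; rewrite big_nil.
by apply: (state_ext (state_add (sg i) IH)) => x; rewrite big_cons.
Qed.

Lemma cvg_linear_form (T : Type) (F : set_system T) (FF : Filter F) (v : 'rV[R]_n)
    (y : T -> 'cV[R]_n) (z : 'cV[R]_n) : y s @[s --> F] --> z ->
  (v *m y s) 0 0 @[s --> F] --> (v *m z) 0 0.
Proof.
move=> yz; rewrite mxE; under eq_cvg do rewrite mxE.
by apply: cvg_sumr => i; apply: cvgMl_tmp; apply: cvg_mx_entry.
Qed.

Lemma state_cvg g (T : Type) (F : set_system T) (FF : Filter F)
    (y : T -> 'cV[R]_n) (z : 'cV[R]_n) : state_fun g -> y s @[s --> F] --> z ->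
  g (y s) @[s --> F] --> g z.
Proof.
move=> sg yz; elim: sg => [h v c han|g1 g2 _ IH1 _ IH2|g1 g2 _ IH1 _ IH2].
- have [hd _] := real_analytic_is_derive han.
  have hc : {for (v *m z) 0 0 + c, continuous h}.
    apply: differentiable_continuous; apply/derivable1_diffP.
    exact: (@ex_derive _ _ _ _ _ _ _ (hd _)).
  apply: (continuous_cvg _ hc); apply: cvgD; last exact: cvg_cst.
  exact: cvg_linear_form.
- exact: cvgD.
- exact: cvgM.
Qed.

(** For a ridge function the radius is reduced until the affine form deviates from its value at the
    centre by norm at most [rho], the radius of the outer function there. *)
Lemma state_wiener g {l} (E : set 'rV[R]_l) (r0 M0 : R) (Z : 'rV[R]_l -> 'cV[R]_n) :
  state_fun g -> 0 < r0 -> E 0 -> (forall i, wiener E r0 M0 (fun h => Z h i 0)) ->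
  exists r M, 0 < r /\ wiener E r M (fun h => g (Z h)).
Proof.
move=> sg r00 E0 HZ; elim: sg => [f v c fan|g1 g2 _ IH1 _ IH2|g1 g2 _ IH1 _ IH2].
- pose z := (v *m Z 0) 0 0 + c.
  have [rho [M [rho0 Hf]]] := real_analytic_wiener z fan.
  have H1 : wiener E r0 (\sum_(i <- index_enum 'I_n) `|v 0 i| * M0) (fun h => (v *m Z h) 0 0).
    have := wiener_sum (index_enum 'I_n) (ltW r00) (fun i => wiener_scale (v 0 i) (ltW r00) (HZ i)).
    by apply: wiener_ext => h _ _; rewrite [RHS]mxE.
  set M1 := \sum_(i <- _) _ in H1.
  have M10 : 0 <= M1 := wiener_ge0 (ltW r00) H1.
  pose k := Num.min 1 (rho / (M1 + 1)).
  have M11 : 0 < M1 + 1 by rewrite ltr_wpDl.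
  have k0 : 0 < k by rewrite lt_min ltr01 divr_gt0.
  have k01 : 0 <= k <= 1 by rewrite (ltW k0) ge_min lexx.
  have H2 := wiener_shrink (ltW r00) k01 E0 H1.
  have kr : 0 < k * r0 by rewrite mulr_gt0.
  exists (k * r0), M; split => //.
  have H3 : wiener E (k * r0) rho (fun h => (v *m Z h) 0 0 - (v *m Z 0) 0 0).
    apply: (wiener_weak H2) => //; first by rewrite lexx ltW.
    have : k <= rho / (M1 + 1) by rewrite ge_min lexx orbT.
    rewrite ler_pdivlMr// => H; apply: le_trans H.
    by rewrite ler_wpM2l ?(ltW k0)// lerDl.
  have := @wiener_subst _ _ _ _ E rho (k * r0) _ _ (fun _ : 'I_1 => _) (ltW kr) Hf
      (fun=> H3) (fun _ _ _ => I).
  by apply: wiener_ext => h _ _; congr (f _); rewrite [X in _ + X]mxE /z; ring.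
- have [r1 [M1 [r10 H1]]] := IH1; have [r2 [M2 [r20 H2]]] := IH2.
  have r0' : 0 < Num.min r1 r2 by rewrite lt_min r10.
  exists (Num.min r1 r2), (M1 + M2); split => //; apply: wiener_add; first exact: ltW.
    by apply: (wiener_weak H1) => //; rewrite (ltW r0') ge_min lexx.
  by apply: (wiener_weak H2) => //; rewrite (ltW r0') ge_min lexx orbT.
- have [r1 [M1 [r10 H1]]] := IH1; have [r2 [M2 [r20 H2]]] := IH2.
  have r0' : 0 < Num.min r1 r2 by rewrite lt_min r10.
  exists (Num.min r1 r2), (M1 * M2); split => //; apply: wiener_mul; first exact: ltW.
    by apply: (wiener_weak H1) => //; rewrite (ltW r0') ge_min lexx.
  by apply: (wiener_weak H2) => //; rewrite (ltW r0') ge_min lexx orbT.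
Qed.

Definition has_rderive (V : normedModType R) (y : R -> V) (d : V) :=
  s^-1 *: (y s - y 0) @[s --> 0^'+] --> d.

Lemma has_rderive_cvg (y : R -> 'cV[R]_n) (d : 'cV[R]_n) :
  has_rderive y d -> y s @[s --> 0^'+] --> y 0.
Proof.
move=> yd.
have s0 : (s : R) @[s --> 0^'+] --> (0 : R).
  by apply: cvg_within_filter; exact: cvg_id.
have : s *: (s^-1 *: (y s - y 0)) + y 0 @[s --> 0^'+] --> (0 : R) *: d + y 0.
  by apply: cvgD; [exact: cvgZ|exact: cvg_cst].
rewrite scale0r add0r; apply: cvg_trans; apply: near_eq_cvg.
by near=> s; rewrite scalerA divff ?scale1r ?subrK.
Unshelve. all: by end_near. Qed.

Lemma has_rderiveM (f g : R -> R) (a b : R) : f s @[s --> 0^'+] --> f 0 ->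
  has_rderive (V := R) f a -> has_rderive (V := R) g b ->
  has_rderive (V := R) (fun s => f s * g s) (a * g 0 + f 0 * b).
Proof.
move=> fc fa gb; rewrite /has_rderive.
have : s^-1 *: (f s - f 0) * g 0 + f s * (s^-1 *: (g s - g 0)) @[s --> 0^'+]
    --> a * g 0 + f 0 * b.
  by apply: cvgD; [exact: cvgMr_tmp|exact: cvgM].
apply: cvg_trans; apply: near_eq_cvg; near=> s.
by rewrite /GRing.scale /=; ring.
Unshelve. all: by end_near. Qed.

Lemma has_rderiveD (f g : R -> R) (a b : R) :
  has_rderive (V := R) f a -> has_rderive (V := R) g b ->
  has_rderive (V := R) (fun s => f s + g s) (a + b).
Proof.
move=> fa gb; rewrite /has_rderive.
have : s^-1 *: (f s - f 0) + s^-1 *: (g s - g 0) @[s --> 0^'+] --> a + b by exact: cvgD.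
apply: cvg_trans; apply: near_eq_cvg; near=> s.
by rewrite /GRing.scale /=; ring.
Unshelve. all: by end_near. Qed.

(** Chain rule by the Caratheodory slope of [h], which avoids dividing by an increment that may
    vanish. *)
Lemma ridge_rderive (h : R -> R) (v : 'rV[R]_n) (c : R) (y : R -> 'cV[R]_n) d :
  real_analytic h -> has_rderive y d ->
  has_rderive (V := R) (fun s => h ((v *m y s) 0 0 + c))
    (derive1 h ((v *m y 0) 0 0 + c) * (v *m d) 0 0).
Proof.
move=> han yd; have [hd _] := real_analytic_is_derive han.
have /is_derive1_caratheodory[phi [phiE phic <-]] := hd ((v *m y 0) 0 0 + c).
rewrite /has_rderive.
have : phi ((v *m y s) 0 0 + c) * (v *m (s^-1 *: (y s - y 0))) 0 0 @[s --> 0^'+] -->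
    phi ((v *m y 0) 0 0 + c) * (v *m d) 0 0.
  apply: cvgM; last exact: cvg_linear_form.
  apply: (continuous_cvg _ phic); apply: cvgD; last exact: cvg_cst.
  apply: cvg_linear_form; exact: has_rderive_cvg yd.
apply: cvg_trans; apply: near_eq_cvg; near=> s.
have E : (v *m (s^-1 *: (y s - y 0))) 0 0 = s^-1 * ((v *m y s) 0 0 - (v *m y 0) 0 0).
  by rewrite -scalemxAr mulmxBr; move: (v *m y s) (v *m y 0) => P Q; rewrite !mxE.
by rewrite phiE E /GRing.scale /=; ring.
Unshelve. all: by end_near. Qed.

(** [g'] is the Lie derivative of [g] along the field. It is found before the curve [y], so one
    function of the state serves all inputs and times. *)
Lemma state_rderive g (f : R -> R) (A : 'M[R]_n) (b : 'cV[R]_n) : real_analytic f ->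
  state_fun g -> exists2 g', state_fun g' & forall y,
    has_rderive y (act_field f A b (y 0)) -> has_rderive (V := R) (fun s => g (y s)) (g' (y 0)).
Proof.
move=> fan; elim=> [h v c han|g1 g2 s1 [g1' s1' H1] s2 [g2' s2' H2]|g1 g2 s1 [g1' s1' H1] s2 [g2' s2' H2]].
- exists (fun x => derive1 h ((v *m x) 0 0 + c) * (v *m act_field f A b x) 0 0).
    have [_ han'] := real_analytic_is_derive han.
    apply: state_mul; first exact: state_ridge.
    apply: (@state_ext (fun x => \sum_i v 0 i * f ((row i A *m x) 0 0 + b i 0))).
      apply: state_sum => i; apply: state_mul; first exact: state_cst.
      exact: state_ridge.
    move=> x; rewrite mxE; apply: eq_bigr => i _; congr (_ * _).
    by rewrite -row_mul [row _ _ _ _]mxE [RHS]mxE; congr (f _); rewrite [RHS]mxE.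
  by move=> y yd; apply: ridge_rderive.
- exists (fun x => g1' x + g2' x); first exact: state_add.
  by move=> y yd; apply: has_rderiveD; [exact: H1|exact: H2].
- exists (fun x => g1' x * g2 x + g1 x * g2' x).
    by apply: state_add; exact: state_mul.
  move=> y yd; apply: (@has_rderiveM (fun s => g1 (y s)) (fun s => g2 (y s))).
  + by apply: state_cvg => //; apply: has_rderive_cvg yd.
  + exact: H1.
  + exact: H2.
Qed.

End StateFunctions.

(** * Input-output maps that factor through the state *)

Section StateMaps.
Context {R : realType} {m n q : nat} {U : set 'cV[R]_m} (Sigma : rnn n q U).
Variables (X : Upc U -> {nonneg R} -> 'cV[R]_n) (Y : Upc U -> {nonneg R} -> 'cV[R]_q).
Hypothesis sol : forall u, is_solution Sigma (val u) (X u) (Y u).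
Hypothesis act_an : real_analytic (activation Sigma).
Implicit Types (phi psi : Upc U -> {nonneg R} -> R) (u v : Upc U) (t : {nonneg R}).

Definition state_map phi := exists2 g : 'cV[R]_n -> R, state_fun g &
  forall u t, phi u t = g (X u t).

Lemma ext_num {T : Type} (f : {nonneg R} -> T) t : ext f t%:num = f t.
Proof. by rewrite /ext; congr f; apply: val_inj; rewrite /= time_ofE. Qed.

Lemma state_map_add phi psi : state_map phi -> state_map psi -> state_map (phi + psi).
Proof.
move=> [g sg gE] [h sh hE]; exists (fun x => g x + h x); first exact: state_add.
by move=> u t; rewrite -gE -hE.
Qed.

Lemma state_map_mul phi psi : state_map phi -> state_map psi -> state_map (phi * psi).
Proof.
move=> [g sg gE] [h sh hE]; exists (fun x => g x * h x); first exact: state_mul.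
by move=> u t; rewrite -gE -hE.
Qed.

Lemma state_map_cst a : state_map (const_map a).
Proof. by exists (fun=> a); first exact: state_cst. Qed.

(** The strict inequality is what [splice_at] needs: a spliced input may differ from [u] at time [t]
    itself. *)
Lemma sol_causal_num u v t : (forall s, s < t -> val u s = val v s) -> X u t = X v t.
Proof.
move=> uv; rewrite -(ext_num (X u)) -(ext_num (X v)); apply: (sol_causal sol) => // z z0 zt.
by apply: uv; rewrite [_ < _]num_lt /= time_ofE// -[t%:num]/(t%:num); apply: zt.
Qed.

Lemma state_map_analytic phi : state_map phi -> analytic phi.
Proof.
move=> [g sg gE] l alpha a a0.
have E0 : [set h | orthant l.+1 (a + h)] 0 by rewrite /= addr0.
have [r0 [M0 [r00 HZ]]] := wiener_switch sol act_an alpha (leqnn l.+1) a0.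
have [r [M [r_gt0 Hg]]] := state_wiener sg r00 E0 HZ.
have [c cP] := wiener_partial_sum r_gt0 Hg.
exists (r / 2), c; split; first by rewrite divr_gt0.
move=> x x0 xr; have := cP (x - a); rewrite /= addrCA subrr addr0 => /(_ x0).
have -> : ext (phi (switch alpha x)) (switch_time x l.+1) =
    g (ext (X (switch alpha x)) (switch_time x l.+1)) by rewrite /ext gE.
have -> : (fun nu : {ffun 'I_l.+1 -> nat} => c nu * \prod_(i < l.+1) (x - a) 0 i ^+ nu i) =
    (fun nu => c nu * \prod_(i < l.+1) (x 0 i - a 0 i) ^+ nu i).
  by apply/funext => nu; congr (_ * _); apply: eq_bigr => i _; rewrite !mxE.
apply=> i; apply: le_trans (ltW xr).
by have := mx_entry_le (x - a) 0 i.
Qed.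

Lemma state_map_continuous phi u : state_map phi -> continuous (ext (phi u)).
Proof.
move=> [g sg gE] z.
have -> : ext (phi u) = (fun z => g (ext (X u) z)) by apply/funext => w; rewrite /ext gE.
by apply: state_cvg => //; apply: sol_continuous (sol u) z.
Qed.

Lemma state_map_AUpc phi : state_map phi -> AUpc U phi.
Proof.
move=> sphi; have phic u := @state_map_continuous phi u sphi; split; last exact: state_map_analytic.
- move=> u; split.
  + move=> T; rewrite [X in finite_set X](_ : _ = set0) ?finite_set0//.
    by apply/seteqP; split => // z [_ /(_ (phic u z))].
  + by move=> z _; exists (ext (phi u) z); apply: cvg_at_left_filter; apply: phic.
  + by move=> z _; exists (ext (phi u) z); apply: cvg_at_right_filter; apply: phic.
- move=> t u v uv s st; have [g sg gE] := sphi; rewrite !gE; congr g.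
  by apply: sol_causal_num => z zs; apply: uv; rewrite (le_trans (ltW zs)).
Qed.

Lemma splice_at u t alpha : X (splice u t alpha) t = X u t.
Proof. by apply: sol_causal_num => s st; rewrite /= /splice_fun st. Qed.

Lemma splice_rderive u t (alpha : U) :
  let y := fun s => ext (X (splice u t alpha)) (t%:num + s) in
  has_rderive y (rnn_field Sigma (val alpha) (y 0)).
Proof.
move=> y; rewrite /has_rderive.
have sp z : t%:num <= z -> z < t%:num + 1 -> ext (val (splice u t alpha)) z = val alpha.
  move=> tz _; rewrite /ext /= /splice_fun.
  have z0 : 0 <= z by apply: le_trans tz.
  have -> // : (time_of z < t) = false.
  by apply/negbTE; rewrite -leNgt -num_le time_ofE.
have [K K0 HK] := sol_quad_approx (sol (splice u t alpha)) (ge0 t) sp.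
apply/cvgrPdist_le => e e0; near=> s.
have s0 : 0 < s by [].
have se : K * s <= e.
  near: s; have [->|Kn0] := eqVneq K 0; first by apply: nearW => s; rewrite mul0r ltW.
  have Kp : 0 < K by rewrite lt_def Kn0.
  near=> s; rewrite mulrC -ler_pdivlMr//; near: s.
  by apply: nbhs_right_le; rewrite divr_gt0.
have s1 : s <= 1 by near: s; apply: nbhs_right_le.
have := HK t%:num (t%:num + s) (lexx _); rewrite lerDl lerD2l ltW// s1 => /(_ erefl erefl).
have -> : t%:num + s - t%:num = s by rewrite addrAC subrr add0r.
rewrite -[X in X - _ - _]/(y s).
have -> : ext (X (splice u t alpha)) t%:num = y 0 by rewrite /y addr0.
rewrite -/(rnn_field Sigma (val alpha)); set d := rnn_field _ _ _ => H.
have -> : d - s^-1 *: (y s - y 0) = - (s^-1 *: (y s - y 0 - s *: d)).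
  by rewrite [in RHS]scalerBr scalerA mulVf ?gt_eqF// scale1r opprB.
rewrite normrN normrZ gtr0_norm ?invr_gt0// ler_pdivrMl//.
by apply: (le_trans H); rewrite expr2 mulrCA ler_wpM2l// ltW.
Unshelve. all: by end_near. Qed.

Lemma state_map_Dop phi alpha : state_map phi ->
  state_map (Dop alpha phi) /\ forall u t,
    has_rderive (V := R) (fun s => ext (phi (splice u t alpha)) (t%:num + s)) (Dop alpha phi u t).
Proof.
move=> [g sg gE].
have [g' sg' Hg'] := state_rderive (rnnA Sigma) (rnnB Sigma *m val alpha) act_an sg.
have key u t : has_rderive (V := R) (fun s => ext (phi (splice u t alpha)) (t%:num + s)) (g' (X u t)).
  have := Hg' _ (@splice_rderive u t alpha); rewrite addr0 ext_num splice_at.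
  by apply: cvg_trans; apply: near_eq_cvg; near=> s; rewrite /ext !gE.
have E u t : Dop alpha phi u t = g' (X u t).
  rewrite /Dop; apply/cvg_lim => //; have := key u t; rewrite /has_rderive.
  by apply: cvg_trans; apply: near_eq_cvg; near=> s; rewrite /GRing.scale /= mulrC.
split; first by exists g'.
by move=> u t; rewrite E; exact: key.
Unshelve. all: by end_near. Qed.

Lemma splice_ext phi u t (alpha : U) : state_map phi ->
  ext (phi (splice u t alpha)) (t%:num + 0) = phi u t.
Proof. by move=> [g sg gE]; rewrite addr0 ext_num !gE splice_at. Qed.

Lemma splice_cvg phi u t (alpha : U) : state_map phi ->
  ext (phi (splice u t alpha)) (t%:num + s) @[s --> 0^'+] --> phi u t.
Proof.
move=> sphi; rewrite -(splice_ext u t alpha sphi).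
apply: (continuous_cvg _ (@state_map_continuous phi (splice u t alpha) sphi _)).
apply: cvgD; first exact: cvg_cst.
by apply: cvg_within_filter; exact: cvg_id.
Qed.

(** [Dop] is a [lim], meaningful only under convergence. [state_map_Dop] supplies it, so any right
    derivative computed by hand is the value. *)
Lemma DopE phi alpha u t (d : R) : state_map phi ->
  has_rderive (V := R) (fun s => ext (phi (splice u t alpha)) (t%:num + s)) d ->
  Dop alpha phi u t = d.
Proof.
move=> /(state_map_Dop alpha)[_ /(_ u t) H] H'.
exact: (cvg_unique _ H H').
Qed.

Lemma DopM phi psi alpha : state_map phi -> state_map psi ->
  Dop alpha (phi * psi) = Dop alpha phi * psi + phi * Dop alpha psi.
Proof.
move=> sphi spsi; apply/funext => u; apply/funext => t.
apply: DopE; first exact: state_map_mul.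
have [_ /(_ u t) H1] := state_map_Dop alpha sphi.
have [_ /(_ u t) H2] := state_map_Dop alpha spsi.
have := has_rderiveM _ H1 H2; rewrite !splice_ext//; apply; exact: splice_cvg.
Qed.

Lemma DopD phi psi alpha : state_map phi -> state_map psi ->
  Dop alpha (phi + psi) = Dop alpha phi + Dop alpha psi.
Proof.
move=> sphi spsi; apply/funext => u; apply/funext => t.
apply: DopE; first exact: state_map_add.
have [_ /(_ u t) H1] := state_map_Dop alpha sphi.
have [_ /(_ u t) H2] := state_map_Dop alpha spsi.
exact: has_rderiveD H1 H2.
Qed.

Lemma Dop_cst (a : R) alpha : Dop alpha (const_map a : Upc U -> {nonneg R} -> R) = const_map 0.
Proof.
apply/funext => u; apply/funext => t; apply: DopE; first exact: state_map_cst.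
rewrite /has_rderive /const_map /ext; under eq_fun do rewrite subrr scaler0.
exact: cvg_cst.
Qed.

Lemma run_cat W W' : run Sigma (W ++ W') =
  foldl (fun x w => flow (rnn_field Sigma (val w.1)) w.2 x) (run Sigma W) W'.
Proof. by rewrite /run foldl_cat. Qed.

(** Keeps the input values and lets no time pass, so that two words can be written with one common
    sequence of input values. *)
Definition stopped (W : seq (U * R)) := [seq (w.1, 0 : R) | w <- W].

Lemma foldl_stopped W x :
  foldl (fun x w => flow (rnn_field Sigma (val w.1)) w.2 x) x (stopped W) = x.
Proof. by elim: W x => //= w W IH x; rewrite flow0. Qed.

Lemma enum_zip (a0 : U) (A : seq U) (T : seq R) l : size A = l.+1 -> size T = l.+1 ->
  [seq (nth a0 A i, (\row_(j < l.+1) nth 0 T j) 0 i) | i : 'I_l.+1 <- enum 'I_l.+1] = zip A T.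
Proof.
move=> sA sT; apply: (@eq_from_nth _ (a0, 0)).
  by rewrite size_map size_enum_ord size_zip sA sT minnn.
move=> i; rewrite size_map size_enum_ord => il.
rewrite (nth_map ord0) ?size_enum_ord// nth_zip ?sA ?sT// mxE.
by rewrite nth_enum_ord.
Qed.

(** [wiener_shrink] by [k] gives |f h - f 0| <= k M, and [k] is chosen to make this less than |f
    0|. *)
Lemma wiener_near_ne0 {l} (E : set 'rV[R]_l) (r M : R) f : 0 < r -> E 0 -> wiener E r M f ->
  f 0 <> 0 -> exists2 e : R, 0 < e & forall h, E h -> `|h| <= e -> f h <> 0.
Proof.
move=> r0 E0 Hf f0; have M0 := wiener_ge0 (ltW r0) Hf.
have f0' : 0 < `|f 0| by rewrite normr_gt0; apply/eqP.
pose k := Num.min 1 (`|f 0| / (2 * (M + 1))).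
have M1 : 0 < 2 * (M + 1) by rewrite mulr_gt0// ltr_wpDl.
have k0 : 0 < k by rewrite lt_min ltr01 divr_gt0.
have k01 : 0 <= k <= 1 by rewrite (ltW k0) ge_min lexx.
have kM : k * M < `|f 0|.
  have : k <= `|f 0| / (2 * (M + 1)) by rewrite ge_min lexx orbT.
  rewrite ler_pdivlMr//; nra.
exists (k * r); first by rewrite mulr_gt0.
move=> h Eh hk fh; have := wiener_le (wiener_shrink (ltW r0) k01 E0 Hf) Eh.
rewrite fh sub0r normrN => H; move: kM; rewrite ltNge H// => i.
by rewrite (le_trans (mx_entry_le _ _ _)).
Qed.

(** The orthant is convex, so the segment stays in it. The radius is divided by the length of the
    segment, increased by 1 in case the ends coincide. *)
Lemma state_segment_wiener g {l} (alpha : 'I_l.+1 -> U) (t0 t1 : 'rV[R]_l.+1) :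
  state_fun g -> orthant l.+1 t0 -> orthant l.+1 t1 ->
  forall a : R, 0 <= a <= 1 -> exists r M, 0 < r /\
    wiener (l := 1) [set h | 0 <= a + h 0 0 <= 1] r M
      (fun h => let t := t0 + (a + h 0 0) *: (t1 - t0) in
         g (ext (X (switch alpha t)) (switch_time t l.+1))).
Proof.
move=> sg t00 t10.
have conv (s : R) : 0 <= s <= 1 -> orthant l.+1 (t0 + s *: (t1 - t0)).
  move=> /andP[s0 s1] i; rewrite !mxE.
  have -> : t0 0 i + s * (t1 0 i - t0 0 i) = (1 - s) * t0 0 i + s * t1 0 i by ring.
  by rewrite addr_ge0// mulr_ge0 ?subr_ge0.
move=> a a01; have p0 := conv a a01; set p := t0 + a *: (t1 - t0) in p0.
have [r0 [M0 [r00 HZ]]] := wiener_switch sol act_an alpha (leqnn l.+1) p0.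
have E0 : [set h | orthant l.+1 (p + h)] 0 by rewrite /= addr0.
have [r [M [r_gt0 Hg]]] := state_wiener sg r00 E0 HZ.
have D1 : 0 < `|t1 - t0| + 1 by rewrite ltr_wpDl.
pose r' := r / (`|t1 - t0| + 1); have r'0 : 0 < r' by rewrite divr_gt0.
exists r', M; split => //.
pose E' := [set h : 'rV[R]_1 | 0 <= a + h 0 0 <= 1].
have Hw i : wiener E' r' r (fun h => (t1 - t0) 0 i * h 0 0).
  apply: (wiener_weak (wiener_scale ((t1 - t0) 0 i) (ltW r'0) (@wiener_coord _ _ E' r' 0))) => //.
    by rewrite lexx ltW.
  rewrite /r' mulrCA ger_pMr// ler_pdivrMr// mul1r (le_trans (mx_entry_le _ _ _))//.
  by rewrite lerDl.
have pE (h : 'rV[R]_1) : p + (\row_i ((t1 - t0) 0 i * h 0 0)) = t0 + (a + h 0 0) *: (t1 - t0).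
  by apply/rowP => i; rewrite !mxE; ring.
have := wiener_subst (ltW r'0) Hg Hw; rewrite /= => H.
apply: (wiener_ext _ (H _)) => h /= hE hr; first by rewrite pE.
by rewrite pE; apply: conv.
Qed.

(* Two state maps that do not vanish at the ends of the words W1 and W2 are
   restricted to the segment that joins the durations (W1, 0) and (0, W2). *)
Lemma state_map_domain (a0 : U) phi psi : state_map phi -> state_map psi ->
  phi * psi = 0 -> phi = 0 \/ psi = 0.
Proof.
move=> sphi spsi pp0; have [g sg gE] := sphi; have [h sh hE] := spsi.
have [->|] := pselect (phi = 0); [by left|move=> phi0; right].
apply: contrapT => psi0.
have nz (chi : Upc U -> {nonneg R} -> R) : chi <> 0 -> exists u t, chi u t <> 0.
  move=> chi0; apply: contrapT => H; apply: chi0; apply/funext => u; apply/funext => t.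
  by apply: contrapT => H'; apply: H; exists u, t.
have [u1 [t1 n1]] := @nz _ phi0; have [u2 [t2 n2]] := @nz _ psi0.
have [W1 [W10 E1 _]] := reach sol (ge0 t1) (fun _ _ _ => erefl (ext (val u1) _)).
have [W2 [W20 E2 _]] := reach sol (ge0 t2) (fun _ _ _ => erefl (ext (val u2) _)).
rewrite ext_num in E1; rewrite ext_num in E2.
rewrite gE E1 in n1; rewrite hE E2 in n2.
(* The final letter of duration 0 makes the word nonempty, since [switch] has at least one piece. *)
pose W := W1 ++ rcons W2 (a0, 0); pose l := size (W1 ++ W2).
pose A := unzip1 W.
pose V0 := W1 ++ stopped (rcons W2 (a0, 0)).
pose V1 := stopped W1 ++ rcons W2 (a0, 0).
have sW : size W = l.+1 by rewrite /W -rcons_cat size_rcons.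
have sV0 : size (unzip2 V0) = l.+1 by rewrite /V0 size_map size_cat size_map -size_cat.
have sV1 : size (unzip2 V1) = l.+1 by rewrite /V1 size_map size_cat size_map -size_cat.
have sA : size A = l.+1 by rewrite size_map.
have un1 V : unzip1 (stopped V) = unzip1 V by rewrite /unzip1 -map_comp.
have A0 : A = unzip1 V0 by rewrite /A /V0 /unzip1 !map_cat [map _ (stopped _)]un1.
have A1 : A = unzip1 V1 by rewrite /A /V1 /unzip1 !map_cat [map _ (stopped _)]un1.
pose alpha (i : 'I_l.+1) := nth a0 A i.
pose t0 : 'rV[R]_l.+1 := \row_(j < l.+1) nth 0 (unzip2 V0) j.
pose t1' : 'rV[R]_l.+1 := \row_(j < l.+1) nth 0 (unzip2 V1) j.
have nn V (i : nat) : all (fun w : U * R => 0 <= w.2) V -> 0 <= nth 0 (unzip2 V) i.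
  move=> V0'; have [iV|iV] := ltnP i (size V); last by rewrite nth_default// size_map.
  by rewrite (nth_map (a0, 0))// (all_nthP _ V0').
have st V : all (fun w : U * R => 0 <= w.2) (stopped V) by elim: V => //= w V ->; rewrite lexx.
have t00 : orthant l.+1 t0.
  by move=> i; rewrite mxE nn// /V0 all_cat W10 st.
have t10 : orthant l.+1 t1'.
  by move=> i; rewrite mxE nn// /V1 all_cat st all_rcons lexx.
pose F g' (s : R) := let t := t0 + s *: (t1' - t0) in
  g' (ext (X (switch alpha t)) (switch_time t l.+1)) : R.
have F0 g' : F g' 0 = g' (run Sigma W1).
  rewrite /F /= scale0r addr0 (sol_switch sol alpha t00) enum_zip// A0 zip_unzip.
  by rewrite /V0 run_cat foldl_stopped.
have F1 g' : F g' 1 = g' (run Sigma W2).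
  rewrite /F /= scale1r addrC subrK (sol_switch sol alpha t10) enum_zip// A1 zip_unzip.
  rewrite /V1 run_cat (_ : run Sigma (stopped W1) = init Sigma); last exact: foldl_stopped.
  by rewrite foldl_rcons /= flow0.
have FG (s : R) : F g s * F h s = 0.
  rewrite /F /= /ext -gE -hE.
  by have := congr1 (fun f => f (switch alpha (t0 + s *: (t1' - t0)))
     (time_of (switch_time (t0 + s *: (t1' - t0)) l.+1))) pp0.
have [r [M [r0 Hg]]] := state_segment_wiener alpha sg t00 t10 (a := 0) (introT andP (conj (lexx _) ler01)).
have E0 : [set h : 'rV[R]_1 | 0 <= 0 + h 0 0 <= 1] 0 by rewrite /= mxE addr0 lexx ler01.
have [|e e0 He] := wiener_near_ne0 r0 E0 Hg.
  by rewrite /= mxE addr0; have := F0 g; rewrite /F /= => ->.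
(* On [0, min 1 e] the first factor has no zero, so the second one vanishes there, and the identity
   theorem carries this to the other end of the segment. *)
apply: n2; rewrite -(F1 h).
have c01 : 0 < Num.min 1 e <= 1 by rewrite lt_min ltr01 e0 ge_min lexx.
apply: (@segment_ident _ (F h) (Num.min 1 e) c01); last by rewrite ler01 lexx.
  by move=> a a01; exact: state_segment_wiener.
move=> s /andP[s0]; rewrite le_min => /andP[s1 se].
have := FG s => /eqP; rewrite mulf_eq0 => /orP[/eqP Fs|/eqP//].
exfalso; apply: (He (const_mx s)).
- by rewrite /= mxE add0r s0.
- by rewrite mx_norm_ub ?(ltW e0)// => i j; rewrite mxE ger0_norm.
- by rewrite mxE add0r; exact: Fs.
Qed.

End StateMaps.

(** * Rational functions of the generators *)

Section AnalyticZeros.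
Context {R : realType} {N : nat} (xi : 'I_N -> R -> R).
Hypothesis xi_an : forall i, real_analytic (xi i).

Lemma meval_analytic_wiener (P : mpoly N R) (a : R) : exists r M, 0 < r /\
  wiener (l := 1) setT r M (fun h => meval (fun i => xi i (a + h 0 0)) P).
Proof.
have [r [M [r0 H]]] := wiener_family (fun i => real_analytic_wiener a (xi_an i)).
by exists r, (pnorm M P); split => //; apply: wiener_meval => //; exact: ltW.
Qed.

(** The identity theorem on the segment from [z] to [s], an initial part of which lies within
    distance [d] of [z]. *)
Lemma meval_analytic_zero (P : mpoly N R) (z d : R) : 0 < d ->
  (forall s, `|s - z| <= d -> meval (fun i => xi i s) P = 0) ->
  forall s, meval (fun i => xi i s) P = 0.
Proof.
move=> d0 Hz s; pose F x := meval (fun i => xi i (z + x * (s - z))) P.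
have D1 : 0 < `|s - z| + 1 by rewrite ltr_wpDl.
have c0 : 0 < Num.min 1 (d / (`|s - z| + 1)) by rewrite lt_min ltr01 divr_gt0.
have c01 : 0 < Num.min 1 (d / (`|s - z| + 1)) <= 1 by rewrite c0 ge_min lexx.
have := segment_ident (F := F) c01.
have -> : meval (fun i => xi i s) P = F 1 by rewrite /F mul1r addrC subrK.
apply; last by rewrite ler01 lexx.
  move=> a a01; have [r [M [r0 H]]] := meval_analytic_wiener P (z + a * (s - z)).
  pose r' := r / (`|s - z| + 1); have r'0 : 0 < r' by rewrite divr_gt0.
  exists r', M; split => //.
  pose E' := [set h : 'rV[R]_1 | 0 <= a + h 0 0 <= 1].
  have Hw : wiener E' r' r (fun h => (s - z) * h 0 0).
    apply: (wiener_weak (wiener_scale (s - z) (ltW r'0) (@wiener_coord _ _ E' r' 0))) => //.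
      by rewrite lexx ltW.
    by rewrite /r' mulrCA ger_pMr// ler_pdivrMr// mul1r lerDl.
  have := @wiener_subst _ _ _ _ E' r r' _ _ (fun _ : 'I_1 => _) (ltW r'0) H (fun=> Hw) (fun _ _ _ => I).
  apply: wiener_ext => h _ _; apply: meval_eq => i; congr (xi i _).
  by rewrite mxE; ring.
move=> x /andP[x0]; rewrite le_min => /andP[_ xd]; apply: Hz.
rewrite addrC addKr normrM ger0_norm//.
move: xd; rewrite ler_pdivlMr// => xd; apply: le_trans xd.
by rewrite ler_wpM2l// lerDl.
Qed.

End AnalyticZeros.

Section PolyMaps.
Context {R : realType} {T1 T2 : Type}.
Implicit Types (phi : T1 -> T2 -> R).

Definition poly_map {D} (z : 'I_D -> T1 -> T2 -> R) (P : mpoly D R) : T1 -> T2 -> R :=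
  fun u t => meval (fun i => z i u t) P.

(** An induction principle for polynomial expressions in the [z i]. *)
Lemma poly_map_closed (B : (T1 -> T2 -> R) -> Prop) {D} (z : 'I_D -> T1 -> T2 -> R) :
  (forall a, B (fun _ _ => a)) -> (forall f g, B f -> B g -> B (f + g)) ->
  (forall f g, B f -> B g -> B (f * g)) -> (forall i, B (z i)) ->
  forall P, B (poly_map z P).
Proof.
move=> B1 BD BM Bz P.
have Bsum (I : Type) (s : seq I) (F : I -> T1 -> T2 -> R) : (forall i, B (F i)) ->
    B (fun u t => \sum_(i <- s) F i u t).
  move=> BF; elim: s => [|i s IH].
    have -> : (fun u t => \sum_(i <- [::]) F i u t) = (fun _ _ => 0); last exact: B1.
    by apply/funext => u; apply/funext => t; rewrite big_nil.
  have -> : (fun u t => \sum_(j <- i :: s) F j u t) = F i + (fun u t => \sum_(j <- s) F j u t).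
    by apply/funext => u; apply/funext => t; rewrite big_cons.
  exact: BD.
have Bprod (I : Type) (s : seq I) (F : I -> T1 -> T2 -> R) : (forall i, B (F i)) ->
    B (fun u t => \prod_(i <- s) F i u t).
  move=> BF; elim: s => [|i s IH].
    have -> : (fun u t => \prod_(i <- [::]) F i u t) = (fun _ _ => 1); last exact: B1.
    by apply/funext => u; apply/funext => t; rewrite big_nil.
  have -> : (fun u t => \prod_(j <- i :: s) F j u t) = F i * (fun u t => \prod_(j <- s) F j u t).
    by apply/funext => u; apply/funext => t; rewrite big_cons.
  exact: BM.
have Bexp (f : T1 -> T2 -> R) k : B f -> B (fun u t => f u t ^+ k).
  move=> Bf; elim: k => [|k IH].
    have -> : (fun u t => f u t ^+ 0) = (fun _ _ => 1); last exact: B1.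
    by apply/funext => u; apply/funext => t.
  have -> : (fun u t => f u t ^+ k.+1) = f * (fun u t => f u t ^+ k).
    by apply/funext => u; apply/funext => t; rewrite exprS.
  exact: BM.
have -> : poly_map z P = (fun u t => \sum_(m <- msupp P) ((fun _ _ => mcoeff m P) *
    (fun u t => \prod_(i <- index_enum 'I_D) z i u t ^+ m i)) u t).
  by apply/funext => u; apply/funext => t; rewrite /poly_map mevalE.
by apply: Bsum => m; apply: BM => //; apply: Bprod => i; exact: Bexp.
Qed.

Lemma poly_mapD {D} (z : 'I_D -> T1 -> T2 -> R) P Q : poly_map z (P + Q) = poly_map z P + poly_map z Q.
Proof. by apply/funext => u; apply/funext => t; rewrite /poly_map mevalD. Qed.

Lemma poly_mapM {D} (z : 'I_D -> T1 -> T2 -> R) P Q : poly_map z (P * Q) = poly_map z P * poly_map z Q.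
Proof. by apply/funext => u; apply/funext => t; rewrite /poly_map mevalM. Qed.

Lemma poly_mapC {D} (z : 'I_D -> T1 -> T2 -> R) c : poly_map z (mpolyC D c) = (fun _ _ => c).
Proof. by apply/funext => u; apply/funext => t; rewrite /poly_map mevalC. Qed.

Lemma poly_mapX {D} (z : 'I_D -> T1 -> T2 -> R) i : poly_map z (mpolyX R (mnm1 i)) = z i.
Proof. by apply/funext => u; apply/funext => t; rewrite /poly_map mevalXU. Qed.

Lemma poly_map_rename {D D'} (z : 'I_D -> T1 -> T2 -> R) (rho : 'I_D' -> 'I_D) (P : mpoly D' R) :
  exists Q, poly_map (fun j => z (rho j)) P = poly_map z Q.
Proof.
apply: (@poly_map_closed (fun f => exists Q, f = poly_map z Q)).
- by move=> a; exists (mpolyC D a); rewrite poly_mapC.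
- by move=> _ _ [Q ->] [Q' ->]; exists (Q + Q'); rewrite poly_mapD.
- by move=> _ _ [Q ->] [Q' ->]; exists (Q * Q'); rewrite poly_mapM.
- by move=> j; exists (mpolyX R (mnm1 (rho j))); rewrite poly_mapX.
Qed.

End PolyMaps.

Section RationalMaps.
Context {R : realType} {m n q : nat} {U : set 'cV[R]_m} (Sigma : rnn n q U).
Variables (X : Upc U -> {nonneg R} -> 'cV[R]_n) (Y : Upc U -> {nonneg R} -> 'cV[R]_q).
Hypothesis sol : forall u, is_solution Sigma (val u) (X u) (Y u).
Hypothesis act_an : real_analytic (activation Sigma).
Variable (u0 : U).
Implicit Types (phi psi : Upc U -> {nonneg R} -> R).

Let domain phi psi : state_map X phi -> state_map X psi -> phi * psi = 0 ->
  phi = 0 \/ psi = 0.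
Proof. exact: (state_map_domain sol act_an u0). Qed.

Section Generators.
Context {D : nat} (z : 'I_D -> Upc U -> {nonneg R} -> R).
Hypothesis sz : forall i, state_map X (z i).

(** The functions of the state that lie in the field generated by the [z i]. The equation replaces a
    division, since a nonzero map may still vanish at some inputs and times. *)
Definition rational_map phi := state_map X phi /\
  exists P Q, poly_map z Q <> 0 /\ phi * poly_map z Q = poly_map z P.

Lemma poly_map_state_map P : state_map X (poly_map z P).
Proof.
apply: (@poly_map_closed _ _ _ (state_map X)) => //.
- exact: state_map_cst.
- exact: state_map_add.
- exact: state_map_mul.
Qed.

Lemma poly_map_neq0M P Q : poly_map z P <> 0 -> poly_map z Q <> 0 -> poly_map z (P * Q) <> 0.
Proof.
move=> P0 Q0; rewrite poly_mapM => /domain[]; [exact: poly_map_state_map|exact: poly_map_state_map| |].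
all: by [].
Qed.

Lemma cst_neq0 (a : R) : a <> 0 -> (fun (_ : Upc U) (_ : {nonneg R}) => a) <> 0.
Proof.
move=> a0; apply: contra_not a0.
by move=> /(congr1 (fun f => f (switch (fun _ : 'I_1 => u0) 0) (time_of 0))).
Qed.

Lemma rational_poly_map P : rational_map (poly_map z P).
Proof.
split; first exact: poly_map_state_map.
exists P, (mpolyC D 1); rewrite poly_mapC; split.
  by apply: cst_neq0; apply/eqP; rewrite oner_eq0.
by apply/funext => u; apply/funext => t; rewrite -[LHS]/(poly_map z P u t * 1) mulr1.
Qed.

Lemma rational_cst a : rational_map (fun _ _ => a).
Proof. by have := rational_poly_map (mpolyC D a); rewrite poly_mapC. Qed.

Lemma rational_generators i : rational_map (z i).
Proof. by have := rational_poly_map (mpolyX R (mnm1 i)); rewrite poly_mapX. Qed.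

Lemma rational_add phi psi : rational_map phi -> rational_map psi -> rational_map (phi + psi).
Proof.
move=> [s1 [P1 [Q1 [Q10 E1]]]] [s2 [P2 [Q2 [Q20 E2]]]]; split; first exact: state_map_add.
exists (P1 * Q2 + P2 * Q1), (Q1 * Q2); split; first exact: poly_map_neq0M.
by rewrite poly_mapD !poly_mapM mulrDl mulrA E1 [poly_map z Q1 * _]mulrC mulrA E2.
Qed.

Lemma rational_mul phi psi : rational_map phi -> rational_map psi -> rational_map (phi * psi).
Proof.
move=> [s1 [P1 [Q1 [Q10 E1]]]] [s2 [P2 [Q2 [Q20 E2]]]]; split; first exact: state_map_mul.
exists (P1 * P2), (Q1 * Q2); split; first exact: poly_map_neq0M.
by rewrite !poly_mapM mulrACA E1 E2.
Qed.

Lemma rational_divr phi Q : state_map X phi -> poly_map z Q <> 0 ->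
  rational_map (phi * poly_map z Q) -> rational_map phi.
Proof.
move=> s1 Q0 [_ [P' [Q' [Q'0 E]]]]; split => //.
by exists P', (Q * Q'); split; [exact: poly_map_neq0M|rewrite poly_mapM mulrA E].
Qed.

Hypothesis Dz : forall alpha i, rational_map (Dop alpha (z i)).

Lemma rational_Dop_poly_map alpha P : rational_map (Dop alpha (poly_map z P)).
Proof.
suff [] : rational_map (poly_map z P) /\ rational_map (Dop alpha (poly_map z P)) by [].
apply: (@poly_map_closed _ _ _ (fun f => rational_map f /\ rational_map (Dop alpha f))).
- move=> a; split; first exact: rational_cst.
  by rewrite (Dop_cst sol act_an a alpha); exact: rational_cst.
- move=> f g [f1 f2] [g1 g2]; split; first exact: rational_add.
  by rewrite (DopD sol act_an)//; [exact: rational_add|case: f1|case: g1].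
- move=> f g [f1 f2] [g1 g2]; split; first exact: rational_mul.
  rewrite (DopM sol act_an)//; [|by case: f1|by case: g1].
  by apply: rational_add; exact: rational_mul.
- by move=> i; split; [exact: rational_generators|exact: Dz].
Qed.

(** Quotient rule without division: phi Q = P gives D(phi) Q = D(P) - phi D(Q), whose right-hand
    side is rational. *)
Lemma rational_Dop alpha phi : rational_map phi -> rational_map (Dop alpha phi).
Proof.
move=> [s1 [P [Q [Q0 E]]]].
have sD : state_map X (Dop alpha phi) by have [] := state_map_Dop sol act_an alpha s1.
apply: (rational_divr sD Q0).
have -> : Dop alpha phi * poly_map z Q =
    Dop alpha (poly_map z P) + (fun _ _ => -1) * (phi * Dop alpha (poly_map z Q)).
  rewrite -E (DopM sol act_an)//; last exact: poly_map_state_map.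
  apply/funext => u; apply/funext => t.
  rewrite -[LHS]/(Dop alpha phi u t * poly_map z Q u t).
  rewrite -[RHS]/(Dop alpha phi u t * poly_map z Q u t + phi u t * Dop alpha (poly_map z Q) u t +
     -1 * (phi u t * Dop alpha (poly_map z Q) u t)).
  by ring.
apply: rational_add; first exact: rational_Dop_poly_map.
apply: rational_mul; first exact: rational_cst.
apply: rational_mul; last exact: rational_Dop_poly_map.
by split => //; exists P, Q.
Qed.

End Generators.

(* If the denominator V(xi(l)) vanishes identically along the trajectories, then
   by analyticity the affine form l of the state is constant there. *)
Lemma affine_cst {N} (xi : 'I_N -> R -> R) (V : mpoly N R) (v : 'rV[R]_n) (c : R) :
  (forall i, real_analytic (xi i)) -> (exists s, meval (fun i => xi i s) V <> 0) ->
  (forall u t, meval (fun i => xi i ((v *m X u t) 0 0 + c)) V = 0) ->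
  forall u t, (v *m X u t) 0 0 + c = (v *m init Sigma) 0 0 + c.
Proof.
move=> xan [s0 Vs0] V0 u t; apply: contrapT => H; apply: Vs0.
pose f (s : R) := (v *m ext (X u) s) 0 0 + c.
have fc : continuous f.
  move=> s; apply: cvgD; last exact: cvg_cst.
  by apply: cvg_linear_form; exact: (sol_continuous (sol u)).
have f0 : f 0 = (v *m init Sigma) 0 0 + c.
  by have [_ [_ E] _ _] := sol u; rewrite /f [ext _ _]E.
have ft : f t%:num = (v *m X u t) 0 0 + c by rewrite /f ext_num.
rewrite -f0 -ft in H.
have d0 : 0 < `|f t%:num - f 0| / 2.
  by rewrite divr_gt0// normr_gt0 subr_eq0; apply/eqP.
(* By the intermediate value theorem [f] takes every value between its values at 0 and [t]; they
   fill the interval with this centre and half-length. *)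
apply: (meval_analytic_zero xan (z := (f t%:num + f 0) / 2) d0) => s sd.
have [|w _ <-] := @IVT R f 0 t%:num s (ge0 t) (continuous_subspaceT fc); last first.
  by have := V0 u (time_of w).
rewrite ge_min le_max; move: sd; rewrite ler_norml => /andP[].
have [ab|ab] := leP (f 0) (f t%:num).
  rewrite ger0_norm ?subr_ge0// => s1 s2.
  by apply/andP; split; apply/orP; [left|right]; lra.
rewrite ltr0_norm ?subr_lt0// => s1 s2.
by apply/andP; split; apply/orP; [right|left]; lra.
Qed.

End RationalMaps.

Section Generators.
Context {R : realType} {m n q : nat} {U : set 'cV[R]_m} (Sigma : rnn n q U).
Variables (X : Upc U -> {nonneg R} -> 'cV[R]_n) (Y : Upc U -> {nonneg R} -> 'cV[R]_q).
Hypothesis sol : forall u, is_solution Sigma (val u) (X u) (Y u).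
Hypothesis act_an : real_analytic (activation Sigma).
Variable (u0 : U).
Variable (inputs : seq 'cV[R]_m).
Hypothesis inputsE : U = [set` inputs].
Context {N : nat} (xi : 'I_N -> R -> R) (Up Vp : 'I_N.+1 -> mpoly N R).
Let ev (P : mpoly N R) (s : R) : R := meval (fun i => xi i s) P.
Hypothesis xi_an : forall i, real_analytic (xi i).
Hypothesis Vp_neq0 : forall k, exists s, ev (Vp k) s <> 0.
Hypothesis act_rational : forall s, activation Sigma s * ev (Vp ord0) s = ev (Up ord0) s.
Hypothesis xi_rational : forall i s,
  derive1 (xi i) s * ev (Vp (lift ord0 i)) s = ev (Up (lift ord0 i)) s.

Definition preactivation (i : 'I_n) (a : 'I_(size inputs)) (u : Upc U) (t : {nonneg R}) : R :=
  (row i (rnnA Sigma) *m X u t) 0 0 + (rnnB Sigma *m nth 0 inputs a) i 0.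

(** Finiteness of the input set enters here: every input value brings its own preactivations. *)
Definition generator_index : finType := ('I_n + 'I_n * 'I_(size inputs) * 'I_N)%type.

Definition generator (g : generator_index) : Upc U -> {nonneg R} -> R := fun u t =>
  match g with
  | inl i => X u t i 0
  | inr (i, a, j) => xi j (preactivation i a u t)
  end.

Definition generators (k : 'I_#|{: generator_index}|) := generator (enum_val k).

Lemma generators_state k : state_map X (generators k).
Proof.
rewrite /generators; case: (enum_val k) => [i|[[i a] j]].
  by exists (fun x => x i 0); first exact: state_coord.
exists (fun x => xi j ((row i (rnnA Sigma) *m x) 0 0 + (rnnB Sigma *m nth 0 inputs a) i 0)) => //.
exact: state_ridge.
Qed.

Lemma rational_generator g : rational_map X generators (generator g).
Proof.
have -> : generator g = generators (enum_rank g) by rewrite /generators enum_rankK.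
exact: (rational_generators u0 generators_state (enum_rank g)).
Qed.

(** Serves the activation and the derivatives of the [xi j] alike. If the denominator vanishes along
    all trajectories, [affine_cst] makes the preactivation, and with it the map, constant. *)
Lemma rational_ridge (h : R -> R) (k : 'I_N.+1) i a : real_analytic h ->
  (forall s, h s * ev (Vp k) s = ev (Up k) s) ->
  rational_map X generators (fun u t => h (preactivation i a u t)).
Proof.
move=> han hE.
have sh : state_map X (fun u t => h (preactivation i a u t)).
  exists (fun x => h ((row i (rnnA Sigma) *m x) 0 0 + (rnnB Sigma *m nth 0 inputs a) i 0)) => //.
  exact: state_ridge.
pose rho j := enum_rank (inr (i, a, j) : generator_index).
have polE P : poly_map (fun j => generators (rho j)) P = (fun u t => ev P (preactivation i a u t)).
  apply/funext => u; apply/funext => t; rewrite /poly_map /ev; apply: meval_eq => j.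
  by rewrite /generators /rho enum_rankK.
have [Q' Q'E] := poly_map_rename generators rho (Vp k).
have [P' P'E] := poly_map_rename generators rho (Up k).
rewrite polE in Q'E; rewrite polE in P'E.
have [Q0|Q0] := pselect (poly_map generators Q' = 0); last first.
  split => //; exists P', Q'; split => //.
  rewrite -Q'E -P'E; apply/funext => u; apply/funext => t; exact: hE.
have cst := affine_cst sol (v := row i (rnnA Sigma)) (c := (rnnB Sigma *m nth 0 inputs a) i 0)
  xi_an (Vp_neq0 k).
have -> : (fun u t => h (preactivation i a u t)) =
    (fun _ _ => h ((row i (rnnA Sigma) *m init Sigma) 0 0 + (rnnB Sigma *m nth 0 inputs a) i 0)).
  apply/funext => u; apply/funext => t; rewrite /preactivation cst// => u' t'.
  by have := congr1 (fun f => f u' t') Q0; rewrite -Q'E.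
exact: (rational_cst u0 generators_state).
Qed.

Lemma input_nth (alpha : U) : exists a : 'I_(size inputs), nth 0 inputs a = val alpha.
Proof.
have ain : val alpha \in inputs.
  have /set_mem aU := valP alpha.
  by have : [set` inputs] (val alpha) by rewrite -inputsE.
have il : (index (val alpha) inputs < size inputs)%N by rewrite index_mem.
by exists (Ordinal il); rewrite /= nth_index.
Qed.

Lemma rational_rnn_field i (alpha : U) :
  rational_map X generators (fun u t => rnn_field Sigma (val alpha) (X u t) i 0).
Proof.
have [a aE] := input_nth alpha.
have := rational_ridge i a act_an act_rational; congr (rational_map _ _ _).
apply/funext => u; apply/funext => t; rewrite /rnn_field /act_field [RHS]mxE; congr (activation _ _).
by rewrite /preactivation -row_mul [row _ _ _ _]mxE [RHS]mxE aE.
Qed.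

Lemma rational_Dop_generators alpha k : rational_map X generators (Dop alpha (generators k)).
Proof.
have sk := generators_state k.
rewrite /generators in sk *; case: (enum_val k) sk => [i|[[i a] j]] sk.
  have := rational_rnn_field i alpha; congr (rational_map _ _ _).
  apply/funext => u; apply/funext => t; apply/esym; apply: (DopE sol act_an) => //.
  have /= := splice_rderive sol (u := u) (t := t) (alpha := alpha).
  rewrite addr0 ext_num (splice_at sol) => H.
  have := cvg_mx_entry (i := i) (j := 0) H; rewrite /has_rderive /generator; apply: cvg_trans.
  by apply: near_eq_cvg; near=> s; rewrite !mxE.
(* Velocity of the preactivation [(i, a)] under the input [alpha]. The input value numbered [a] is a
   mere label of the generator and contributes a constant. *)
pose D := fun u t => \sum_(l < n) rnnA Sigma i l * rnn_field Sigma (val alpha) (X u t) l 0.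
have -> : Dop alpha (generator (inr (i, a, j))) =
    (fun u t => derive1 (xi j) (preactivation i a u t)) * D.
  apply/funext => u; apply/funext => t; apply: (DopE sol act_an) => //.
  have /= := splice_rderive sol (u := u) (t := t) (alpha := alpha).
  move=> /(ridge_rderive (v := row i (rnnA Sigma)) (c := (rnnB Sigma *m nth 0 inputs a) i 0) (xi_an j)).
  rewrite addr0 ext_num (splice_at sol).
  have -> : (row i (rnnA Sigma) *m rnn_field Sigma (val alpha) (X u t)) 0 0 = D u t.
    by rewrite mxE; apply: eq_bigr => l _; rewrite mxE.
  exact.
apply: (rational_mul sol act_an u0 generators_state).
  have [_ dxi] := real_analytic_is_derive (xi_an j).
  exact: (rational_ridge _ _ dxi (xi_rational j)).
rewrite /D; elim: (index_enum 'I_n) => [|l s IH].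
  have := rational_cst u0 generators_state 0; congr (rational_map _ _ _).
  by apply/funext => u; apply/funext => t; rewrite big_nil.
have H1 := rational_mul sol act_an u0 generators_state
  (rational_cst u0 generators_state (rnnA Sigma i l)) (rational_rnn_field l alpha).
have := rational_add sol act_an u0 generators_state H1 IH; congr (rational_map _ _ _).
by apply/funext => u; apply/funext => t; rewrite big_cons.
Unshelve. all: by end_near. Qed.

Lemma rational_output k : rational_map X generators (fun u t => Y u t k 0).
Proof.
have -> : (fun u t => Y u t k 0) = (fun u t => \sum_(l < n) rnnC Sigma k l * X u t l 0).
  by apply/funext => u; apply/funext => t; have [_ _ _ ->] := sol u; rewrite mxE.
elim: (index_enum 'I_n) => [|l s IH].
  have := rational_cst u0 generators_state 0; congr (rational_map _ _ _).
  by apply/funext => u; apply/funext => t; rewrite big_nil.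
have H1 := rational_mul sol act_an u0 generators_state
  (rational_cst u0 generators_state (rnnC Sigma k l)) (rational_generator (inl l)).
have := rational_add sol act_an u0 generators_state H1 IH; congr (rational_map _ _ _).
by apply/funext => u; apply/funext => t; rewrite big_cons.
Qed.

End Generators.

(** * Transcendence degree *)

Section Fractions.
Variable S : idomainType.

Lemma fraction_quotient (y : {fraction S}) : exists a b : S, b != 0 /\
  y = FracField.tofrac a / FracField.tofrac b.
Proof.
elim/quotW: y => x; exists (val x).1, (val x).2; split; first exact: denom_ratioP.
have d0 : FracField.tofrac (val x).2 != 0 :> {fraction S}.
  by rewrite tofrac_eq0 denom_ratioP.
apply: (mulIf d0); rewrite divfK//; unlock FracField.tofrac.
rewrite -[LHS]FracField.pi_mul; apply/eqmodP.
rewrite /= FracField.equivfE /FracField.mulf !numden_Ratio ?oner_neq0 ?mulr1 ?denom_ratioP//.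
by rewrite mulrC.
Qed.

End Fractions.

(** * Algebraic dependence by counting; [regular] polynomials are the admissible denominators *)

Section Dependence.
Variables (F : fieldType) (S : idomainType) (T : comPzRingType) (D : nat).
Variables (iota : {rmorphism F -> S}) (j : {rmorphism S -> T}) (pi : {rmorphism mpoly D F -> T}).
Hypothesis pi_cst : forall c, pi (mpolyC D c) = j (iota c).
Variable regular : mpoly D F -> Prop.
Hypothesis regular1 : regular 1.
Hypothesis regularM : forall P Q, regular P -> regular Q -> regular (P * Q).
Hypothesis regular_inj : forall (a : S) Q, regular Q -> j a * pi Q = 0 -> a = 0.
Hypothesis rational : forall a : S, exists P Q, regular Q /\ j a * pi Q = pi P.

Definition box_mnm {b} (g : {ffun 'I_D -> 'I_b}) : multinom D := Multinom [tuple (g i : nat) | i < D].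

Lemma linear_dependence (I : finType) (M : I -> mpoly D F) b :
  (forall i, (msize (M i) <= b)%N) -> (b ^ D < #|I|)%N ->
  exists2 c : I -> F, (exists i, c i != 0) & \sum_i c i *: M i = 0.
Proof.
move=> Mb bI.
pose A : 'M[F]_(#|I|, #|{ffun 'I_D -> 'I_b}|) :=
  \matrix_(r, s) mcoeff (box_mnm (enum_val s)) (M (enum_val r)).
have kA : kermx A != 0.
  rewrite kermx_eq0 /row_free neq_ltn; apply/orP; left.
  by rewrite (leq_ltn_trans (rank_leq_col A))// card_ffun !card_ord.
pose v := nz_row (kermx A).
have vA : v *m A = 0 by apply/sub_kermxP; exact: nz_row_sub.
exists (fun i => v 0 (enum_rank i)).
  apply: contrapT => H; have /eqP : v != 0 by rewrite nz_row_eq0.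
  apply; apply/rowP => r; rewrite mxE; apply: contrapT => /eqP vr.
  by apply: H; exists (enum_val r); rewrite enum_valK.
apply/mpolyP => m; rewrite raddf_sum mcoeff0 /=.
have [mb|mb] := ltnP (mdeg m) b; last first.
  rewrite big1// => i _; rewrite mcoeffZ memN_msupp_eq0 ?mulr0//.
  by apply: msize_mdeg_ge; apply: leq_trans mb; exact: Mb.
have lt_m i : (m i < b)%N.
  by apply: leq_ltn_trans mb; rewrite mdegE (bigD1 i)//= leq_addr.
pose g : {ffun 'I_D -> 'I_b} := [ffun i => Ordinal (lt_m i)].
have gm : box_mnm g = m by apply/mnmP => i; rewrite /box_mnm mnmE ffunE.
have /rowP/(_ (enum_rank g)) := vA; rewrite !mxE => H; rewrite -[RHS]H.
rewrite (reindex (enum_val : 'I_#|I| -> I)); last by apply: onW_bij; exact: enum_val_bij.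
by apply: eq_bigr => r _; rewrite mcoeffZ enum_valK mxE enum_rankK gm.
Qed.

(** The [msize] of a nonzero polynomial is its degree plus 1; the successors make the bounds add
    like degrees. *)
Lemma msizeM_leS (G H : mpoly D F) a b : (msize G <= a.+1)%N -> (msize H <= b.+1)%N ->
  (msize (G * H) <= (a + b).+1)%N.
Proof.
move=> Ga Hb; have [->|G0] := eqVneq G 0; first by rewrite mul0r msize0.
have [->|H0] := eqVneq H 0; first by rewrite mulr0 msize0.
by rewrite msizeM// -subn1 leq_subLR add1n; have := leq_add Ga Hb; rewrite addSn addnS.
Qed.

Lemma msize_exp (G : mpoly D F) e k : (msize G <= e.+1)%N -> (msize (G ^+ k) <= (k * e).+1)%N.
Proof.
move=> Ge; elim: k => [|k IH]; first by rewrite expr0 msize1.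
by rewrite exprS mulSn msizeM_leS.
Qed.

Lemma msize_prod (I : Type) (s : seq I) (G : I -> mpoly D F) (e : nat) :
  (forall i, (msize (G i) <= e.+1)%N) ->
  (msize (\prod_(i <- s) G i) <= (size s * e).+1)%N.
Proof.
move=> Ge; elim: s => [|i s IH]; first by rewrite !big_nil msize1.
by rewrite big_cons mulSn msizeM_leS.
Qed.

Lemma regular_prod (I : Type) (s : seq I) (G : I -> mpoly D F) :
  (forall i, regular (G i)) -> regular (\prod_(i <- s) G i).
Proof. by move=> HG; elim/big_ind : _ => // *; apply: regularM. Qed.

Lemma regular_exp (G : mpoly D F) k : regular G -> regular (G ^+ k).
Proof. by move=> HG; elim: k => [|k IH]; rewrite ?expr0// exprS; apply: regularM. Qed.

(* Counting: the k ^ d monomials in the y_i with exponents less than k have, over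
   a common denominator, numerators of degree O(k) in D variables. *)
Lemma frac_dependent d (y : 'I_d -> {fraction S}) : (D < d)%N ->
  exists2 P : mpoly d F, P <> 0 & mmap (@FracField.tofrac S \o iota) y P = 0.
Proof.
move=> Dd.
have /choice[ab Hab] : forall i, exists ab : S * S, ab.2 != 0 /\
    y i = FracField.tofrac ab.1 / FracField.tofrac ab.2.
  by move=> i; have [a [b H]] := fraction_quotient (y i); exists (a, b).
have /choice[pq Hpq] : forall i, exists pq : mpoly D F * mpoly D F,
    regular pq.2 /\ j (ab i).1 * pi pq.2 = pi pq.1.
  by move=> i; have [P [Q H]] := rational (ab i).1; exists (P, Q).
have /choice[pq' Hpq'] : forall i, exists pq : mpoly D F * mpoly D F,
    regular pq.2 /\ j (ab i).2 * pi pq.2 = pi pq.1.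
  by move=> i; have [P [Q H]] := rational (ab i).2; exists (P, Q).
(* Formally a = P / Q and b = P' / Q' in the generators, so [y i] is [G i / G' i]. *)
pose G i := (pq i).1 * (pq' i).2; pose G' i := (pq' i).1 * (pq i).2.
pose N i := (pq i).2 * (pq' i).2.
pose e := (\max_i maxn (msize (G i)) (msize (G' i)))%N.
have Ge i : (msize (G i) <= e.+1)%N.
  by rewrite leqW// (leq_trans (leq_maxl _ (msize (G' i))))// leq_bigmax_cond.
have G'e i : (msize (G' i) <= e.+1)%N.
  by rewrite leqW// (leq_trans (leq_maxr (msize (G i)) _))// leq_bigmax_cond.
(* Chosen for (d k e + 1)^D <= (k (d e + 1))^D = k^D K < k^(D+1) <= k^d. *)
pose K := ((d * e).+1 ^ D)%N; pose k := K.+1.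
(* Numerator of the monomial y^nu over the product of the G'_i^k, a denominator common to all
   [nu]. *)
pose M (nu : {ffun 'I_d -> 'I_k}) := \prod_i (G i ^+ nu i * G' i ^+ (k - nu i)).
have Mb nu : (msize (M nu) <= (d * (k * e)).+1)%N.
  have := @msize_prod _ (enum 'I_d) (fun i => G i ^+ nu i * G' i ^+ (k - nu i)) (k * e).
  rewrite size_enum_ord big_enum.
  apply => i; have := msizeM_leS (msize_exp (nu i) (Ge i)) (msize_exp (k - nu i) (G'e i)).
  by rewrite -mulnDl subnKC// ltnW.
have big : ((d * (k * e)).+1 ^ D < #|{ffun 'I_d -> 'I_k}|)%N.
  rewrite card_ffun !card_ord.
  apply: (@leq_ltn_trans ((k * (d * e).+1) ^ D)%N).
    have le_exp (x z : nat) : (x <= z)%N -> (x ^ D <= z ^ D)%N.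
      by move=> xz; have [->|D0] := posnP D; rewrite ?expn0 ?leq_exp2r.
    by apply: le_exp; rewrite mulnS mulnCA addnC -addn1 leq_add2l.
  rewrite expnMn -/K (@leq_trans (k ^ D.+1))//; last by rewrite leq_pexp2l.
  by rewrite expnSr ltn_pmul2l// expn_gt0.
have [c [nu0 c0] cM] := linear_dependence Mb big.
exists (\sum_nu c nu *: mpolyX F (Multinom [tuple (nu i : nat) | i < d])).
  move=> /(congr1 (mcoeff (Multinom [tuple (nu0 i : nat) | i < d]))).
  rewrite mcoeff0 raddf_sum /= (bigD1 nu0)//= big1 ?addr0.
    by rewrite mcoeffZ mcoeffX eqxx mulr1 => /eqP; rewrite (negbTE c0).
  move=> nu nuE; rewrite mcoeffZ mcoeffX.
  case: eqP => [/mnmP H|_]; last by rewrite mulr0.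
  exfalso; move/eqP: nuE; apply; apply/ffunP => i; apply: val_inj.
  by have := H i; rewrite !mnmE.
pose a i := (ab i).1; pose b i := (ab i).2.
(* The value at [y] of the polynomial just given, times all [b i ^+ k]: an element of [S], to which
   [regular_inj] applies. *)
pose f := \sum_(nu : {ffun 'I_d -> 'I_k}) iota (c nu) * \prod_i (a i ^+ nu i * b i ^+ (k - nu i)).
have jf : j f * pi (\prod_i N i ^+ k) = pi (\sum_nu c nu *: M nu).
  rewrite /f !rmorph_sum /= mulr_suml; apply: eq_bigr => nu _.
  rewrite -mul_mpolyC !rmorphM /= pi_cst -mulrA; congr (_ * _).
  rewrite !rmorph_prod /= -big_split /=; apply: eq_bigr => i _.
  have [_ E1] := Hpq i; have [_ E2] := Hpq' i.
  rewrite !rmorphM !rmorphXn /= /G /G' /N !rmorphM /= -E1 -E2 -/(a i) -/(b i).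
  have -> : (pi (pq i).2 * pi (pq' i).2) ^+ k = (pi (pq i).2 * pi (pq' i).2) ^+ nu i *
      (pi (pq i).2 * pi (pq' i).2) ^+ (k - nu i).
    by rewrite -exprD subnKC// ltnW.
  rewrite mulrACA -!exprMn mulrA.
  by congr (_ ^+ _ * _ ^+ _); rewrite -!mulrA; congr (_ * _); rewrite mulrC.
have f0 : f = 0.
  apply: (@regular_inj f (\prod_i N i ^+ k)); last by rewrite jf cM rmorph0.
  apply: regular_prod => i; apply: regular_exp; apply: regularM.
    by have [] := Hpq i.
  by have [] := Hpq' i.
have b0 i : FracField.tofrac (b i) != 0 :> {fraction S}.
  by rewrite tofrac_eq0; have [] := Hab i.
have B0 : \prod_i FracField.tofrac (b i) ^+ k != 0 :> {fraction S}.
  by rewrite prodf_seq_neq0; apply/allP => i _; rewrite expf_neq0.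
apply: (mulIf B0); rewrite mul0r.
transitivity (FracField.tofrac f : {fraction S}); last by rewrite f0 tofrac0.
rewrite raddf_sum /= mulr_suml /f rmorph_sum /=; apply: eq_bigr => nu _.
rewrite mmapZ /= mmapX /mmap1 rmorphM rmorph_prod /= -mulrA; congr (_ * _).
rewrite -big_split /=; apply: eq_bigr => i _.
have [_ ->] := Hab i; rewrite -/(a i) -/(b i) mnmE !rmorphM !rmorphXn /=.
have -> : FracField.tofrac (b i) ^+ k =
    FracField.tofrac (b i) ^+ nu i * FracField.tofrac (b i) ^+ (k - nu i) :> {fraction S}.
  by rewrite -exprD subnKC// ltnW.
by rewrite mulrA -exprMn divfK.
Qed.

End Dependence.

Section FiniteTrdeg.
Variables (F : fieldType) (S : comPzRingType) (iota : {rmorphism F -> S}).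

(** By the bound there is an independent family of maximal size, which is a transcendence basis. The
    empty family starts the search: a polynomial in no variables is constant. *)
Lemma finite_trdeg_bound (domS : integral_domain S) (D : nat) :
  (forall d (y : 'I_d -> {fraction (domain_of domS)}), (D < d)%N ->
     ~ alg_independent (frac_embedding iota domS) y) ->
  finite_trdeg iota.
Proof.
move=> HD; exists domS; pose K := {fraction (domain_of domS)}.
pose P d := `[< exists x : 'I_d -> K, alg_independent (frac_embedding iota domS) x >].
have P0 : exists d, P d.
  exists 0%N; apply/asboolP; exists (fun=> 0) => Q HQ.
  have QE : Q = mpolyC 0 (mcoeff mnm0 Q).
    apply/mpolyP => m0; rewrite mcoeffC; have -> : m0 = mnm0 by apply/mnmP => -[].
    by rewrite eqxx mulr1.
  move: HQ; rewrite QE mmapC => /eqP; rewrite fmorph_eq0 => /eqP ->.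
  by rewrite mpolyC0.
have Pub d : P d -> (d <= D)%N.
  by move=> /asboolP[x xi]; rewrite leqNgt; apply/negP => /(HD d x).
case: (ex_maxnP P0 Pub) => d /asboolP[x xi] dmax; exists d, x; split => // y yi.
have /dmax : P d.+1 by apply/asboolP; exists (add_elt y x).
by rewrite ltnn.
Qed.

End FiniteTrdeg.

Section ObservationTrdeg.
Context {R : realType} {m q : nat} {U : set 'cV[R]_m} (p : io_map q U).
Variable domS : integral_domain (Aobs p).

(* [domain_of domS] is a copy of [Aobs p]: the morphisms from and to it have to be
   declared anew. *)
Definition obs_val (a : domain_of domS) : Upc U -> {nonneg R} -> R := val (a : Aobs p).

Lemma obs_val_zmod : zmod_morphism obs_val.
Proof. by []. Qed.

Lemma obs_val_monoid : monoid_morphism obs_val.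
Proof. by []. Qed.

HB.instance Definition _ := GRing.isZmodMorphism.Build
  (domain_of domS) (Upc U -> {nonneg R} -> R) obs_val obs_val_zmod.
HB.instance Definition _ := GRing.isMonoidMorphism.Build
  (domain_of domS) (Upc U -> {nonneg R} -> R) obs_val obs_val_monoid.

Definition dom_const (a : R) : domain_of domS := obs_const p a.

Lemma dom_const_zmod : zmod_morphism dom_const.
Proof. exact: obs_const_zmod. Qed.

Lemma dom_const_monoid : monoid_morphism dom_const.
Proof. exact: obs_const_monoid. Qed.

HB.instance Definition _ := GRing.isZmodMorphism.Build
  R (domain_of domS) dom_const dom_const_zmod.
HB.instance Definition _ := GRing.isMonoidMorphism.Build
  R (domain_of domS) dom_const dom_const_monoid.

Context {D : nat} (z : 'I_D -> Upc U -> {nonneg R} -> R).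

Lemma poly_map_zmod : zmod_morphism (poly_map z).
Proof.
move=> P Q; apply/funext => u; apply/funext => t; exact: mevalB.
Qed.

Lemma poly_map_monoid : monoid_morphism (poly_map z).
Proof.
split; first by apply/funext => u; apply/funext => t; exact: meval1.
by move=> P Q; exact: poly_mapM.
Qed.

HB.instance Definition _ := GRing.isZmodMorphism.Build
  (mpoly D R) (Upc U -> {nonneg R} -> R) (poly_map z) poly_map_zmod.
HB.instance Definition _ := GRing.isMonoidMorphism.Build
  (mpoly D R) (Upc U -> {nonneg R} -> R) (poly_map z) poly_map_monoid.

Lemma obs_dependent d (y : 'I_d -> {fraction (domain_of domS)}) : (D < d)%N ->
  poly_map z 1 <> 0 ->
  (forall P Q, poly_map z P <> 0 -> poly_map z Q <> 0 -> poly_map z (P * Q) <> 0) ->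
  (forall (a : Aobs p) Q, poly_map z Q <> 0 -> val a * poly_map z Q = 0 -> a = 0) ->
  (forall a : Aobs p, exists P Q, poly_map z Q <> 0 /\ val a * poly_map z Q = poly_map z P) ->
  ~ alg_independent (frac_embedding (obs_const p) domS) y.
Proof.
move=> Dd p1 pM inj rat ind.
have [|||P P0 PE] := @frac_dependent R (domain_of domS) (Upc U -> {nonneg R} -> R) D
  dom_const obs_val (poly_map z) _ (fun Q => poly_map z Q <> 0) p1 pM _ _ d y Dd.
- by move=> c; exact: poly_mapC.
- exact: inj.
- exact: rat.
- by apply: P0; apply: ind; exact: PE.
Qed.

End ObservationTrdeg.

Theorem theorem2 (R : realType) (m q : nat) (U : set 'cV[R]_m)
    (p : io_map q U) :
  finite_set U -> U !=set0 ->
  (exists (n : nat) (Sigma : rnn n q U),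
     assumption_A1 (activation Sigma) /\ realization Sigma p) ->
  [/\ causal_io p, analytic_io p & finite_trdeg (obs_const p)].
Proof.
move=> finU [a0 Ua0] [n [Sigma [[act_an [N [xi [Up [Vp A1]]]]] real_p]]].
have /= [_ xi_an V0 act_rat xi_rat] := A1.
(* A value in [U] makes [Upc U] inhabited, so that the constant maps 0 and 1 differ. *)
pose u0 : U := SigSub (mem_set Ua0).
have [inputs inputsE] : exists s : seq 'cV[R]_m, U = [set` s] by exact/finite_seqP.
have solE u : exists x, is_solution Sigma (val u) x (val (p u)).
  by have [[x y] [[H _] /= ->]] := real_p u; exists x.
pose X u := sval (cid (solE u)); pose Y u := val (p u).
have sol u : is_solution Sigma (val u) (X u) (Y u) by rewrite /X; case: cid.
pose z := generators Sigma X (inputs := inputs) xi.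
have sz : forall k, state_map X (z k) := generators_state Sigma X (inputs := inputs) xi_an.
have rDop alpha phi : rational_map X z phi -> rational_map X z (Dop alpha phi).
  apply: (rational_Dop sol act_an u0 sz) => beta k.
  exact: (rational_Dop_generators sol act_an u0 inputsE xi_an V0 act_rat xi_rat).
have rout k : rational_map X z (component p k) := rational_output sol act_an u0 inputs xi_an k.
have obs_rat phi : obs_set p phi -> rational_map X z phi.
  (* [obs_set] is an intersection, and the rational maps form one of the algebras intersected. *)
  apply; split => //.
  - by move=> psi [spsi _]; exact: (state_map_AUpc sol act_an spsi).
  - split.
    + exact: (rational_cst u0 sz).
    + exact: (rational_add sol act_an u0 sz).
    + exact: (rational_mul sol act_an u0 sz).
have val_rat (a : Aobs p) : rational_map X z (val a).
  by apply: obs_rat; have /set_mem := valP a.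
have dom phi psi : state_map X phi -> state_map X psi -> phi * psi = 0 ->
    phi = 0 \/ psi = 0 := fun s1 s2 => state_map_domain sol act_an u0 s1 s2.
split.
- move=> t u v uv s st; have [_ _ _ yu] := sol u; have [_ _ _ yv] := sol v.
  rewrite -[LHS]/(Y u s) -[RHS]/(Y v s) yu yv.
  rewrite (sol_causal_num sol (u := u) (v := v))// => w ws.
  by apply: uv; rewrite (le_trans (ltW ws)).
- by move=> k; apply: (state_map_analytic sol act_an); have [] := rout k.
have domS : integral_domain (Aobs p).
  split.
    move=> /(congr1 (fun a : Aobs p => val a)) /=.
    by apply: (cst_neq0 u0); apply/eqP; rewrite oner_eq0.
  move=> x y /(congr1 (fun a : Aobs p => val a)) /= xy.
  have [||E|E] := dom (val x) (val y) _ _ xy; [by case: (val_rat x)|by case: (val_rat y)| |].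
    by left; apply: val_inj.
  by right; apply: val_inj.
apply: (@finite_trdeg_bound _ _ _ domS #|{: @generator_index R m n inputs N}|) => d y Dd.
apply: (@obs_dependent _ _ _ _ p domS _ z d y Dd).
- by rewrite -mpolyC1 poly_mapC; apply: (cst_neq0 u0); apply/eqP; rewrite oner_eq0.
- exact: (poly_map_neq0M sol act_an u0 sz).
- move=> a Q Q0 aQ; have [||E|//] := dom (val a) (poly_map z Q) _ _ aQ.
  + by case: (val_rat a).
  + exact: (poly_map_state_map sz).
  + exact: val_inj.
- by move=> a; have [_ H] := val_rat a.
Qed.
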